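(* Let $(B,g_B)$ be a nondegenerate semi-Riemannian manifold, $(F,g_F)$ a semi-regular semi-Riemannian manifold and $f\in C^\infty(B)$, so that $B\times_fF$ is a semi-regular warped product. Let $X,Y,Z,T\in\Gamma(TB)$ and $U,V,W,Q\in\Gamma(TF)$ (lifted), and let $P\in\Gamma(TF)$ (lifted). Let $\overline R$ be the curvature of the semi-symmetric metric covariant derivative on $B\times_fF$ associated with $P$, and $R_B$, $R_F$ the Riemann curvatures of $B$ and $F$. Then: (1) $\overline R(X,Y,Z,T)=R_B(X,Y,Z,T)+f^2g_B(X,Z)g_F(P,P)g_B(Y,T)-f^2g_B(Y,Z)g_F(P,P)g_B(X,T)$; (2) $\overline R(X,Y,Z,Q)=-\overline R(Z,Q,X,Y)=-fX(f)g_B(Y,Z)g_F(P,Q)+fY(f)g_B(X,Z)g_F(P,Q)$; (3) $\overline R(X,Y,W,Q)=\overline R(W,Q,X,Y)=0$; (4) $\overline R(X,V,W,T)=-fH^f(X,T)g_F(V,W)-\big[\mathcal K_F(V,P,W)+f^2g_F(P,P)g_F(V,W)-f^2g_F(V,P)g_F(P,W)\big]f^2g_B(X,T)$; (5) $\overline R(U,V,Z,Q)=-\overline R(Z,Q,U,V)=f^3Z(f)\big[-g_F(P,U)g_F(Q,V)+g_F(P,V)g_F(Q,U)\big]$; (6) $\overline R(U,V,W,Q)=f^2R_F(U,V,W,Q)+f^2g_B^*(df,df)\big[g_F(U,W)g_F(V,Q)-g_F(V,W)g_F(U,Q)\big]-f^6g_F(V,P)g_F(U,W)g_F(P,Q)+f^6g_F(U,P)g_F(V,W)g_F(P,Q)+f^4\mathcal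 K_F(U,P,W)g_F(V,Q)-f^4\mathcal K_F(V,P,W)g_F(U,Q)-f^4\mathcal K_F(U,P,Q)g_F(V,W)+f^4\mathcal K_F(V,P,Q)g_F(U,W)+f^6g_F(P,P)g_F(U,W)g_F(V,Q)-f^6g_F(U,P)g_F(P,W)g_F(V,Q)-f^6g_F(P,P)g_F(V,W)g_F(U,Q)+f^6g_F(V,P)g_F(P,W)g_F(U,Q)$.
   Context: A singular semi-Riemannian manifold $(M,g)$ is a smooth manifold with a smooth symmetric $(0,2)$-tensor field $g=\langle\cdot,\cdot\rangle$, possibly degenerate and of varying signature. The Koszul form is $\mathcal K(X,Y,Z)=\tfrac12\{X\langle Y,Z\rangle+Y\langle Z,X\rangle-Z\langle X,Y\rangle-\langle X,[Y,Z]\rangle+\langle Y,[Z,X]\rangle+\langle Z,[X,Y]\rangle\}$; for a vector field $P$, $\overline{\mathcal K}(X,Y,Z)=\mathcal K(X,Y,Z)+g(Y,P)g(X,Z)-g(X,Y)g(P,Z)$. Put $\nabla^\flat_XY:=\mathcal K(X,Y,\cdot)$ and $\overline\nabla^\flat_XY:=\overline{\mathcal K}(X,Y,\cdot)$. $\mathcal A^\bullet(M)$ is the set of smooth 1-forms $\omega$ such that for each $p$ there is $u\in T_pM$ with $\omega_p=\langle u,\cdot\rangle$. For covectors $\omega_p=\langle u,\cdot\rangle$, $\tau_p=\langle v,\cdot\rangle$ put $\langle\langle\omega,\tau\rangle\rangle_\bullet=\langle u,v\rangle$. For radical-stationary manifolds (i.e. $\nabla^\flat_XY\in\mathcal A^\bullet(M)$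 for all $X,Y$) and $\omega\in\mathcal A^\bullet(M)$, $(\nabla_X\omega)(Y)=X(\omega(Y))-\langle\langle\nabla^\flat_XY,\omega\rangle\rangle_\bullet$ and $(\overline\nabla_X\omega)(Y)=X(\omega(Y))-\langle\langle\overline\nabla^\flat_XY,\omega\rangle\rangle_\bullet$, smooth on the regions of constant signature (an open dense set); elsewhere values are understood by smooth extension when it exists. $(M,g)$ is semi-regular if $\nabla^\flat_XY\in\mathcal A^\bullet(M)$ and $\nabla_Z(\nabla^\flat_XY)\in\mathcal A^\bullet(M)$ for all $X,Y,Z$. Curvatures: $R(X,Y,Z,T)=(\nabla_X\nabla^\flat_YZ)(T)-(\nabla_Y\nabla^\flat_XZ)(T)-(\nabla^\flat_{[X,Y]}Z)(T)$ and $\overline R(X,Y,Z,T)=(\overline\nabla_X\overline\nabla^\flat_YZ)(T)-(\overline\nabla_Y\overline\nabla^\flat_XZ)(T)-(\overline\nabla^\flat_{[X,Y]}Z)(T)$. For singular semi-Riemannian manifolds $(B,g_B)$, $(F,g_F)$ and $f\in C^\infty(B)$ (possibly with zeros), $B\times_fF$ is $B\times F$ with the metric $\pi_B^*(g_B)+(f\circ\pi_B)^2\pi_F^*(g_F)$. Objects on $B$, $F$ are identified with their lifts. Subscripts $B$, $F$ denote the objects of the factors ($\mathcal K_F$ is the Koszul form of $F$). $g_B^*$ is the inner product induced by the nondegenerate $g_B$ on 1-forms, and $H^f(X,T)=X(T(f))-(\nabla^B_XT)(f)$ is the Hessian of $f$, with $\nabla^B$ the Levi-Civita connection of $g_B$.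 *)

(* Defs.v *)
From HB Require Import structures.
From mathcomp Require Import all_boot all_order all_algebra.
From mathcomp Require Import all_classical all_reals all_analysis.

Set Implicit Arguments.
Unset Strict Implicit.
Unset Printing Implicit Defensive.

Import Order.TTheory GRing.Theory Num.Theory.
Import numFieldNormedType.Exports.

Local Open Scope classical_set_scope.
Local Open Scope ring_scope.

(* Meant for open [U]. *)
Fixpoint Ck (R : realType) (n : nat) (k : nat) (U : set 'rV[R]_n)
    (h : 'rV[R]_n -> R) : Prop :=
  match k with
  | 0 => forall z, U z -> {for z, continuous h}
  | k'.+1 => (forall z, U z -> differentiable h z) /\
             forall v, Ck k' U (fun z => 'D_v h z)
  end.

Definition Csmooth (R : realType) (n : nat) (U : set 'rV[R]_n)
  (h : 'rV[R]_n -> R) : Prop := forall k, Ck k U h.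

(* A smooth manifold, presented by an atlas indexed by the points of [M]:
   [phi p] is a chart defined on the neighbourhood [mdom p] of [p], with inverse
   [psi p].  The chart [phi p] is also used to identify T_pM with R^n, so a
   tangent vector at [p] is the row of its components in the coordinate basis
   of that chart. *)
Record manifold (R : realType) := Manifold {
  mpt :> topologicalType;
  mdim : nat;
  mdom : mpt -> set mpt;
  phi : mpt -> mpt -> 'rV[R]_mdim;
  psi : mpt -> 'rV[R]_mdim -> mpt;
  mdom_open : forall p, open (mdom p);
  mdom_self : forall p, mdom p p;
  phiK : forall p x, mdom p x -> psi p (phi p x) = x;
  phi_open : forall p, open (phi p @` mdom p);
  phi_cont : forall p x, mdom p x -> {for x, continuous (phi p)};
  psi_cont : forall p z, (phi p @` mdom p) z -> {for z, continuous (psi p)};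
  transition_smooth : forall p q j,
    Csmooth (phi p @` (mdom p `&` mdom q)) (fun z => phi q (psi p z) 0 j);
  mfd_hausdorff : hausdorff_space mpt;
  mfd_second_countable : @second_countable mpt
}.

Section ProductManifold.
Context {R : realType}.

Lemma Ck_sub n k (U V : set 'rV[R]_n) h : V `<=` U -> Ck k U h -> Ck k V h.
Proof.
move=> VU; elim: k h => [|k IH] h /=; first by move=> H z /VU; exact: H.
by move=> [H1 H2]; split=> [z /VU|v]; [exact: H1|exact/IH/H2].
Qed.

Lemma Ck_comp_linear m n (L : {linear 'rV[R]_m -> 'rV[R]_n}) k U h :
  continuous L -> Ck k U h -> Ck k (L @^-1` U) (h \o L).
Proof.
move=> Lc; elim: k h => [|k IH] h /=.
  by move=> H z Uz; apply: continuous_comp; [exact: Lc|exact: H].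
move=> [H1 H2]; split=> [z Uz|v].
  apply: differentiable_comp; last exact: H1.
  exact: linear_differentiable.
have -> : (fun z => 'D_v (h \o L) z) = (fun y => 'D_(L v) h y) \o L.
  apply/funext => z /=; rewrite /derive.
  apply: (congr1 (fun g : R -> R => lim (g @ 0^'))).
  by apply/funext => t /=; rewrite (linearP L).
exact/IH/H2.
Qed.

Lemma hausdorff_prod (S T : topologicalType) :
  hausdorff_space S -> hausdorff_space T -> hausdorff_space (S * T)%type.
Proof.
move=> HS HT [p1 p2] [q1 q2] cl; congr pair.
- apply: HS => A A' Ap Aq.
  have nA : nbhs (p1, p2) (A `*` setT).
    by exists (A, setT) => //; split=> //=; exact: (@filterT _ _ (nbhs_filter _)).
  have nA' : nbhs (q1, q2) (A' `*` setT).
    by exists (A', setT) => //; split=> //=; exact: (@filterT _ _ (nbhs_filter _)).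
  by have [[x1 x2] [[/= ? _] [/= ? _]]] := cl _ _ nA nA'; exists x1.
- apply: HT => A A' Ap Aq.
  have nA : nbhs (p1, p2) (setT `*` A).
    by exists (setT, A) => //; split=> //=; exact: (@filterT _ _ (nbhs_filter _)).
  have nA' : nbhs (q1, q2) (setT `*` A').
    by exists (setT, A') => //; split=> //=; exact: (@filterT _ _ (nbhs_filter _)).
  by have [[x1 x2] [[/= _ ?] [/= _ ?]]] := cl _ _ nA nA'; exists x2.
Qed.

Lemma open_setX (S T : topologicalType) (A : set S) (C : set T) :
  open A -> open C -> open (A `*` C).
Proof.
rewrite !openE => oA oC [x y] [/= Ax Cy].
by exists (A, C) => //; split; [exact: oA|exact: oC].
Qed.

Lemma second_countable_prod (S T : topologicalType) :
  @second_countable S -> @second_countable T -> @second_countable (S * T)%type.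
Proof.
move=> [B1 cB1 [oB1 bB1]] [B2 cB2 [oB2 bB2]].
exists [set U | exists2 V, (B1 `*` B2) V & V.1 `*` V.2 = U].
  have := countableX cB1 cB2; exact: sub_countable (card_image_le _ _).
split=> [U [[V1 V2] [/= b1 b2] <-]|[x y] U [[A C] [/= nA nC] ACU]].
  by apply: open_setX; [exact: oB1|exact: oB2].
have [V1 [/= BV1 V1x] V1A] := bB1 x A nA.
have [V2 [/= BV2 V2y] V2C] := bB2 y C nC.
exists (V1 `*` V2); first by split=> //; exists (V1, V2).
by move=> [u v] [/= /V1A ? /V2C ?]; exact: ACU.
Qed.

Lemma continuous_row_mx (S : topologicalType) m n
    (a : S -> 'rV[R]_m) (b : S -> 'rV[R]_n) x :
  {for x, continuous a} -> {for x, continuous b} ->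
  {for x, continuous (fun y => row_mx (a y) (b y))}.
Proof.
move=> ca cb A [P nP PA].
have na : nbhs x (a @^-1` [set M | forall i j, P i (lshift n j) (M i j)]).
  apply: ca; exists (fun i j => P i (lshift n j)) => // i j.
  by have := nP i (lshift n j); rewrite row_mxEl.
have nb : nbhs x (b @^-1` [set M | forall i j, P i (rshift m j) (M i j)]).
  apply: cb; exists (fun i j => P i (rshift m j)) => // i j.
  by have := nP i (rshift m j); rewrite row_mxEr.
apply: filterS (filterI na nb) => y [/= ya yb]; apply: PA => i j.
by rewrite mxE; case: split_ordP => k ->; [exact: ya|exact: yb].
Qed.

Variables B F : manifold R.

Definition prod_dom (p : B * F) : set (B * F) := mdom p.1 `*` mdom p.2.
Definition prod_phi (p x : B * F) : 'rV[R]_(mdim B + mdim F) :=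
  row_mx (phi p.1 x.1) (phi p.2 x.2).
Definition prod_psi (p : B * F) (z : 'rV[R]_(mdim B + mdim F)) : B * F :=
  (psi p.1 (lsubmx z), psi p.2 (rsubmx z)).

Lemma prod_imageE p (U : set B) (V : set F) :
  prod_phi p @` (U `*` V) =
  lsubmx @^-1` (phi p.1 @` U) `&` rsubmx @^-1` (phi p.2 @` V).
Proof.
apply/seteqP; split=> [_ [[x y] [/= Ux Vy] <-]|z [/= [x Ux xz] [y Vy yz]]].
  by split; rewrite /= /prod_phi ?row_mxKl ?row_mxKr; [exists x|exists y].
by exists (x, y) => //; rewrite /prod_phi /= xz yz hsubmxK.
Qed.

Lemma prod_dom_open p : open (prod_dom p).
Proof. by apply: open_setX; exact: mdom_open. Qed.

Lemma prod_dom_self p : prod_dom p p.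
Proof. by split; exact: mdom_self. Qed.

Lemma prod_phiK p x : prod_dom p x -> prod_psi p (prod_phi p x) = x.
Proof.
case: x => x y [/= px py].
by rewrite /prod_psi /prod_phi row_mxKl row_mxKr !phiK.
Qed.

Lemma prod_phi_open p : open (prod_phi p @` prod_dom p).
Proof.
rewrite prod_imageE; apply: openI; apply: open_comp; try exact: phi_open.
- by move=> *; exact: continuous_lsubmx.
- by move=> *; exact: continuous_rsubmx.
Qed.

Lemma prod_phi_cont p x : prod_dom p x -> {for x, continuous (prod_phi p)}.
Proof.
case: x => x y [/= px py]; apply: continuous_row_mx.
- apply: (@continuous_comp _ _ _ fst (phi p.1)); first exact: cvg_fst.
  exact: phi_cont.
- apply: (@continuous_comp _ _ _ snd (phi p.2)); first exact: cvg_snd.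
  exact: phi_cont.
Qed.

Lemma prod_psi_cont p z :
  (prod_phi p @` prod_dom p) z -> {for z, continuous (prod_psi p)}.
Proof.
rewrite prod_imageE => -[/= lz rz].
have c1 : {for z, continuous (psi p.1 \o lsubmx)}.
  by apply: continuous_comp; [exact: continuous_lsubmx|exact: psi_cont].
have c2 : {for z, continuous (psi p.2 \o rsubmx)}.
  by apply: continuous_comp; [exact: continuous_rsubmx|exact: psi_cont].
exact: cvg_pair c1 c2.
Qed.

Lemma prod_transition_smooth p q j :
  Csmooth (prod_phi p @` (prod_dom p `&` prod_dom q))
    (fun z => prod_phi q (prod_psi p z) 0 j).
Proof.
have sub z : (prod_phi p @` (prod_dom p `&` prod_dom q)) z ->
    (phi p.1 @` (mdom p.1 `&` mdom q.1)) (lsubmx z) /\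
    (phi p.2 @` (mdom p.2 `&` mdom q.2)) (rsubmx z).
  move=> [[x y] [/= [/= ? ?] [/= ? ?]] <-].
  by rewrite /prod_phi /= row_mxKl row_mxKr; split; [exists x|exists y].
move=> k; case: (split_ordP j) => i ->.
- under eq_fun => z do rewrite /prod_phi row_mxEl /=.
  apply: (@Ck_sub _ _ (lsubmx @^-1` (phi p.1 @` (mdom p.1 `&` mdom q.1)))).
    by move=> z /sub[].
  apply: (@Ck_comp_linear _ _ lsubmx k _ (fun y => phi q.1 (psi p.1 y) 0 i)).
    exact: continuous_lsubmx.
  exact: transition_smooth.
- under eq_fun => z do rewrite /prod_phi row_mxEr /=.
  apply: (@Ck_sub _ _ (rsubmx @^-1` (phi p.2 @` (mdom p.2 `&` mdom q.2)))).
    by move=> z /sub[].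
  apply: (@Ck_comp_linear _ _ rsubmx k _ (fun y => phi q.2 (psi p.2 y) 0 i)).
    exact: continuous_rsubmx.
  exact: transition_smooth.
Qed.

Definition prod_manifold : manifold R :=
  Manifold prod_dom_open prod_dom_self prod_phiK prod_phi_open prod_phi_cont
    prod_psi_cont prod_transition_smooth
    (hausdorff_prod (@mfd_hausdorff R B) (@mfd_hausdorff R F))
    (second_countable_prod (@mfd_second_countable R B)
       (@mfd_second_countable R F)).

End ProductManifold.

Section Geometry.
Context {R : realType} (M : manifold R).
Local Notation n := (mdim M).

Definition vfield := M -> 'rV[R]_n.
(* [w p] is the column of components of a covector at [p] in the basis dual to
   the coordinate basis of [phi p]. *)
Definition oneform := M -> 'cV[R]_n.
(* [g p] is the Gram matrix at [p] in the coordinate basis of [phi p]. *)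
Definition tensor2 := M -> 'M[R]_n.

Definition smooth_fun (U : set M) (h : M -> R) : Prop :=
  forall p, Csmooth (phi p @` (U `&` mdom p)) (h \o psi p).

Definition act (X : vfield) (h : M -> R) : M -> R :=
  fun p => 'D_(X p) (h \o psi p) (phi p p).

Definition smooth_vfield (U : set M) (X : vfield) : Prop :=
  forall (V : set M) (h : M -> R), open V -> V `<=` U ->
    smooth_fun V h -> smooth_fun V (act X h).

(* The components in [phi p] of a tangent vector at [p] are its values on the
   coordinate functions of [phi p]. *)
Definition lie (X Y : vfield) : vfield := fun p =>
  \row_j (act X (act Y (fun x => phi p x 0 j)) p -
          act Y (act X (fun x => phi p x 0 j)) p).

Definition pairing (w : oneform) (X : vfield) : M -> R :=
  fun p => (X p *m w p) 0 0.

Definition smooth_oneform (w : oneform) : Prop :=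
  forall (U : set M) (X : vfield), open U ->
    smooth_vfield U X -> smooth_fun U (pairing w X).

Definition dform (h : M -> R) : oneform := fun p =>
  \col_i 'D_(delta_mx 0 i) (h \o psi p) (phi p p).

(* The i-th coordinate vector field of the chart [phi p], defined on [mdom p];
   at [q] its components refer to [phi q]. *)
Definition coord_field (p : M) (i : 'I_n) : vfield := fun q =>
  \row_j 'D_(delta_mx 0 i) (fun z => phi q (psi p z) 0 j) (phi p q).

Definition bil (g : tensor2) (p : M) (u v : 'rV[R]_n) : R :=
  (u *m g p *m v^T) 0 0.

Definition inner (g : tensor2) (X Y : vfield) : M -> R :=
  fun p => bil g p (X p) (Y p).

Definition is_metric (g : tensor2) : Prop :=
  (forall p, (g p)^T = g p) /\
  (forall (U : set M) (X Y : vfield), open U ->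
     smooth_vfield U X -> smooth_vfield U Y -> smooth_fun U (inner g X Y)).

Definition nondegenerate_metric (g : tensor2) : Prop :=
  forall p u, (forall v, bil g p u v = 0) -> u = 0.

(* [s] negative and [t] positive directions; the radical has dimension
   n - s - t. *)
Definition has_signature (A : 'M[R]_n) (s t : nat) : Prop :=
  exists e : 'M[R]_n, exists d : 'rV[R]_n,
    [/\ e \in unitmx, e *m A *m e^T = diag_mx d,
        #|[pred i | d 0 i < 0]| = s & #|[pred i | 0 < d 0 i]| = t].

Definition constant_signature (g : tensor2) : set M :=
  [set p | exists s t, \forall q \near p, has_signature (g q) s t].

Definition koszul (g : tensor2) (X Y Z : vfield) : M -> R := fun p =>
  2^-1 * (act X (inner g Y Z) p + act Y (inner g Z X) p - act Z (inner g X Y) p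
          - inner g X (lie Y Z) p + inner g Y (lie Z X) p
          + inner g Z (lie X Y) p).

Definition koszul_bar (g : tensor2) (P X Y Z : vfield) : M -> R := fun p =>
  koszul g X Y Z p + inner g Y P p * inner g X Z p
                   - inner g X Y p * inner g P Z p.

(* In the next definitions [K] is [koszul g] or [koszul_bar g P]. *)

(* The one-form K(X,Y,.).  As K is tensorial in its last argument, the
   components at [p] are obtained from the coordinate fields around [p]. *)
Definition lower (K : vfield -> vfield -> vfield -> M -> R) (X Y : vfield)
  : oneform := fun p => \col_i K X Y (coord_field p i) p.

Definition represents (g : tensor2) (p : M) (w : 'cV[R]_n) (u : 'rV[R]_n) :=
  forall v, (v *m w) 0 0 = bil g p u v.

Definition Abullet (g : tensor2) : set oneform :=
  [set w | smooth_oneform w /\ forall p, exists u, represents g p (w p) u].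

Definition representative (g : tensor2) (p : M) (w : 'cV[R]_n) : 'rV[R]_n :=
  xget 0 [set u | represents g p w u].

(* For nondegenerate [g] this is the induced inner product on one-forms. *)
Definition coinner (g : tensor2) (w t : oneform) : M -> R := fun p =>
  bil g p (representative g p (w p)) (representative g p (t p)).

(* When [D] is dense there is at most one such [r]; without one, [h] is kept. *)
Definition smooth_extension (D : set M) (h : M -> R) : M -> R :=
  xget h [set r | smooth_fun setT r /\ forall p, D p -> r p = h p].

(* The extension is not cosmetic: with g = dx^2 + x^2 dt^2 on R^2, <<x dt, x dt>>
   is 1 for x <> 0 and 0 on x = 0. *)
Definition dual_derivative (g : tensor2)
    (K : vfield -> vfield -> vfield -> M -> R) (X : vfield) (w : oneform)
    (Y : vfield) : M -> R :=
  smooth_extension (constant_signature g)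
    (fun p => act X (pairing w Y) p - coinner g (lower K X Y) w p).

Definition curvature (g : tensor2) (K : vfield -> vfield -> vfield -> M -> R)
    (X Y Z T : vfield) : M -> R := fun p =>
  dual_derivative g K X (lower K Y Z) T p
  - dual_derivative g K Y (lower K X Z) T p
  - pairing (lower K (lie X Y) Z) T p.

Definition riemann (g : tensor2) := curvature g (koszul g).

Definition riemann_bar (g : tensor2) (P : vfield) :=
  curvature g (koszul_bar g P).

Definition radical_stationary (g : tensor2) : Prop :=
  forall X Y, smooth_vfield setT X -> smooth_vfield setT Y ->
    Abullet g (lower (koszul g) X Y).

Definition semi_regular (g : tensor2) : Prop :=
  radical_stationary g /\
  forall X Y Z, smooth_vfield setT X -> smooth_vfield setT Y ->
    smooth_vfield setT Z ->
    exists2 w, Abullet g w & forall T, smooth_vfield setT T ->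
      dual_derivative g (koszul g) Z (lower (koszul g) X Y) T = pairing w T.

Definition levi_civita (g : tensor2) (X Y : vfield) : vfield := fun p =>
  representative g p (lower (koszul g) X Y p).

Definition hessian (g : tensor2) (h : M -> R) (X T : vfield) : M -> R :=
  fun p => act X (act T h) p - act (levi_civita g X T) h p.

End Geometry.

Section WarpedProduct.
Context {R : realType} (B F : manifold R).

(* The chart of the product at (p,q) is the product of the charts at [p] and
   [q], so T_(p,q)(B x F) = T_pB (+) T_qF is the block decomposition of rows. *)
Definition liftB (X : vfield B) : vfield (prod_manifold B F) :=
  fun x => row_mx (X x.1) 0.

Definition liftF (V : vfield F) : vfield (prod_manifold B F) :=
  fun x => row_mx 0 (V x.2).

Definition warped (f : B -> R) (gB : tensor2 B) (gF : tensor2 F)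
  : tensor2 (prod_manifold B F) :=
  fun x => block_mx (gB x.1) 0 0 (f x.1 ^+ 2 *: gF x.2).

End WarpedProduct.

(* Main.v *)
(* Write a form of the warped product as a pair of forms of the factors.  The lower
   derivative K(A,C,.) of two lifts is then represented at every point by an explicit
   vector, with f^-1 X(f) V for the F-part of K(X,V,.); so <<K(A,E,.),K(C,D,.)>> is
   computed by bilinearity, up to a factor f^2 f^-2.  Replacing that factor by 1 gives
   a smooth function which agrees with the original on the regions of constant
   signature: there, if f vanishes at b, then df vanishes at b or g_F vanishes at the
   other coordinate.  These regions are dense, because the numbers of positive and of
   negative signs are lower semicontinuous, so smooth extensions are unique and all the
   covariant derivatives (nabla_A K(C,D,.))(E) of lifts are known.  The curvature
   formulas follow from them by compatibility with the metric and absence of torsion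
   of the Koszul forms of the factors. *)
Require Import Defs.
From HB Require Import structures.
From mathcomp Require Import all_boot all_order all_algebra.
From mathcomp Require Import all_classical all_reals all_analysis.
From mathcomp Require Import ring lra zify.

Set Implicit Arguments.
Unset Strict Implicit.
Unset Printing Implicit Defensive.

Import Order.TTheory GRing.Theory Num.Theory.
Import numFieldNormedType.Exports.

Local Open Scope classical_set_scope.
Local Open Scope ring_scope.

(** * Functions of class C^k on open sets *)

Section Smooth.
Context {R : realType}.

(** A covariant derivative of a form is a smooth extension obtained by choice, so nothing can be
    computed from it directly at a zero of [f]: every formula needs a globally smooth candidate.
    Besides the quotient by [f], the factor F causes a difficulty. The product <<K_F(U,Q,.),
    K_F(V,W,.)>> need not be smooth on F, and semi-regularity only controls the extended derivative
    of K_F(V,W,.) along U. The candidate therefore contains U(K_F(V,W,Q)) minus that derivative: it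
    has the right value where [f] is nonzero, because constancy of the signature then passes to F,
    and elsewhere the factor f^2 removes the difference. The other constraint comes from
    coordinates. A tangent vector at p is written in the chart chosen at p, and this choice has no
    continuity in p; smoothness and semicontinuity are hence proved in the coordinate frame of one
    fixed chart. Such frames are only local fields, so the Koszul identities for lifts are stated
    for arbitrary fields and rely on default values of derivatives. *)

Lemma near_differentiable (V W : normedModType R) (f g : V -> W) x :
  {near x, f =1 g} -> differentiable f x -> differentiable g x.
Proof.
(* [k] vanishes near [x], so it is differentiable there with differential 0, and [g] is the sum of
   [f] and [k]. *)
move=> fg df; pose k : V -> W := g - f.
have -> : g = f + k by apply/funext => y; rewrite /k !fctE addrC subrK.
apply: differentiableD => //.
have kE : k \o shift x = cst (k x) + (\0 : V -> W) +o_ 0 id.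
  have k0 : k x = 0 by rewrite /k !fctE (nbhs_singleton fg) subrr.
  apply/eqaddoP => e e0.
  have := fg; rewrite [X in X -> _](near_shift 0) => H.
  apply: (@filterS _ (nbhs (0 : V)) _ _ _ _ H) => y /=.
  rewrite subr0 !fctE k0 /k !fctE => ->.
  rewrite subrr add0r [0 + _]add0r oppr0 normr0.
  by apply: mulr_ge0; [exact: ltW|exact: normr_ge0].
have d0 : 'd k x = (\0 : V -> W) :> (V -> W).
  by apply: diff_unique => //; exact: cst_continuous.
apply/diff_locallyP; rewrite d0; split=> //; exact: cst_continuous.
Qed.

Lemma near_continuous (S T : topologicalType) (f g : S -> T) x :
  (\forall y \near x, f y = g y) -> {for x, continuous f} ->
  {for x, continuous g}.
Proof.
move=> fg cf; rewrite /prop_for /continuous_at -(nbhs_singleton fg) => A nA.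
by apply: filterS2 fg (cf A nA) => y /= <-.
Qed.

Lemma open_nearP (T : topologicalType) (U : set T) (P : T -> Prop) z :
  open U -> U z -> (forall x, U x -> P x) -> \forall x \near z, P x.
Proof. by move=> oU Uz UP; apply: (filterS UP); exact: open_nbhs_nbhs. Qed.

(** [Ck] differentiates total functions, whereas the rules of calculus give derivatives on [U] only;
    this lemma carries such formulas through the recursion. Openness makes the two functions agree
    near each point of [U]. *)
Lemma Ck_eq n k (U : set 'rV[R]_n) h h' : open U ->
  (forall z, U z -> h z = h' z) -> Ck k U h -> Ck k U h'.
Proof.
move=> oU; elim: k h h' => [|k IH] h h' e /=.
  by move=> H z Uz; apply: near_continuous (H z Uz); exact: (open_nearP oU).
move=> [H1 H2]; split=> [z Uz|v].
  by apply: near_differentiable (H1 z Uz); exact: (open_nearP oU).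
by apply: IH (H2 v) => z Uz; apply: near_eq_derive; exact: (open_nearP oU).
Qed.

Lemma CkS n k (U : set 'rV[R]_n) h : Ck k.+1 U h -> Ck k U h.
Proof.
elim: k h => [|k IH] h [H1 H2]; first by move=> z /H1; exact: differentiable_continuous.
by split=> // v; exact/IH/H2.
Qed.

Lemma Ck_cst n k (U : set 'rV[R]_n) c : Ck k U (cst c).
Proof.
elim: k c => [|k IH] c /=; first by move=> z _; exact: cst_continuous.
split=> [z _|v]; first exact: differentiable_cst.
by have -> : (fun z => 'D_v (cst c) z) = cst 0
  by apply/funext => z; rewrite derive_cst.
Qed.

Lemma Ck_add n k (U : set 'rV[R]_n) h h' : open U ->
  Ck k U h -> Ck k U h' -> Ck k U (h + h').
Proof.
move=> oU; elim: k h h' => [|k IH] h h' /=.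
  by move=> H H' z Uz; apply: continuousD; [exact: H|exact: H'].
move=> [H1 H2] [H1' H2']; split=> [z Uz|v].
  by apply: differentiableD; [exact: H1|exact: H1'].
apply: Ck_eq (IH _ _ (H2 v) (H2' v)) => // z Uz.
by rewrite deriveD //; apply: diff_derivable; [exact: H1|exact: H1'].
Qed.

Lemma Ck_mul n k (U : set 'rV[R]_n) h h' : open U ->
  Ck k U h -> Ck k U h' -> Ck k U (h * h').
Proof.
move=> oU; elim: k h h' => [|k IH] h h' /=.
  by move=> H H' z Uz; apply: continuousM; [exact: H|exact: H'].
move=> Hh Hh'; have [[H1 H2] [H1' H2']] := (Hh, Hh'); split=> [z Uz|v].
  by apply: differentiableM; [exact: H1|exact: H1'].
apply: Ck_eq (Ck_add oU (IH _ _ (CkS Hh) (H2' v)) (IH _ _ (CkS Hh') (H2 v))) => // z Uz.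
by rewrite deriveM //; apply: diff_derivable; [exact: H1|exact: H1'].
Qed.

Lemma Ck_inv n k (U : set 'rV[R]_n) h : open U ->
  (forall z, U z -> h z != 0) -> Ck k U h -> Ck k U (fun z => (h z)^-1).
Proof.
move=> oU h0; elim: k => [|k IH] /=.
  by move=> H z Uz; apply: continuousV; [exact: h0|exact: H].
move=> Hh; have [H1 H2] := Hh; split=> [z Uz|v].
  by apply: differentiableV; [exact: H1|exact: h0].
have Hi := IH (CkS Hh).
(* The derivative of 1/h is -(1/h)(1/h) Dh, in which 1/h is already of class [k] by induction. *)
apply: Ck_eq (Ck_mul oU (Ck_cst _ _ (-1)) (Ck_mul oU (Ck_mul oU Hi Hi) (H2 v))) => // z Uz.
rewrite deriveV ?h0 //; last by apply: diff_derivable; exact: H1.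
by rewrite !fctE /= mulN1r /GRing.scale /= mulNr expr2 invfM.
Qed.

Lemma Ck_sum n k (U : set 'rV[R]_n) m (h : 'I_m -> 'rV[R]_n -> R) : open U ->
  (forall i, Ck k U (h i)) -> Ck k U (\sum_i h i).
Proof.
move=> oU H; elim/big_ind: _ => [|a b|i _]; [exact: (Ck_cst k U 0)|exact: Ck_add|exact: H].
Qed.

Lemma differentiable_row (V : normedModType R) n (p : V -> 'rV[R]_n) z :
  (forall j, differentiable (fun x => p x 0 j) z) -> differentiable p z.
Proof.
move=> dp.
have -> : p = \sum_j (fun x => p x 0 j *: delta_mx 0 j).
  by apply/funext => x; rewrite fct_sumE -row_sum_delta.
by apply: differentiable_sum => j; exact: differentiableZl.
Qed.

Lemma derive_chain m n (p : 'rV[R]_m -> 'rV[R]_n) (h : 'rV[R]_n -> R) z v :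
  (forall j, differentiable (fun x => p x 0 j) z) ->
  differentiable h (p z) ->
  'D_v (h \o p) z = 'D_(\row_j 'D_v (fun x => p x 0 j) z) h (p z).
Proof.
move=> dp dh; have dp' := differentiable_row dp.
rewrite !deriveE //; last exact: differentiable_comp.
rewrite diff_comp //=; congr ('d h (p z) _).
rewrite -deriveE // derive_mx; last exact: diff_derivable.
by apply/rowP => j; rewrite !mxE.
Qed.

Lemma derive_delta n (h : 'rV[R]_n -> R) z v : differentiable h z ->
  'D_v h z = \sum_j v 0 j * 'D_(delta_mx 0 j) h z.
Proof.
move=> dh; rewrite deriveE // {1}(row_sum_delta v) linear_sum.
by apply: eq_bigr => j _; rewrite linearZ deriveE.
Qed.

Lemma continuous_row (S : topologicalType) n (p : S -> 'rV[R]_n) z :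
  (forall j, {for z, continuous (fun x => p x 0 j)}) -> {for z, continuous p}.
Proof.
move=> cp A [P nP PA].
have H : \forall x \near z, forall j, P 0 j (p x 0 j).
  by apply: filter_forall => j; exact: (cp j _ (nP 0 j)).
by apply: filterS H => x Px; apply: PA => i j; rewrite ord1.
Qed.

Lemma Ck_comp m n k (W : set 'rV[R]_m) (U : set 'rV[R]_n)
    (p : 'rV[R]_m -> 'rV[R]_n) h : open W ->
  (forall j, Ck k W (fun x => p x 0 j)) -> (forall z, W z -> U (p z)) ->
  Ck k U h -> Ck k W (h \o p).
Proof.
move=> oW; elim: k h => [|k IH] h Hp pU Hh /=.
  move=> z Wz; apply: continuous_comp; last exact/Hh/pU.
  by apply: continuous_row => j; exact: Hp.
have [H1 H2] := Hh; split=> [z Wz|v].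
  apply: differentiable_comp; last exact/H1/pU.
  by apply: differentiable_row => j; have [+ _] := Hp j; exact.
(* Chain rule: the induction is over all [h], so it applies to the partial derivatives of [h]
   composed with [p]. *)
have H : Ck k W (\sum_j (fun x => 'D_v (fun y => p y 0 j) x) *
                        ((fun x => 'D_(delta_mx 0 j) h x) \o p)).
  apply: Ck_sum => // j; apply: Ck_mul => //; first by have [_] := Hp j; exact.
  by apply: IH; [move=> i; exact/CkS/Hp|exact: pU|exact: H2].
apply: Ck_eq H => // z Wz; rewrite derive_chain; last exact/H1/pU.
  rewrite derive_delta; last exact/H1/pU.
  by rewrite fct_sumE; apply: eq_bigr => j _; rewrite mxE.
by move=> j; have [+ _] := Hp j; exact.
Qed.

End Smooth.

(** * Symmetry of second derivatives *)

Section Schwarz.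
Context {R : realType} (n : nat).
Implicit Types (h : 'rV[R]_n -> R) (z u v : 'rV[R]_n).

Lemma derivable_line h z u s : derivable h (z + s *: u) u ->
  is_derive s 1 (fun t : R => h (z + t *: u)) ('D_u h (z + s *: u)).
Proof.
have E : (fun t : R => t^-1 *: ((fun t => h (z + t *: u)) (t *: 1 + s) - h (z + s *: u))) =
   (fun t : R => t^-1 *: (h (t *: u + (z + s *: u)) - h (z + s *: u))).
  apply/funext => t /=; do 3 f_equal.
  by rewrite [t *: 1]mulr1 scalerDl addrCA.
by move=> dh; split; rewrite ?/derivable ?/derive E.
Qed.

(* Applying the mean value theorem in [u], then in [v], to the second difference
   [h(z+tu+tv) - h(z+tu) - h(z+tv) + h(z)]. *)
Lemma second_difference h z u v t : 0 < t ->
  (forall a b, 0 <= a <= t -> 0 <= b <= t ->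
     differentiable h (z + a *: u + b *: v) /\
     differentiable (fun x => 'D_u h x) (z + a *: u + b *: v)) ->
  exists a b, [/\ 0 <= a <= t, 0 <= b <= t &
    h (z + t *: u + t *: v) - h (z + t *: u) - h (z + t *: v) + h z =
    t ^+ 2 * 'D_v (fun x => 'D_u h x) (z + a *: u + b *: v)].
Proof.
move=> t0 D.
have t01 : 0 <= t <= t by rewrite lexx andbT ltW.
have t00 : (0 : R) <= 0 <= t by rewrite lexx ltW.
have dk (s : R) : 0 <= s <= t ->
    is_derive s 1 (fun s => h (z + t *: v + s *: u) - h (z + s *: u))
      ('D_u h (z + t *: v + s *: u) - 'D_u h (z + s *: u)).
  move=> st; apply: is_deriveB; apply: derivable_line; apply: diff_derivable.
    by rewrite addrAC; have [] := D _ _ st t01.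
  by have [] := D _ _ st t00; rewrite scale0r addr0.
have oc (s : R) : s \in `]0, t[ -> 0 <= s <= t.
  by rewrite in_itv /= => /andP[/ltW -> /ltW ->].
have [a ai Ea] : exists2 a, a \in `]0, t[%R &
    (h (z + t *: v + t *: u) - h (z + t *: u)) - (h (z + t *: v + 0 *: u) - h (z + 0 *: u))
    = ('D_u h (z + t *: v + a *: u) - 'D_u h (z + a *: u)) * (t - 0).
  apply: (@MVT R (fun s => h (z + t *: v + s *: u) - h (z + s *: u))
      (fun s => 'D_u h (z + t *: v + s *: u) - 'D_u h (z + s *: u)) 0 t t0).
    by move=> s /oc; exact: dk.
  apply: derivable_within_continuous => s; rewrite in_itv /= => st.
  by have [] := dk s st.
have at_ := oc _ ai.
have dk2 (s : R) : 0 <= s <= t ->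
    is_derive s 1 (fun s => 'D_u h (z + a *: u + s *: v))
      ('D_v (fun x => 'D_u h x) (z + a *: u + s *: v)).
  move=> st; apply: (@derivable_line (fun x => 'D_u h x)); apply: diff_derivable.
  by have [] := D _ _ at_ st.
have [b bi Eb] : exists2 b, b \in `]0, t[%R &
    'D_u h (z + a *: u + t *: v) - 'D_u h (z + a *: u + 0 *: v)
    = 'D_v (fun x => 'D_u h x) (z + a *: u + b *: v) * (t - 0).
  apply: (@MVT R (fun s => 'D_u h (z + a *: u + s *: v))
      (fun s => 'D_v (fun x => 'D_u h x) (z + a *: u + s *: v)) 0 t t0).
    by move=> s /oc; exact: dk2.
  apply: derivable_within_continuous => s; rewrite in_itv /= => st.
  by have [] := dk2 s st.
exists a, b; split=> //; first exact: oc.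
move: Ea Eb; rewrite !scale0r !addr0 !subr0 ![z + t *: v + _]addrAC => Ea Eb.
by rewrite expr2 -mulrA [t * 'D_v _ _]mulrC -Eb mulrC -Ea opprB addrA addrAC.
Qed.

(** The second difference is symmetric in [u] and [v], so by [second_difference] the two mixed
    derivatives share a value at two points arbitrarily close to [z]. If they differed by [e] at
    [z], continuity would keep both within [e / 2] of their values there, a contradiction. *)
Lemma Schwarz h z u v (U : set 'rV[R]_n) : open U -> U z -> Ck 2 U h ->
  'D_v (fun x => 'D_u h x) z = 'D_u (fun x => 'D_v h x) z.
Proof.
move=> oU Uz [H1 H2].
have cA : {for z, continuous (fun x => 'D_v (fun x => 'D_u h x) x)}.
  exact: ((H2 u).2 v z Uz).
have cB : {for z, continuous (fun x => 'D_u (fun x => 'D_v h x) x)}.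
  exact: ((H2 v).2 u z Uz).
apply: contrapT => /eqP; rewrite -subr_eq0 -normr_gt0 => e0.
set e := `| _ | in e0.
have nA := @cvgr_dist_lt _ _ _ _ (nbhs_filter z) _ _ cA _ (divr_gt0 e0 (ltr0n R 2)).
have nB := @cvgr_dist_lt _ _ _ _ (nbhs_filter z) _ _ cB _ (divr_gt0 e0 (ltr0n R 2)).
have nU : nbhs z U by exact: open_nbhs_nbhs.
have [r r0 rN] := (nbhs_ballP _ _).1 (filterI (filterI nA nB) nU).
(* The side [t = r / c] keeps the whole parallelogram spanned by [t *: u] and [t *: v] inside the
   ball of radius [r]; the summand 1 makes [c] positive and the inclusion strict. *)
pose c := `|u| + `|v| + 1; have c0 : 0 < c by rewrite ltr_wpDl ?addr_ge0.
pose t := r / c; have t0 : 0 < t by rewrite divr_gt0.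
have inr a b : 0 <= a <= t -> 0 <= b <= t -> ball z r (z + a *: u + b *: v).
  move=> /andP[a0 a1] /andP[b0 b1]; rewrite -ball_normE /= -addrA opprD addNKr normrN.
  apply: le_lt_trans (ler_normD _ _) _; rewrite !normrZ (ger0_norm a0) (ger0_norm b0).
  apply: (@le_lt_trans _ _ (t * (`|u| + `|v|))).
    by rewrite mulrDr lerD // ler_wpM2r.
  by rewrite /t mulrAC ltr_pdivrMr // ltr_pM2l // /c ltrDl.
have d w x : U x -> differentiable (fun x => 'D_w h x) x by have [+ _] := H2 w; exact.
have [a [b [ha hb Eab]]] := second_difference t0 (fun a b ha hb =>
  let: conj _ Ux := rN _ (inr a b ha hb) in conj (H1 _ Ux) (d u _ Ux)).
have [a' [b' [ha' hb' Eab']]] : exists b a, [/\ 0 <= a <= t, 0 <= b <= t &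
    h (z + t *: v + t *: u) - h (z + t *: v) - h (z + t *: u) + h z =
    t ^+ 2 * 'D_u (fun x => 'D_v h x) (z + a *: u + b *: v)].
  have [b' [a' [hb' ha' E]]] : exists b a, [/\ 0 <= b <= t, 0 <= a <= t &
    h (z + t *: v + t *: u) - h (z + t *: v) - h (z + t *: u) + h z =
    t ^+ 2 * 'D_u (fun x => 'D_v h x) (z + b *: v + a *: u)].
    apply: second_difference t0 _ => b' a' hb' ha'; rewrite addrAC.
    by have [_ Ux] := rN _ (inr a' b' ha' hb'); split; [exact: H1|exact: d].
  have pt : z + a' *: u + b' *: v = z + b' *: v + a' *: u by rewrite addrAC.
  exists b', a'; rewrite pt; split; [exact: ha'|exact: hb'|exact: E].
have [[/= Ap _] _] := rN _ (inr _ _ ha hb).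
have [[/= _ Bp] _] := rN _ (inr _ _ ha' hb').
have t2 : t ^+ 2 != 0 by rewrite expf_neq0 // gt_eqF.
move: Eab Eab' Ap Bp.
rewrite [z + t *: v + t *: u]addrAC [h _ - h (z + t *: v) - _]addrAC.
move: ('D_v _ (z + a *: u + b *: v)) ('D_u _ (z + b' *: u + a' *: v)) => A1 B1 Eab Eab'.
move: Eab'; rewrite Eab => /(mulfI t2) <- Ap Bp.
suff : e < e by rewrite ltxx.
rewrite {2}[e]splitr; apply: le_lt_trans (ltrD Ap Bp).
by rewrite [X in _ <= _ + X]distrC; exact: ler_distD.
Qed.
End Schwarz.

(** * Functions and fields on manifolds *)

(** Leibniz bookkeeping for [act_lie]: the first sum on the right collects the second-order terms,
    the second one the bracket. Abstract families keep derivatives out of the reach of [ring]. *)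
Lemma sum_commutator (R : comNzRingType) n (a b c d e f g : 'I_n -> R) :
  \sum_j (a j * c j + d j * e j - (b j * f j + d j * g j)) =
  \sum_j (a j * c j - b j * f j) + \sum_j (e j - g j) * d j.
Proof. by rewrite -big_split; apply: eq_bigr => j _ /=; ring. Qed.

Section Manifold.
Context {R : realType} (M : manifold R).
Local Notation n := (mdim M).
Implicit Types (p q x : M) (U V : set M) (h : M -> R) (X Y Z T : vfield M).

Lemma chart_imageE p U :
  phi p @` (U `&` mdom p) = (phi p @` mdom p) `&` psi p @^-1` U.
Proof.
apply/seteqP; split=> [_ [x [Ux px] <-]|_ [[x px <-]]] /=.
  by split; [exists x|rewrite /= phiK].
by rewrite phiK // => Ux; exists x.
Qed.

Lemma chart_image_open p U : open U -> open (phi p @` (U `&` mdom p)).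
Proof.
rewrite chart_imageE !openE => oU z [pz Uz].
apply: filterI; first by apply: open_nbhs_nbhs; split=> //; exact: phi_open.
by apply: (psi_cont pz); exact: oU.
Qed.

Lemma near_chart p q U : open U -> U p -> mdom q p ->
  \forall z \near phi q p, (phi q @` (U `&` mdom q)) z.
Proof.
move=> oU Up qp; apply: open_nbhs_nbhs; split; first exact: chart_image_open.
by exists p.
Qed.

Lemma smooth_fun_sub U V h : V `<=` U -> smooth_fun U h -> smooth_fun V h.
Proof.
move=> VU H p k; apply: Ck_sub (H p k) => _ [x [Vx px] <-].
by exists x => //; split=> //; exact: VU.
Qed.

Lemma smooth_fun_eq U h h' : open U -> (forall x, U x -> h x = h' x) ->
  smooth_fun U h -> smooth_fun U h'.
Proof.
move=> oU e H p k; apply: Ck_eq (H p k); first exact: chart_image_open.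
by move=> _ [x [Ux px] <-]; rewrite /= phiK // e.
Qed.

Lemma smooth_fun_local h : (forall p, exists2 U, open U /\ U p & smooth_fun U h) ->
  smooth_fun setT h.
Proof.
move=> H p k.
(* The property that each point lies in some set on which the function is of class [k] is inherited
   by derivatives, which makes the induction on [k] work without fixing one set. *)
have pt z : (phi p @` (setT `&` mdom p)) z ->
    exists2 V : set _, V z & Ck k V (h \o psi p).
  move=> [x [_ px] <-]; have [U [oU Ux] Uh] := H x.
  by exists (phi p @` (U `&` mdom p)); [exists x|exact: Uh].
elim: k (h \o psi p) pt => [|k IH] h' pt /=.
  by move=> z /pt[V Vz]; exact.
split=> [z /pt[V Vz [+ _]]|v]; first exact.
by apply: IH => z /pt[V Vz [_ H2]]; exists V => //; exact: H2.
Qed.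

Lemma smooth_funD U h h' : open U ->
  smooth_fun U h -> smooth_fun U h' -> smooth_fun U (fun x => h x + h' x).
Proof.
by move=> oU H H' p k; apply: (@Ck_add _ _ _ _ (h \o psi p) (h' \o psi p));
  [exact: chart_image_open|exact: H|exact: H'].
Qed.

Lemma smooth_funM U h h' : open U ->
  smooth_fun U h -> smooth_fun U h' -> smooth_fun U (fun x => h x * h' x).
Proof.
by move=> oU H H' p k; apply: (@Ck_mul _ _ _ _ (h \o psi p) (h' \o psi p));
  [exact: chart_image_open|exact: H|exact: H'].
Qed.

Lemma smooth_fun_cst U c : smooth_fun U (fun=> c).
Proof. by move=> p k; exact: Ck_cst. Qed.

Lemma smooth_funV U h : open U -> (forall x, U x -> h x != 0) ->
  smooth_fun U h -> smooth_fun U (fun x => (h x)^-1).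
Proof.
move=> oU h0 H p k; apply: (@Ck_inv _ _ _ _ (h \o psi p)); last exact: H.
  exact: chart_image_open.
by move=> _ [x [Ux px] <-]; rewrite /= phiK // h0.
Qed.

Lemma smooth_funN U h : open U -> smooth_fun U h -> smooth_fun U (fun x => - h x).
Proof.
move=> oU H; apply: (@smooth_fun_eq _ (fun x => -1 * h x)) => //.
  by move=> x _; rewrite mulN1r.
by apply: smooth_funM => //; exact: smooth_fun_cst.
Qed.

Lemma smooth_funB U h h' : open U ->
  smooth_fun U h -> smooth_fun U h' -> smooth_fun U (fun x => h x - h' x).
Proof. by move=> oU H H'; apply: smooth_funD => //; exact: smooth_funN. Qed.

Lemma smooth_funX U h m : open U ->
  smooth_fun U h -> smooth_fun U (fun x => h x ^+ m).
Proof.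
move=> oU H; elim: m => [|m IH]; first exact: smooth_fun_cst.
apply: (@smooth_fun_eq _ (fun x => h x * h x ^+ m)) => //.
  by move=> x _; rewrite exprS.
exact: smooth_funM.
Qed.

Lemma smooth_fun_sum U (I : Type) (r : seq I) (P : pred I) (h : I -> M -> R) :
  open U -> (forall i, P i -> smooth_fun U (h i)) ->
  smooth_fun U (fun x => \sum_(i <- r | P i) h i x).
Proof.
move=> oU H; elim: r => [|i r IH].
  by apply: smooth_fun_eq (smooth_fun_cst _ 0) => // x _; rewrite big_nil.
case Pi : (P i).
  apply: smooth_fun_eq (smooth_funD oU (H i Pi) IH) => // x _.
  by rewrite big_cons Pi.
by apply: smooth_fun_eq IH => // x _; rewrite big_cons Pi.
Qed.

Lemma smooth_fun_prod U (I : Type) (r : seq I) (h : I -> M -> R) :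
  open U -> (forall i, smooth_fun U (h i)) ->
  smooth_fun U (fun x => \prod_(i <- r) h i x).
Proof.
move=> oU H; elim: r => [|i r IH].
  by apply: smooth_fun_eq (smooth_fun_cst _ 1) => // x _; rewrite big_nil.
by apply: smooth_fun_eq (smooth_funM oU (H i) IH) => // x _; rewrite big_cons.
Qed.

Lemma smooth_fun_det U m (A : M -> 'M[R]_m) : open U ->
  (forall i j, smooth_fun U (fun x => A x i j)) ->
  smooth_fun U (fun x => \det (A x)).
Proof.
move=> oU H; apply: smooth_fun_sum => // s _; apply: smooth_funM => //.
  exact: smooth_fun_cst.
exact: smooth_fun_prod.
Qed.

Lemma smooth_fun_diff U h p q : open U -> smooth_fun U h -> U p -> mdom q p ->
  differentiable (h \o psi q) (phi q p).
Proof. by move=> oU H Up qp; have [+ _] := H q 1; apply; exists p. Qed.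

Lemma smooth_fun_continuous U h p : open U -> smooth_fun U h -> U p ->
  {for p, continuous h}.
Proof.
move=> oU H Up; have pp := mdom_self p.
apply: (@near_continuous _ _ ((h \o psi p) \o phi p)).
  apply: filterS (open_nbhs_nbhs (conj (mdom_open p) pp)) => x px /=.
  by rewrite phiK.
apply: continuous_comp; first exact: phi_cont.
apply: differentiable_continuous; exact: smooth_fun_diff H Up pp.
Qed.

Lemma chart_smooth q j : smooth_fun (mdom q) (fun x => phi q x 0 j).
Proof. by move=> p; rewrite setIC; exact: transition_smooth. Qed.

Lemma act_eq U X h h' p : open U -> U p -> (forall x, U x -> h x = h' x) ->
  act X h p = act X h' p.
Proof.
move=> oU Up e; apply: near_eq_derive.
apply: filterS (near_chart oU Up (mdom_self p)) => _ [x [Ux px] <-] /=.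
by rewrite phiK // e.
Qed.

Lemma act_const X c p : act X (fun=> c) p = 0.
Proof. exact: (derive_cst c). Qed.

Section ActAt.
Variables (U : set M) (p : M).
Hypotheses (oU : open U) (Up : U p).
Variables (X : vfield M).
Let dble h : smooth_fun U h -> derivable (h \o psi p) (phi p p) (X p).
Proof.
by move=> H; apply: diff_derivable; apply: smooth_fun_diff H _ _ => //; exact: mdom_self.
Qed.

Lemma actD h h' : smooth_fun U h -> smooth_fun U h' ->
  act X (fun x => h x + h' x) p = act X h p + act X h' p.
Proof. by move=> /dble H /dble H'; rewrite /act -deriveD. Qed.

Lemma actM h h' : smooth_fun U h -> smooth_fun U h' ->
  act X (fun x => h x * h' x) p = h p * act X h' p + h' p * act X h p.
Proof.
move=> /dble H /dble H'; rewrite /act.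
have -> : (fun x => h x * h' x) \o psi p = (h \o psi p) * (h' \o psi p) by [].
by rewrite (deriveM H H') /= (phiK (mdom_self p)).
Qed.

Lemma actN h : smooth_fun U h -> act X (fun x => - h x) p = - act X h p.
Proof. by move=> /dble H; rewrite /act -deriveN. Qed.

Lemma actB h h' : smooth_fun U h -> smooth_fun U h' ->
  act X (fun x => h x - h' x) p = act X h p - act X h' p.
Proof. by move=> H H'; rewrite actD ?actN //; exact: smooth_funN. Qed.

Lemma actX h m : smooth_fun U h ->
  act X (fun x => h x ^+ m.+1) p = m.+1%:R * h p ^+ m * act X h p.
Proof.
move=> H; elim: m => [|m IH].
  rewrite expr0 !mul1r; apply: (act_eq _ oU) => // x _; exact: expr1.
have -> : act X (fun x => h x ^+ m.+2) p = act X (fun x => h x * h x ^+ m.+1) p.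
  by apply: (act_eq _ oU Up) => x _; rewrite exprS.
rewrite actM ?IH //; last exact: smooth_funX.
by rewrite [m.+2%:R]mulrSr exprS; ring.
Qed.

Lemma act_sum m (h : 'I_m -> M -> R) : (forall i, smooth_fun U (h i)) ->
  act X (fun x => \sum_i h i x) p = \sum_i act X (h i) p.
Proof.
move=> H; rewrite /act -derive_sum; last by move=> i; exact: dble.
by congr ('D_(X p) _ _); apply/funext => z; rewrite fct_sumE.
Qed.

Lemma act_delta h : smooth_fun U h ->
  act X h p = \sum_j X p 0 j * 'D_(delta_mx 0 j) (h \o psi p) (phi p p).
Proof.
move=> H; rewrite /act derive_delta //; apply: smooth_fun_diff H _ _ => //.
exact: mdom_self.
Qed.

End ActAt.

Lemma act_lin U p X (I : finType) (c : I -> R) (Y : I -> vfield M) h :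
  open U -> U p -> smooth_fun U h -> X p = \sum_i c i *: Y i p ->
  act X h p = \sum_i c i * act (Y i) h p.
Proof.
move=> oU Up H E; have dh := smooth_fun_diff oU H Up (mdom_self p).
rewrite /act E deriveE // linear_sum; apply: eq_bigr => i _.
by rewrite linearZ deriveE.
Qed.

Lemma act_phi_self X p k : act X (fun x => phi p x 0 k) p = X p 0 k.
Proof.
have pp := mdom_self p.
rewrite /act (@near_eq_derive _ _ _ _ (fun z : 'rV[R]_n => z 0 k)); last first.
  by apply: filterS (near_chart (mdom_open p) pp pp) => _ [x [px _] <-]; rewrite /= phiK.
rewrite deriveE; last exact: differentiable_coord.
have @f : {linear 'rV[R]_n -> R}.
  by exists (fun N : 'rV[R]_n => N 0 k); do 2![eexists]; do ?[constructor];
    rewrite ?mxE// => ? *; rewrite ?mxE//; move=> ?; rewrite !mxE.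
by rewrite (@diff_lin _ _ _ f) //; exact: coord_continuous.
Qed.

(** Near [phi p p] the function factors through the transition map to [phi q]. The chart at [p]
    changes with [p], while the right-hand side uses the one chart [phi q] and can be differentiated
    again. *)
Lemma act_chart U X h p q : open U -> U p -> mdom q p -> smooth_fun U h ->
  act X h p = \sum_j act X (fun x => phi q x 0 j) p *
                     'D_(delta_mx 0 j) (h \o psi q) (phi q p).
Proof.
move=> oU Up qp H; have pp := mdom_self p; have phK := phiK pp.
have dc j : differentiable (fun z => phi q (psi p z) 0 j) (phi p p).
  by apply: (smooth_fun_diff (mdom_open q) (chart_smooth q j)).
have dh : differentiable (h \o psi q) (phi q p) by exact: (smooth_fun_diff oU H Up qp).
rewrite {1}/act (@near_eq_derive _ _ _ _ ((h \o psi q) \o (phi q \o psi p))); last first.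
  apply: filterS (near_chart (mdom_open q) qp pp) => _ [x [qx px] <-] /=.
  by rewrite phiK // phiK.
rewrite (derive_chain _ dc) /= phK // derive_delta //.
by apply: eq_bigr => j _; rewrite mxE.
Qed.

Lemma act_coord U p q i h : open U -> U p -> mdom q p -> smooth_fun U h ->
  act (coord_field q i) h p = 'D_(delta_mx 0 i) (h \o psi q) (phi q p).
Proof.
move=> oU Up qp H; have pp := mdom_self p; have qK := phiK qp.
have dc j : differentiable (fun z => phi p (psi q z) 0 j) (phi q p).
  by apply: (smooth_fun_diff (mdom_open p) (chart_smooth p j)).
have dh : differentiable (h \o psi p) (phi p p) by exact: (smooth_fun_diff oU H Up pp).
rewrite -(@near_eq_derive _ _ _ ((h \o psi p) \o (phi p \o psi q))); last first.
  apply: filterS (near_chart (mdom_open p) pp qp) => _ [x [px qx] <-] /=.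
  by rewrite phiK // phiK.
by rewrite (derive_chain _ dc) /= qK.
Qed.

Lemma act_coord_phi p q i j : mdom q p ->
  act (coord_field q i) (fun x => phi q x 0 j) p = (i == j)%:R.
Proof.
move=> qp; rewrite (act_coord _ (mdom_open q) qp qp (chart_smooth q j)).
rewrite (@near_eq_derive _ _ _ _ (fun z : 'rV[R]_n => z 0 j)); last first.
  by apply: filterS (near_chart (mdom_open q) qp qp) => _ [x [px _] <-]; rewrite /= phiK.
rewrite deriveE; last exact: differentiable_coord.
have @f : {linear 'rV[R]_n -> R}.
  by exists (fun N : 'rV[R]_n => N 0 j); do 2![eexists]; do ?[constructor];
    rewrite ?mxE// => ? *; rewrite ?mxE//; move=> ?; rewrite !mxE.
rewrite (@diff_lin _ _ _ f) /= ?mxE //; first by rewrite eq_sym.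
exact: coord_continuous.
Qed.

Lemma coord_field_self p i : coord_field p i p = delta_mx 0 i.
Proof.
apply/rowP => j; rewrite -act_phi_self act_coord_phi; last exact: mdom_self.
by rewrite mxE eqxx eq_sym.
Qed.

Lemma vfield_coord X p q : mdom q p ->
  X p = \sum_i act X (fun x => phi q x 0 i) p *: coord_field q i p.
Proof.
move=> qp; apply/rowP => k; have pp := mdom_self p.
rewrite -act_phi_self (act_chart X (mdom_open p) pp qp (chart_smooth p k)).
by rewrite summxE; apply: eq_bigr => i _; rewrite !mxE.
Qed.

Lemma coord_field_smooth q i : smooth_vfield (mdom q) (coord_field q i).
Proof.
move=> V h oV Vq H.
apply: (@smooth_fun_eq _ (fun p => 'D_(delta_mx 0 i) (h \o psi q) (phi q p))) => //.
  by move=> p Vp; rewrite (act_coord _ oV Vp (Vq _ Vp) H).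
move=> p k.
apply: (@Ck_comp _ _ _ _ _ (phi q @` (V `&` mdom q)) (fun z => phi q (psi p z))
   (fun z => 'D_(delta_mx 0 i) (h \o psi q) z)).
- exact: chart_image_open.
- move=> j; apply: Ck_sub (transition_smooth p q j k) => _ [x [Vx px] <-].
  by exists x => //; split=> //; exact: Vq.
- move=> _ [x [Vx px] <-]; rewrite phiK //; exists x => //.
  by split=> //; exact: Vq.
- by have [_] := H q k.+1; exact.
Qed.

Lemma smooth_vfield_sub U V X : V `<=` U -> smooth_vfield U X -> smooth_vfield V X.
Proof. by move=> VU H W h oW WV; apply: H => //; exact: subset_trans VU. Qed.

(** [lie] is defined by its values on the coordinates of one chart. Expanding both fields in the
    coordinate frame, the product rule gives these values as first-order part, and the second-order
    parts cancel by the symmetry of mixed derivatives. *)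
Lemma act_lie U X Y h p : open U -> U p -> smooth_vfield U X ->
  smooth_vfield U Y -> smooth_fun U h ->
  act (lie X Y) h p = act X (act Y h) p - act Y (act X h) p.
Proof.
move=> oU Up sX sY H; have pp := mdom_self p.
pose W := U `&` mdom p; have oW : open W by apply: openI => //; exact: mdom_open.
have Wp : W p by [].
have WU : W `<=` U by move=> ? [].
have Wm : W `<=` mdom p by move=> ? [].
have Wh : smooth_fun W h by exact: smooth_fun_sub H.
have c j : smooth_fun W (fun x => phi p x 0 j) by apply: smooth_fun_sub (chart_smooth p j).
pose e j := coord_field p j.
have sd j : smooth_fun W (act (e j) h).
  by apply: (@coord_field_smooth p j) => //.
have E Z : smooth_vfield U Z -> forall x, W x ->
    act Z h x = \sum_j act Z (fun x => phi p x 0 j) x * act (e j) h x.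
  move=> sZ x [Ux px]; rewrite (act_chart Z oU Ux px H).
  by apply: eq_bigr => j _; rewrite (act_coord _ oU Ux px H).
have E2 Z Z' : smooth_vfield U Z -> smooth_vfield U Z' -> act Z (act Z' h) p =
   \sum_j (Z' p 0 j * act Z (act (e j) h) p +
           act (e j) h p * act Z (act Z' (fun x => phi p x 0 j)) p).
  move=> sZ sZ'; rewrite (act_eq _ oW Wp (E _ sZ')) (act_sum oW Wp); last first.
    by move=> j; apply: smooth_funM => //; apply: sZ'.
  apply: eq_bigr => j _; rewrite (actM oW Wp) ?act_phi_self //.
  by apply: sZ'.
have E3 Z j : act Z (act (e j) h) p =
   \sum_k Z p 0 k * act (e k) (act (e j) h) p.
  rewrite (act_delta oW Wp Z (sd j)); apply: eq_bigr => k _.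
  by rewrite (act_coord _ oW Wp pp (sd j)).
(* In the chart [phi p] the coordinate fields act near [p] as partial derivatives, so they commute
   by [Schwarz]. *)
have sym j k : act (e k) (act (e j) h) p = act (e j) (act (e k) h) p.
  rewrite (act_coord _ oW Wp pp (sd j)) (act_coord _ oW Wp pp (sd k)).
  have oI := @chart_image_open p _ oW.
  have Ip : (phi p @` (W `&` mdom p)) (phi p p) by exists p.
  have D i v : 'D_v (act (e i) h \o psi p) (phi p p) =
      'D_v (fun z => 'D_(delta_mx 0 i) (h \o psi p) z) (phi p p).
    apply: near_eq_derive; apply: filterS (near_chart oW Wp pp) => _ [x [Wx px] <-] /=.
    by rewrite phiK // (act_coord _ oW Wx px Wh).
  have S := Schwarz (delta_mx 0 j) (delta_mx 0 k) oI Ip (Wh p 2).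
  have D1 := D j (delta_mx 0 k).
  have D2 := D k (delta_mx 0 j).
  refine (etrans D1 _).
  refine (etrans S _).
  exact: (esym D2).
rewrite (act_delta oU Up _ H) (E2 _ _ sX sY) (E2 _ _ sY sX) -sumrB.
under eq_bigr => j _ do rewrite -(act_coord _ oU Up pp H) mxE.
rewrite (sum_commutator (fun j => Y p 0 j) (fun j => X p 0 j)).
rewrite -[LHS]add0r; congr (_ + _).
rewrite sumrB; apply/esym/eqP; rewrite subr_eq0; apply/eqP.
have E4 Z Z' : \sum_j Z' p 0 j * act Z (act (e j) h) p =
    \sum_j \sum_k Z' p 0 j * (Z p 0 k * act (e k) (act (e j) h) p).
  by apply: eq_bigr => j _; rewrite (E3 Z j) mulr_sumr.
refine (etrans (E4 X Y) (etrans _ (esym (E4 Y X)))).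
rewrite exchange_big; apply: eq_bigr => j _; apply: eq_bigr => k _.
by rewrite (sym k j) mulrCA.
Qed.

End Manifold.

(** * The Koszul form *)

(** [t] stands for the components of the last argument of the Koszul form, [xt] and [yt] for their
    derivatives along the first two arguments, [gx] and [gy] for inner products with the frame. All
    terms with [xt] or [yt] cancel. *)
Lemma koszul_sum (R : comNzRingType) n (t xt yt A B C D E F gx gy : 'I_n -> R) c :
  c * (\sum_i (t i * A i + gy i * xt i) + \sum_i (t i * B i + gx i * yt i)
       - \sum_i t i * C i - \sum_i (yt i * gx i + t i * D i)
       + \sum_i (- (xt i * gy i) + t i * E i) + \sum_i t i * F i) =
  \sum_i t i * (c * (A i + B i - C i - D i + E i + F i)).
Proof.
rewrite -!sumrN -!big_split mulr_sumr /=.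
by apply: eq_bigr => i _; ring.
Qed.

Section Metric.
Context {R : realType} (M : manifold R).
Local Notation n := (mdim M).
Variable g : tensor2 M.
Implicit Types (p : M) (u v : 'rV[R]_n) (X Y Z T : vfield M).

Lemma bilDl p u u' v : bil g p (u + u') v = bil g p u v + bil g p u' v.
Proof. by rewrite /bil !mulmxDl mxE. Qed.

Lemma bilDr p u v v' : bil g p u (v + v') = bil g p u v + bil g p u v'.
Proof. by rewrite /bil linearD mulmxDr mxE. Qed.

Lemma bilZl p a u v : bil g p (a *: u) v = a * bil g p u v.
Proof. by rewrite /bil -!scalemxAl mxE. Qed.

Lemma bilZr p a u v : bil g p u (a *: v) = a * bil g p u v.
Proof. by rewrite /bil linearZ -scalemxAr mxE. Qed.

Lemma bil0l p v : bil g p 0 v = 0.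
Proof. by rewrite /bil !mul0mx mxE. Qed.

Lemma bil0r p u : bil g p u 0 = 0.
Proof. by rewrite /bil trmx0 mulmx0 mxE. Qed.

Lemma bilNr p u v : bil g p u (- v) = - bil g p u v.
Proof. by rewrite -scaleN1r bilZr mulN1r. Qed.

Lemma bilBl p u u' v : bil g p (u - u') v = bil g p u v - bil g p u' v.
Proof. by rewrite bilDl -[- u']scaleN1r bilZl mulN1r. Qed.

Lemma bil_suml p (I : finType) (F : I -> 'rV[R]_n) v :
  bil g p (\sum_i F i) v = \sum_i bil g p (F i) v.
Proof. by rewrite /bil !mulmx_suml summxE. Qed.

Lemma bil_sumr p (I : finType) (F : I -> 'rV[R]_n) u :
  bil g p u (\sum_i F i) = \sum_i bil g p u (F i).
Proof. by rewrite /bil linear_sum mulmx_sumr summxE. Qed.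

Lemma lieC X Y p : lie Y X p = - lie X Y p.
Proof. by apply/rowP => j; rewrite !mxE opprB. Qed.

Lemma vfield_coord_self X p : X p = \sum_i X p 0 i *: coord_field p i p.
Proof.
by rewrite {1}(row_sum_delta (X p)); apply: eq_bigr => i _; rewrite coord_field_self.
Qed.

Lemma lie_coord_field (U : set M) p Y T : open U -> U p -> smooth_vfield U Y ->
  lie Y T p = \sum_i (act Y (act T (fun x => phi p x 0 i)) p *: coord_field p i p +
                      T p 0 i *: lie Y (coord_field p i) p) :> 'rV[R]_n.
Proof.
move=> oU Up sY; have pp := mdom_self p; have oW := mdom_open p.
have sy j : smooth_fun (U `&` mdom p) (act Y (fun x => phi p x 0 j)).
  apply: sY; [exact: openI|by move=> ? []|].
  by apply: smooth_fun_sub (chart_smooth p j) => ? [].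
rewrite big_split /=.
have -> : \sum_i act Y (act T (fun x => phi p x 0 i)) p *: coord_field p i p =
          \row_i act Y (act T (fun x => phi p x 0 i)) p.
  rewrite [RHS]row_sum_delta; apply: eq_bigr => i _.
  by rewrite coord_field_self mxE.
apply/rowP => j; rewrite !mxE summxE; congr (_ + _).
rewrite (act_lin (openI oU oW) (conj Up pp) (sy j) (vfield_coord_self T p)) -sumrN.
apply: eq_bigr => i _; rewrite !mxE -mulrN; congr (_ * _).
(* On the coordinates of its own chart a coordinate field acts by constants, so of the bracket with
   [Y] only the term that differentiates the components of [Y] survives. *)
have -> : act Y (act (coord_field p i) (fun x => phi p x 0 j)) p = 0.
  rewrite (act_eq (h' := fun=> (i == j)%:R) _ oW pp) ?act_const // => x px.
  exact: act_coord_phi.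
by rewrite sub0r.
Qed.

Section Symmetric.
Hypothesis gT : forall p, (g p)^T = g p.

Lemma bilC p u v : bil g p u v = bil g p v u.
Proof.
rewrite /bil -[in LHS](trmxK (u *m g p *m v^T)) [LHS]mxE.
by rewrite !trmx_mul trmxK gT mulmxA.
Qed.

Lemma innerC X Y : inner g X Y = inner g Y X.
Proof. by apply/funext => p; exact: bilC. Qed.

Lemma inner_lieC X Y Z p : inner g X (lie Z Y) p = - inner g X (lie Y Z) p.
Proof. by rewrite /inner lieC bilNr. Qed.

(** The remaining terms cancel by the symmetry of [g] and the antisymmetry of the bracket alone, so
    the identity is available for arbitrary fields. *)
Lemma koszul_metric X Y Z p :
  act X (inner g Y Z) p = koszul g X Y Z p + koszul g X Z Y p.
Proof.
rewrite /koszul (innerC Z Y) (innerC Z X) (innerC Y X).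
rewrite -> (inner_lieC X Y Z p), (inner_lieC Y X Z p), (inner_lieC Z X Y p).
move: (act X _ p) (act Y _ p) (act Z _ p) (inner g X _ p) (inner g Y _ p) (inner g Z _ p).
by move=> *; lra.
Qed.

Lemma koszul_torsion X Y Z p :
  koszul g X Y Z p = koszul g Y X Z p + inner g (lie X Y) Z p.
Proof.
rewrite /koszul (innerC Z Y) (innerC Z X) (innerC Y X) (innerC (lie X Y)).
rewrite -> (inner_lieC X Y Z p), (inner_lieC Y X Z p), (inner_lieC Z X Y p).
move: (act X _ p) (act Y _ p) (act Z _ p) (inner g X _ p) (inner g Y _ p) (inner g Z _ p).
by move=> *; lra.
Qed.

(** Two representatives of a covector differ by a radical vector, which is orthogonal to everything;
    so the inner product can be computed from any explicit pair instead of the chosen one. *)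
Lemma represents_coinner p (w t : oneform M) u v :
  represents g p (w p) u -> represents g p (t p) v ->
  coinner g w t p = bil g p u v.
Proof.
move=> wu tv; rewrite /coinner /representative.
have wu' := @xgetPex _ 0 [set u | represents g p (w p) u] (ex_intro _ u wu).
have tv' := @xgetPex _ 0 [set u | represents g p (t p) u] (ex_intro _ v tv).
move: (xget _ _) (xget _ _) wu' tv' => u' v' /= wu' tv'.
by rewrite bilC -tv' tv bilC -wu' wu.
Qed.

End Symmetric.

Lemma pairing_lower (K : vfield M -> vfield M -> vfield M -> M -> R) X Y T p :
  pairing (lower K X Y) T p = \sum_i T p 0 i * K X Y (coord_field p i) p.
Proof. by rewrite /pairing mxE; apply: eq_bigr => i _; rewrite mxE. Qed.

Hypothesis hg : is_metric g.

Lemma inner_smooth (U : set M) X Y : open U -> smooth_vfield U X ->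
  smooth_vfield U Y -> smooth_fun U (inner g X Y).
Proof. by move=> oU sX sY; apply: hg.2. Qed.

Lemma inner_coord_field p q X Y : mdom p q ->
  inner g X Y q =
  \sum_i act Y (fun x => phi p x 0 i) q * inner g X (coord_field p i) q.
Proof.
move=> pq; rewrite {1}/inner {1}(vfield_coord Y pq) bil_sumr.
by apply: eq_bigr => i _; rewrite bilZr.
Qed.

(* The form [koszul g X Y] is function-linear in its last slot, because the terms
   differentiating the coefficients cancel; hence its coordinate components
   determine it. *)
Lemma pairing_koszul (U : set M) X Y T p : open U -> U p -> smooth_vfield U X ->
  smooth_vfield U Y -> smooth_vfield U T ->
  pairing (lower (koszul g) X Y) T p = koszul g X Y T p.
Proof.
move=> oU Up sX sY sT; have pp := mdom_self p.
pose W := U `&` mdom p; have oW : open W by apply: openI => //; exact: mdom_open.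
have Wp : W p by [].
have WU : W `<=` U by move=> ? [].
have Wm : W `<=` mdom p by move=> ? [].
pose e i := coord_field p i.
pose t i := act T (fun x => phi p x 0 i).
have sx i : smooth_fun W (fun x => phi p x 0 i) by apply: smooth_fun_sub (chart_smooth p i).
have st i : smooth_fun W (t i) by apply: (sT _ _ oW WU); exact: sx.
have se i : smooth_vfield W (e i) by apply: smooth_vfield_sub (@coord_field_smooth _ _ p i).
have sX' := smooth_vfield_sub WU sX; have sY' := smooth_vfield_sub WU sY.
have E1 X' Y' : smooth_vfield W Y' -> act X' (inner g Y' T) p =
  \sum_i (T p 0 i * act X' (inner g Y' (e i)) p + inner g Y' (e i) p * act X' (t i) p).
  move=> sY2.
  have E : forall x, W x -> inner g Y' T x = \sum_i t i x * inner g Y' (e i) x.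
    by move=> x [_ px]; rewrite (inner_coord_field Y' T px).
  have sg i := inner_smooth oW sY2 (se i).
  rewrite (act_eq _ oW Wp E) (act_sum oW Wp); last by move=> i; exact: smooth_funM.
  apply: eq_bigr => i _; rewrite (actM oW Wp X' (st i) (sg i)).
  by rewrite [t i p]act_phi_self.
have E2 : act T (inner g X Y) p = \sum_i T p 0 i * act (e i) (inner g X Y) p.
  exact: (act_lin oW Wp (inner_smooth oW sX' sY') (vfield_coord_self T p)).
have E3 X' Y' : smooth_vfield W Y' -> inner g X' (lie Y' T) p =
  \sum_i (act Y' (t i) p * inner g X' (e i) p + T p 0 i * inner g X' (lie Y' (e i)) p).
  move=> sY2; rewrite {1}/inner (lie_coord_field T oW Wp sY2) bil_sumr; apply: eq_bigr => i _.
  by rewrite bilDr !bilZr.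
have E4 : inner g Y (lie T X) p =
  \sum_i (- (act X (t i) p * inner g Y (e i) p) + T p 0 i * inner g Y (lie (e i) X) p).
  rewrite -> (inner_lieC Y X T p), (E3 Y X sX'); rewrite -sumrN; apply: eq_bigr => i _.
  by rewrite -> (inner_lieC Y X (e i) p); rewrite opprD mulrN.
have E5 : inner g T (lie X Y) p = \sum_i T p 0 i * inner g (e i) (lie X Y) p.
  rewrite {1}/inner {1}(vfield_coord_self T p) bil_suml.
  by apply: eq_bigr => i _; rewrite bilZl.
rewrite pairing_lower /koszul; symmetry.
rewrite -> (innerC hg.1 T X), (E1 X Y sY'), (E1 Y X sX'), E2, (E3 X Y sY'), E4, E5.
refine (etrans (koszul_sum (fun i => T p 0 i) (fun i => act X (t i) p)
  (fun i => act Y (t i) p) _ _ _ _ _ _ _ _ _) _).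
by apply: eq_bigr => i _; rewrite -> (innerC hg.1 X).
Qed.

End Metric.

(** * Coordinate frames, one-forms and nondegenerate metrics *)

Section Forms.
Context {R : realType} (M : manifold R).
Local Notation n := (mdim M).
Implicit Types (p q : M) (U : set M) (h : M -> R) (X Y Z T : vfield M) (w t : oneform M).

(** The entries of [g q] refer to the chart chosen at [q] and need not even be continuous in [q]. In
    the coordinate frame of the fixed chart [phi p] they become smooth functions of [q]. *)
Definition frame_gram (g : tensor2 M) p q : 'M[R]_n :=
  \matrix_(i, j) inner g (coord_field p i) (coord_field p j) q.

Definition frame p q : 'M[R]_n := \matrix_i coord_field p i q.

Lemma frame_gramE g p q : frame_gram g p q = frame p q *m g q *m (frame p q)^T.
Proof.
apply/matrixP => i j; rewrite mxE /inner /bil.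
have -> : coord_field p i q = row i (frame p q) by rewrite rowK.
have -> : coord_field p j q = row j (frame p q) by rewrite rowK.
rewrite -row_mul mxE [RHS]mxE; apply: eq_bigr => k _.
by rewrite !mxE.
Qed.

Lemma frame_unit p q : mdom p q -> frame p q \in unitmx.
Proof.
(* Row [k] of [c] lists the components, in the coordinate frame of [phi p], of the k-th basis vector
   at [q]; so [c] is a left inverse of the frame. *)
move=> pq; pose c := \matrix_(k, i)
  act (fun=> delta_mx 0 k : 'rV[R]_n) (fun x => phi p x 0 i) q.
suff : c *m frame p q = 1%:M by case/mulmx1_unit.
apply/row_matrixP => k; rewrite row_mul mulmx_sum_row row1.
rewrite [RHS](vfield_coord (fun=> delta_mx 0 k) pq).
by apply: eq_bigr => i _; rewrite !mxE rowK.
Qed.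

Lemma smooth_lie U X Y : open U -> smooth_vfield U X -> smooth_vfield U Y ->
  smooth_vfield U (lie X Y).
Proof.
move=> oU sX sY V h oV VU H.
have sX' := smooth_vfield_sub VU sX; have sY' := smooth_vfield_sub VU sY.
have HX := sX _ _ oV VU H; have HY := sY _ _ oV VU H.
apply: smooth_fun_eq (smooth_funB oV (sX _ _ oV VU HY) (sY _ _ oV VU HX)) => // p Vp.
by rewrite (act_lie oV Vp sX' sY' H).
Qed.

Lemma pairing_dform U X h p : open U -> U p -> smooth_fun U h ->
  pairing (dform h) X p = act X h p.
Proof.
move=> oU Up H; rewrite (act_delta oU Up X H) /pairing mxE.
by apply: eq_bigr => i _; rewrite mxE.
Qed.

Lemma smooth_dform h : smooth_fun setT h -> smooth_oneform (dform h).
Proof.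
move=> H U X oU sX.
have HU : smooth_fun U h by apply: smooth_fun_sub H.
apply: (@smooth_fun_eq _ _ _ (act X h)) => //; last exact: sX.
by move=> p Up; rewrite (pairing_dform X oU Up HU).
Qed.

Variable g : tensor2 M.
Hypothesis hg : is_metric g.

Lemma koszul_smooth U X Y Z : open U -> smooth_vfield U X -> smooth_vfield U Y ->
  smooth_vfield U Z -> smooth_fun U (koszul g X Y Z).
Proof.
move=> oU sX sY sZ.
have sg A B := @inner_smooth _ _ _ hg U A B oU.
have sa A h : smooth_vfield U A -> smooth_fun U h -> smooth_fun U (act A h).
  by move=> sA; apply: sA.
apply: smooth_funM => //; first exact: smooth_fun_cst.
apply: (smooth_funD oU _ (sg _ _ sZ (smooth_lie oU sX sY))).
apply: (smooth_funD oU _ (sg _ _ sY (smooth_lie oU sZ sX))).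
apply: (smooth_funB oU _ (sg _ _ sX (smooth_lie oU sY sZ))).
apply: (smooth_funB oU _ (sa _ _ sZ (sg _ _ sX sY))).
exact: (smooth_funD oU (sa _ _ sX (sg _ _ sY sZ)) (sa _ _ sY (sg _ _ sZ sX))).
Qed.

Lemma smooth_lower_koszul X Y : smooth_vfield setT X -> smooth_vfield setT Y ->
  smooth_oneform (lower (koszul g) X Y).
Proof.
move=> sX sY U T oU sT.
have sX' : smooth_vfield U X by apply: smooth_vfield_sub sX.
have sY' : smooth_vfield U Y by apply: smooth_vfield_sub sY.
apply: smooth_fun_eq (koszul_smooth oU sX' sY' sT) => // p Up.
by rewrite (pairing_koszul hg oU Up sX' sY' sT).
Qed.

Hypothesis hg0 : nondegenerate_metric g.

Lemma nondegenerate_unit p : g p \in unitmx.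
Proof.
rewrite -row_free_unit -kermx_eq0; apply/eqP/row_matrixP => i; rewrite row0.
apply: (hg0 (p := p)) => v; rewrite /bil -row_mul mulmx_ker row0.
by rewrite mul0mx mxE.
Qed.

Lemma nondegenerate_represents p (w : 'cV[R]_n) :
  represents g p w (w^T *m invmx (g p)).
Proof.
move=> v; rewrite /bil mulmxKV ?nondegenerate_unit //.
by rewrite -trmx_mul [RHS]mxE.
Qed.

Lemma coinner_nondegenerate w t p :
  coinner g w t p = ((w p)^T *m invmx (g p) *m t p) 0 0.
Proof.
rewrite (represents_coinner hg.1 (nondegenerate_represents p (w p))
  (nondegenerate_represents p (t p))).
by rewrite (bilC hg.1) -nondegenerate_represents.
Qed.

(** The change of frame cancels between the two forms and the inverse Gram matrix, which leaves only
    functions of [q] whose smoothness can be tested in one chart. *)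
Lemma coinner_frame w t p q : mdom p q ->
  coinner g w t q =
  \sum_i \sum_j pairing w (coord_field p i) q * invmx (frame_gram g p q) i j
                * pairing t (coord_field p j) q.
Proof.
move=> pq; rewrite coinner_nondegenerate.
have fu := frame_unit pq.
have E (u : oneform M) i : pairing u (coord_field p i) q = (frame p q *m u q) i 0.
  rewrite /pairing; have -> : coord_field p i q = row i (frame p q) by rewrite rowK.
  by rewrite -row_mul mxE.
have -> : (w q)^T *m invmx (g q) *m t q =
    (frame p q *m w q)^T *m invmx (frame_gram g p q) *m (frame p q *m t q).
  have gu := nondegenerate_unit q.
  have GK : frame_gram g p q *m ((invmx (frame p q))^T *m invmx (g q) *m invmx (frame p q)) = 1%:M.
    rewrite frame_gramE !mulmxA -[_ *m _^T *m _^T]mulmxA -trmx_mul mulVmx // trmx1 mulmx1.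
    by rewrite mulmxK // mulmxV.
  have [Gu _] := mulmx1_unit GK.
  have -> : invmx (frame_gram g p q) = (invmx (frame p q))^T *m invmx (g q) *m invmx (frame p q).
    by rewrite -[LHS]mulmx1 -GK mulKmx.
  rewrite trmx_mul !mulmxA mulmxKV //.
  by rewrite -[in RHS](mulmxA (w q)^T) -trmx_mul mulVmx // trmx1 mulmx1.
rewrite mxE exchange_big; apply: eq_bigr => j _.
rewrite [in LHS]mxE mulr_suml; apply: eq_bigr => i _.
by rewrite !E [in LHS]mxE.
Qed.

Lemma frame_gram_smooth p i j : smooth_fun (mdom p) (fun q => frame_gram g p q i j).
Proof.
have H := inner_smooth hg (mdom_open p) (@coord_field_smooth _ _ p i)
   (@coord_field_smooth _ _ p j).
by apply: smooth_fun_eq H; [exact: mdom_open|move=> q _; rewrite mxE].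
Qed.

(** By Cramer's rule the inverse Gram matrix has smooth entries: cofactors divided by a determinant
    that nondegeneracy keeps away from zero. *)
Lemma smooth_coinner w t : smooth_oneform w -> smooth_oneform t ->
  smooth_fun setT (coinner g w t).
Proof.
move=> sw st; apply: smooth_fun_local => p; have oW := mdom_open p.
exists (mdom p); first by split; [exact: oW|exact: mdom_self].
have Gu q : mdom p q -> frame_gram g p q \in unitmx.
  by move=> pq; rewrite frame_gramE !unitmx_mul unitmx_tr frame_unit // nondegenerate_unit.
have sdet : smooth_fun (mdom p) (fun q => (\det (frame_gram g p q))^-1).
  apply: smooth_funV => //.
    by move=> q /Gu; rewrite unitmxE unitfE.
  by apply: smooth_fun_det => // i j; exact: frame_gram_smooth.
have scof i j : smooth_fun (mdom p) (fun q => cofactor (frame_gram g p q) j i).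
  apply: smooth_funM => //; first exact: smooth_fun_cst.
  apply: smooth_fun_det => // i' j'.
  apply: smooth_fun_eq (frame_gram_smooth p (lift j i') (lift i j')) => // q _.
  by rewrite !mxE.
have sI i j : smooth_fun (mdom p) (fun q => invmx (frame_gram g p q) i j).
  apply: smooth_fun_eq (smooth_funM oW sdet (scof i j)) => // q pq.
  by rewrite /invmx Gu // !mxE.
have sc i := @coord_field_smooth _ _ p i.
have H : smooth_fun (mdom p) (fun q => \sum_i \sum_j
  pairing w (coord_field p i) q * invmx (frame_gram g p q) i j
                * pairing t (coord_field p j) q).
  apply: smooth_fun_sum => // i _; apply: smooth_fun_sum => // j _.
  exact: (smooth_funM oW (smooth_funM oW (sw _ _ oW (sc i)) (sI i j)) (st _ _ oW (sc j))).
by apply: smooth_fun_eq H => // q pq; rewrite (coinner_frame w t pq).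
Qed.

End Forms.

(** * Signature *)

Section Signature.
Context {R : realType}.

(** Same body as [has_signature], but for a matrix of any size, so that it also covers the diagonal
    blocks of a warped metric and Gram matrices of frames. *)
Definition sig_mx n (A : 'M[R]_n) (s t : nat) : Prop :=
  exists e : 'M[R]_n, exists d : 'rV[R]_n,
    [/\ e \in unitmx, e *m A *m e^T = diag_mx d,
        #|[pred i | d 0 i < 0]| = s & #|[pred i | 0 < d 0 i]| = t].

Lemma unit_with_row n (u : 'rV[R]_n.+1) : u != 0 ->
  exists2 e : 'M[R]_n.+1, e \in unitmx & row 0 e = u.
Proof.
move=> u0; pose U : 'rV[R]_n.+1 := delta_mx 0 0.
have Uu : U *m (U^T *m u) = u.
  rewrite mulmxA /U trmx_delta mul_delta_mx.
  have -> : delta_mx 0 0 = 1%:M :> 'M[R]_1 by apply/matrixP => i j; rewrite !ord1 !mxE.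
  by rewrite mul1mx.
have U0 : U != 0.
  by apply/eqP => /rowP/(_ 0); rewrite !mxE !eqxx => /eqP; rewrite oner_eq0.
have [|e eu] := @complete_unitmx _ _ _ U (U^T *m u).
  by rewrite Uu !rank_rV u0 U0.
by rewrite Uu -rowE => E; exists e.
Qed.

Lemma quad_delta n (A : 'M[R]_n) i j :
  ((delta_mx 0 i : 'rV_n) *m A *m (delta_mx 0 j : 'rV_n)^T) 0 0 = A i j.
Proof. by rewrite trmx_delta -rowE -colE !mxE. Qed.

(** Completing the square: a vector with nonzero quadratic value becomes the first basis vector, its
    row and column are cleared, and the induction continues on the Schur complement. *)
Lemma symmetric_diagonalizable n (A : 'M[R]_n) : A^T = A ->
  exists e d, e \in unitmx /\ e *m A *m e^T = diag_mx d.
Proof.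
elim: n A => [|n IH] A sA.
  by exists 1%:M, 0; split; [exact: unitmx1|apply/matrixP => -[]].
have [[u uAu]|Q] := pselect (exists u : 'rV_n.+1, (u *m A *m u^T) 0 0 != 0); last first.
  have Q0 (u : 'rV_n.+1) : (u *m A *m u^T) 0 0 = 0.
    by apply: contrapT => /eqP H; apply: Q; exists u.
  exists 1%:M, 0; split; first exact: unitmx1.
  rewrite mul1mx trmx1 mulmx1 raddf0; apply/matrixP => i j.
  (* Polarization: a symmetric form whose quadratic values all vanish is zero. *)
  have := Q0 (delta_mx 0 i + delta_mx 0 j).
  have D11 (a b : 'M[R]_1) : (a + b) 0 0 = a 0 0 + b 0 0 by rewrite mxE.
  rewrite !mulmxDl linearD /= !mulmxDr !D11 !Q0 !quad_delta.
  have -> : A j i = A i j by rewrite -[in LHS]sA mxE.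
  rewrite mxE => H; lra.
have u0 : u != 0.
  by apply: contraNneq uAu => ->; rewrite !mul0mx mxE.
have [e0 e0u r0] := unit_with_row u0.
pose A' : 'M[R]_(1 + n) := e0 *m A *m e0^T.
have sA' : A'^T = A' by rewrite /A' !trmx_mul trmxK sA mulmxA.
have a0 : A' 0 0 != 0.
  suff -> : A' 0 0 = (u *m A *m u^T) 0 0 by [].
  by rewrite -r0 rowE -quad_delta trmx_mul !mulmxA.
have A'def : A' = e0 *m A *m e0^T by [].
clearbody A'; pose a := A' 0 0; pose b := ursubmx A'.
(* Subtracts multiples of the pivot row so that [b] and its transpose disappear; the block left over
   is the Schur complement [D]. *)
pose e1 : 'M[R]_(1 + n) := block_mx 1%:M 0 (- a^-1 *: b^T) 1%:M.
have e1u : e1 \in unitmx by rewrite unitmxE det_lblock !det1 mulr1 unitr1.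
have A'E : A' = block_mx a%:M b b^T (drsubmx A').
  rewrite -[LHS](@submxK _ 1 n 1 n); congr block_mx.
    apply/matrixP => i j; rewrite !ord1 !mxE eqxx mulr1n.
    by congr (A' _ _); apply/val_inj.
  by rewrite /b trmx_ursub sA'.
pose D := drsubmx A' - a^-1 *: (b^T *m b).
have [|e2 [d2 [e2u E2]]] := IH D.
  rewrite /D linearB linearZ /= trmx_mul trmxK; congr (_ - _).
  by rewrite trmx_drsub sA'.
have E1 : e1 *m A' *m e1^T = block_mx a%:M 0 0 D.
  rewrite A'E /e1 tr_block_mx !mulmx_block !trmx1 !trmx0 linearZ /= trmxK.
  rewrite !mul1mx !mul0mx !mulmx0 !mulmx1 !addr0.
  have -> : - a^-1 *: b^T *m a%:M + b^T = 0.
    by rewrite mul_mx_scalar scalerA mulrN mulfV // scaleN1r addNr.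
  rewrite !mul0mx !add0r.
  have -> : a%:M *m (- a^-1 *: b) + b = 0.
    by rewrite mul_scalar_mx scalerA mulrN mulfV // scaleN1r addNr.
  by congr block_mx; rewrite -scalemxAl scaleNr addrC.
pose e3 : 'M[R]_(1 + n) := block_mx 1%:M 0 0 e2.
have e3u : e3 \in unitmx by rewrite unitmxE det_lblock det1 mul1r -unitmxE.
exists (e3 *m e1 *m e0), (row_mx a%:M d2 : 'rV_(1 + n)); split.
  by rewrite !unitmx_mul e3u e1u.
have -> : e3 *m e1 *m e0 *m A *m (e3 *m e1 *m e0)^T = e3 *m (e1 *m A' *m e1^T) *m e3^T.
  by rewrite A'def !trmx_mul !mulmxA.
rewrite E1 /e3 tr_block_mx !mulmx_block !trmx1 !trmx0.
rewrite !mul1mx !mul0mx !mulmx0 !mulmx1 !addr0 !add0r mul0mx E2.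
refine (etrans _ (esym (@diag_mx_row _ _ _ a%:M d2))).
congr block_mx; apply/matrixP => i j.
by rewrite !ord1 !mxE !eqxx.
Qed.

Lemma sig_mx_exists n (A : 'M[R]_n) : A^T = A -> exists s t, sig_mx A s t.
Proof.
move=> /symmetric_diagonalizable[e [d [eu E]]].
by exists #|[pred i | d 0 i < 0]|, #|[pred i | 0 < d 0 i]|, e, d.
Qed.

Lemma quad_diag n (d y : 'rV[R]_n) :
  (y *m diag_mx d *m y^T) 0 0 = \sum_i d 0 i * y 0 i ^+ 2.
Proof.
rewrite mxE; apply: eq_bigr => i _.
by rewrite mul_mx_diag !mxE mulrAC mulrC expr2.
Qed.

(** Dimension count: if [k] exceeded the number of positive entries of [d], some nonzero combination
    of the rows of [W] would have no component along them, and the form would be nonpositive on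
    it. *)
Lemma positive_subspace_le n k (A : 'M[R]_n) (W : 'M[R]_(k, n))
    (e : 'M[R]_n) (d : 'rV[R]_n) :
  e \in unitmx -> e *m A *m e^T = diag_mx d ->
  (forall c : 'rV_k, c != 0 -> 0 < ((c *m W) *m A *m (c *m W)^T) 0 0) ->
  (k <= #|[pred i | (0 < d 0 i)%R]|)%N.
Proof.
move=> eu E pos; set P := [pred i | 0 < d 0 i]; rewrite leqNgt; apply/negP => tk.
(* [V] expresses the rows of [W] in the diagonalizing basis, and [N] keeps the coordinates with
   positive diagonal entry; a vector in the left kernel of [N] gives the combination sought. *)
pose V := W *m invmx e; pose N := colsub (fun i : 'I_#|P| => enum_val i) V.
have : kermx N != 0.
  rewrite kermx_eq0 /row_free; apply: contraTneq tk => <-.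
  by rewrite -leqNgt rank_leq_col.
case/rowV0Pn => c /sub_kermxP cN c0.
pose y := c *m V.
have y0 i : P i -> y 0 i = 0.
  move=> Pi; have -> : y 0 i = (c *m N) 0 (enum_rank_in Pi i).
    rewrite [LHS]mxE [RHS]mxE; apply: eq_bigr => j _.
    by rewrite [N _ _]mxE enum_rankK_in.
  by rewrite cN mxE.
have := pos c c0; have -> : c *m W = y *m e by rewrite /y /V mulmxA mulmxKV.
have -> : y *m e *m A *m (y *m e)^T = y *m diag_mx d *m y^T.
  by rewrite -E trmx_mul !mulmxA.
rewrite quad_diag ltNge => /negP; apply; apply: sumr_le0 => i _.
have [Pi|/negP] := pselect (P i); first by rewrite y0 // expr0n mulr0.
by rewrite /P /= -leNgt => di; rewrite mulr_le0_ge0 // sqr_ge0.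
Qed.

(** The bound with [k.+1] makes each cross term at least -(d_i c_i^2 + d_j c_j^2) / (2(k+1)). Over
    the k^2 pairs this costs at most k/(k+1) of the diagonal sum, so a positive fraction of it
    remains. *)
Lemma perturbed_diag_pos k (d : 'I_k -> R) (E : 'I_k -> 'I_k -> R) (c : 'rV[R]_k) :
  (forall i, 0 < d i) ->
  (forall i j, `|E i j| * k.+1%:R <= d i /\ `|E i j| * k.+1%:R <= d j) ->
  c != 0 ->
  0 < \sum_i d i * c 0 i ^+ 2 + \sum_i \sum_j c 0 i * E i j * c 0 j.
Proof.
move=> d0 HE c0; pose S := \sum_i d i * c 0 i ^+ 2.
have S0 : 0 < S.
  have [i ci] : exists i, c 0 i != 0.
    by apply/existsP; rewrite -negb_forall; apply: contra c0 => /forallP H;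
      apply/eqP/rowP => i; rewrite mxE; exact/eqP.
  have p : 0 < d i * c 0 i ^+ 2 by apply: mulr_gt0 => //; rewrite exprn_even_gt0.
  rewrite /S (bigD1 i) //=; apply: ltr_pwDl => //.
  by apply: sumr_ge0 => j _; rewrite mulr_ge0 ?sqr_ge0 // ltW.
have K0 : 0 < k.+1%:R :> R by rewrite ltr0n.
have B i j : - (d i * c 0 i ^+ 2 + d j * c 0 j ^+ 2) <=
             2 * k.+1%:R * (c 0 i * E i j * c 0 j).
  have [H1 H2] := HE i j; move: (c 0 i) (c 0 j) (E i j) H1 H2 => x y e H1 H2.
  have n1 : - `|e| <= e by rewrite lerNl ler_normr lexx orbT.
  have n2 : e <= `|e| := ler_norm e.
  have s1 : 0 <= (x + y) ^+ 2 := sqr_ge0 _.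
  have s2 : 0 <= (x - y) ^+ 2 := sqr_ge0 _.
  (* Added to [t2], this gives 2|e|(x^2 + y^2) + 4xey >= 0, which is twice the estimate [t3]. *)
  have t1 : 0 <= (`|e| + e) * (x + y) ^+ 2 by apply: mulr_ge0 => //; lra.
  have t2 : 0 <= (`|e| - e) * (x - y) ^+ 2 by apply: mulr_ge0 => //; lra.
  have t3 : - (`|e| * (x ^+ 2 + y ^+ 2)) <= 2 * (x * e * y) by nra.
  have x2 := sqr_ge0 x; have y2 := sqr_ge0 y.
  have m1 := ler_wpM2r x2 H1; have m2 := ler_wpM2r y2 H2.
  have m3 : k.+1%:R * - (`|e| * (x ^+ 2 + y ^+ 2)) <= k.+1%:R * (2 * (x * e * y)).
    by rewrite ler_pM2l.
  lra.
have HB : - (k%:R * S + k%:R * S) <=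
    2 * k.+1%:R * \sum_i \sum_j c 0 i * E i j * c 0 j.
  have -> : - (k%:R * S + k%:R * S) =
      \sum_i \sum_j - (d i * c 0 i ^+ 2 + d j * c 0 j ^+ 2).
    under eq_bigr => i _ do rewrite sumrN big_split /= sumr_const card_ord -/S.
    by rewrite sumrN big_split /= sumr_const card_ord sumrMnl -/S !mulr_natl.
  rewrite mulr_sumr; apply: ler_sum => i _.
  by rewrite mulr_sumr; apply: ler_sum => j _; exact: B.
rewrite -/S; set Q := \sum_i _ in HB *.
have : 0 < k.+1%:R * (S + Q); last by rewrite pmulr_rgt0.
by move: HB; rewrite -natr1; lra.
Qed.

Lemma continuous_sum (S : topologicalType) m (F : 'I_m -> S -> R) p :
  (forall i, {for p, continuous (F i)}) ->
  {for p, continuous (fun x => \sum_i F i x)}.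
Proof.
move=> H; have -> : (fun x => \sum_i F i x) = \sum_i F i.
  by apply/funext => x; rewrite fct_sumE.
by elim/big_ind: _ => [|f g cf cg|i _]; [exact: cst_continuous|exact: continuousD|exact: H].
Qed.

Lemma continuous_congr (S : topologicalType) k n (W : 'M[R]_(k, n)) (G : S -> 'M[R]_n) p :
  (forall i j, {for p, continuous (fun x => G x i j)}) ->
  forall i j, {for p, continuous (fun x => (W *m G x *m W^T) i j)}.
Proof.
move=> cG i j.
have -> : (fun x => (W *m G x *m W^T) i j) =
          (fun x => \sum_l (\sum_m W i m * G x m l) * W j l).
  by apply/funext => x; rewrite mxE; apply: eq_bigr => l _; rewrite !mxE.
apply: continuous_sum => l.
apply: (@continuousM _ _ (fun x => \sum_m W i m * G x m l) (fun=> W j l)).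
  apply: continuous_sum => m.
  apply: (@continuousM _ _ (fun=> W i m) (fun x => G x m l)); last exact: cG.
  exact: cst_continuous.
exact: cst_continuous.
Qed.

(** The rows of [e] with positive diagonal entry span a subspace on which the form at [p] is
    diagonal and positive. At nearby points its matrix on this subspace is a perturbation within the
    margin of [perturbed_diag_pos], so [positive_subspace_le] applies to every diagonalization
    there. *)
Lemma positive_index_lsc (S : topologicalType) n (G : S -> 'M[R]_n) p
    (e : 'M[R]_n) (d : 'rV[R]_n) :
  (forall i j, {for p, continuous (fun x => G x i j)}) ->
  e *m G p *m e^T = diag_mx d ->
  \forall x \near p, forall (e' : 'M[R]_n) (d' : 'rV[R]_n), e' \in unitmx ->
    e' *m G x *m e'^T = diag_mx d' ->
    (#|[pred i | (0 < d 0 i)%R]| <= #|[pred i | (0 < d' 0 i)%R]|)%N.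
Proof.
move=> cG E; set P := [pred i | (0 < d 0 i)%R].
pose v (i : 'I_#|P|) := enum_val i; pose W := rowsub v e.
have dv i : 0 < d 0 (v i) by have := enum_valP i.
have WE : W *m G p *m W^T = diag_mx (\row_i d 0 (v i)).
  rewrite /W trmx_mxsub mul_rowsub_mx mulmx_colsub mul_rowsub_mx E.
  by apply/matrixP => i j; rewrite !mxE (inj_eq enum_val_inj).
have H : \forall x \near p, forall i j,
    `|(W *m G p *m W^T) i j - (W *m G x *m W^T) i j| * #|P|.+1%:R <= d 0 (v i) /\
    `|(W *m G p *m W^T) i j - (W *m G x *m W^T) i j| * #|P|.+1%:R <= d 0 (v j).
  apply: filter_forall => i; apply: filter_forall => j.
  have c : (W *m G x *m W^T) i j @[x --> p] --> (W *m G p *m W^T) i j :=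
    @continuous_congr S _ n W G p cG i j.
  have K0 : 0 < #|P|.+1%:R :> R by rewrite ltr0n.
  have h1 := @cvgr_dist_le _ _ _ _ (nbhs_filter p) _ _ c _ (divr_gt0 (dv i) K0).
  have h2 := @cvgr_dist_le _ _ _ _ (nbhs_filter p) _ _ c _ (divr_gt0 (dv j) K0).
  apply: filterS2 h1 h2 => x.
  by rewrite !ler_pdivlMr.
apply: filterS H => x H e' d' e'u E'.
apply: (@positive_subspace_le _ _ _ W _ _ e'u E') => c c0.
have -> : c *m W *m G x *m (c *m W)^T = c *m (W *m G x *m W^T) *m c^T.
  by rewrite trmx_mul !mulmxA.
pose D i j := (W *m G x *m W^T) i j - (W *m G p *m W^T) i j.
have -> : (c *m (W *m G x *m W^T) *m c^T) 0 0 =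
  \sum_i d 0 (v i) * c 0 i ^+ 2 + \sum_i \sum_j c 0 i * D i j * c 0 j.
  have -> : W *m G x *m W^T = W *m G p *m W^T + \matrix_(i, j) D i j.
    by apply/matrixP => i j; rewrite [RHS]mxE [X in _ + X]mxE /D addrC subrK.
  rewrite mulmxDr mulmxDl mxE WE quad_diag; congr (_ + _).
    by apply: eq_bigr => i _; rewrite mxE.
  rewrite mxE exchange_big; apply: eq_bigr => j _.
  rewrite mxE mulr_suml; apply: eq_bigr => i _.
  by rewrite !mxE.
apply: perturbed_diag_pos => // i j; rewrite /D distrC.
exact: H.
Qed.

Lemma sig_mxN n (A : 'M[R]_n) s t : sig_mx A s t -> sig_mx (- A) t s.
Proof.
move=> [e [d [eu E ds dt]]]; exists e, (- d); split=> //.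
- by rewrite mulmxN mulNmx E linearN.
- by rewrite -dt; apply: eq_card => i; rewrite !inE mxE oppr_lt0.
- by rewrite -ds; apply: eq_card => i; rewrite !inE mxE oppr_gt0.
Qed.

Lemma sig_mx_lsc (S : topologicalType) n (G : S -> 'M[R]_n) p s t :
  (forall i j, {for p, continuous (fun x => G x i j)}) -> sig_mx (G p) s t ->
  \forall x \near p, forall s' t', sig_mx (G x) s' t' -> (s <= s')%N /\ (t <= t')%N.
Proof.
move=> cG sG; have [e [d [_ E _ dt]]] := sG.
have [e2 [d2 [_ E2 _ ds]]] := sig_mxN sG.
have cN i j : {for p, continuous (fun x => (- G x) i j)}.
  have -> : (fun x => (- G x) i j) = (fun x => - (G x i j)).
    by apply/funext => x; rewrite mxE.
  exact: (@continuousN _ _ _ (fun x => G x i j)).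
apply: filterS2 (positive_index_lsc cG E) (positive_index_lsc cN E2) => x H1 H2 s' t' sx.
have [e3 [d3 [u3 E3 _ <-]]] := sx.
have [e4 [d4 [u4 E4 _ <-]]] := sig_mxN sx.
by split; [rewrite -ds; exact: H2 u4 E4|rewrite -dt; exact: H1 u3 E3].
Qed.

(** Sylvester's law of inertia, read off from semicontinuity applied to a constant family in both
    directions. *)
Lemma sig_mx_unique n (A : 'M[R]_n) s t s' t' :
  sig_mx A s t -> sig_mx A s' t' -> s = s' /\ t = t'.
Proof.
have H s1 t1 s2 t2 : sig_mx A s1 t1 -> sig_mx A s2 t2 -> (s1 <= s2)%N /\ (t1 <= t2)%N.
  move=> H1; have c i j : {for (0 : R), continuous (fun=> A i j)} by exact: cst_continuous.
  exact: nbhs_singleton (@sig_mx_lsc R n (fun=> A) 0 s1 t1 c H1) _ _.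
move=> H1 H2; have [a b] := H _ _ _ _ H1 H2; have [c d] := H _ _ _ _ H2 H1.
by split; apply/eqP; rewrite eqn_leq ?a ?b ?c ?d.
Qed.

Lemma sig_mx_congr n (J A : 'M[R]_n) s t : J \in unitmx ->
  sig_mx A s t -> sig_mx (J *m A *m J^T) s t.
Proof.
move=> Ju [e [d [eu E ds dt]]]; exists (e *m invmx J), d; split=> //.
  by rewrite unitmx_mul eu unitmx_inv.
rewrite -E trmx_mul !mulmxA mulmxKV //.
by rewrite -[_ *m J^T *m _]mulmxA -trmx_mul mulVmx // trmx1 mulmx1.
Qed.

Lemma sig_mx0 n : sig_mx (0 : 'M[R]_n) 0 0.
Proof.
exists 1%:M, 0; split; first exact: unitmx1.
- by rewrite mulmx0 mul0mx linear0.
- by apply: eq_card0 => i; rewrite !inE mxE ltxx.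
- by apply: eq_card0 => i; rewrite !inE mxE ltxx.
Qed.

Lemma sig_mx00 n (A : 'M[R]_n) : sig_mx A 0 0 -> A = 0.
Proof.
move=> [e [d [eu E ds dt]]].
have d0 : d = 0.
  apply/rowP => i; rewrite mxE; apply/eqP; rewrite eq_le !leNgt.
  have := card0_eq ds i; have := card0_eq dt i; rewrite !inE => -> ->.
  by [].
move: E; rewrite d0 linear0 => E.
have eTu : e^T \in unitmx by rewrite unitmx_tr.
rewrite -[A](mulKmx eu) -[e *m A](mulmxK eTu) E.
by rewrite mul0mx mulmx0.
Qed.

Lemma sig_mxZ n (A : 'M[R]_n) c s t : 0 < c -> sig_mx A s t -> sig_mx (c *: A) s t.
Proof.
move=> c0 [e [d [eu E ds dt]]]; exists e, (c *: d); split=> //.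
- by rewrite -scalemxAr -scalemxAl E linearZ.
- by rewrite -ds; apply: eq_card => i; rewrite !inE mxE pmulr_rlt0.
- by rewrite -dt; apply: eq_card => i; rewrite !inE mxE pmulr_rgt0.
Qed.

Lemma card_split_ord m n (P : pred 'I_(m + n)) :
  #|P| = (#|[pred i | P (lshift n i)]| + #|[pred i | P (rshift m i)]|)%N.
Proof.
by rewrite -!sum1_card big_split_ord.
Qed.

Lemma sig_mx_block m n (A : 'M[R]_m) (C : 'M[R]_n) s t s' t' :
  sig_mx A s t -> sig_mx C s' t' ->
  sig_mx (block_mx A 0 0 C) (s + s') (t + t').
Proof.
move=> [e [d [eu E <- <-]]] [e' [d' [eu' E' <- <-]]].
exists (block_mx e 0 0 e'), (row_mx d d'); split.
- by rewrite unitmxE det_ublock unitrM -!unitmxE eu.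
- rewrite tr_block_mx !trmx0 !mulmx_block !mul0mx !mulmx0 !addr0 !add0r.
  by rewrite ?mul0mx ?mulmx0 ?addr0 ?add0r E E' diag_mx_row.
- rewrite card_split_ord; congr (_ + _)%N; apply: eq_card => i.
    by rewrite !inE row_mxEl.
  by rewrite !inE row_mxEr.
- rewrite card_split_ord; congr (_ + _)%N; apply: eq_card => i.
    by rewrite !inE row_mxEl.
  by rewrite !inE row_mxEr.
Qed.

End Signature.

(** * Density of the regions of constant signature *)

Section Density.
Context {R : realType} (M : manifold R) (g : tensor2 M).
Hypothesis gT : forall p, (g p)^T = g p.
Hypothesis gC : forall p i j,
  {for p, continuous (inner g (coord_field p i) (coord_field p j))}.

(** Passing to the Gram matrix in the frame of [phi p] is a congruence, hence keeps the signature
    and makes the entries continuous. Continuity on coordinate frames is easy to check for a warped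
    metric, whose coordinate fields are lifts. *)
Lemma signature_lsc p s t : has_signature (g p) s t ->
  \forall q \near p, forall s' t', has_signature (g q) s' t' ->
    (s <= s')%N /\ (t <= t')%N.
Proof.
move=> sp; have pp := mdom_self p.
have cG i j : {for p, continuous (fun q => frame_gram g p q i j)}.
  have -> : (fun q => frame_gram g p q i j) = inner g (coord_field p i) (coord_field p j).
    by apply/funext => q; rewrite mxE.
  exact: gC.
have sG : sig_mx (frame_gram g p p) s t.
  by rewrite frame_gramE; apply: sig_mx_congr => //; exact: frame_unit.
have np : nbhs p (mdom p) by apply: open_nbhs_nbhs; split=> //; exact: mdom_open.
apply: filterS2 np (sig_mx_lsc cG sG) => q pq H s' t' sq.
by apply: H; rewrite frame_gramE; apply: sig_mx_congr => //; exact: frame_unit.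
Qed.

(* A point of [O] where the number of nonzero signs is maximal is a point of
   locally constant signature. *)
Lemma constant_signature_dense (O : set M) p : open O -> O p ->
  exists2 q, O q & constant_signature g q.
Proof.
move=> oO Op; have [s [t st]] := sig_mx_exists (gT p).
have bound q s' t' : has_signature (g q) s' t' -> (s' + t' <= mdim M + mdim M)%N.
  move=> [e [d [_ _ <- <-]]].
  have c P : (#|P : {pred 'I_(mdim M)}| <= mdim M)%N by rewrite -[leqRHS]card_ord max_card.
  by apply: leq_add; exact: c.
(* Induction on the room left below the crude bound 2 [mdim M]: unless [p] itself works, some point
   of [O] near it has strictly more nonzero signs. *)
have [m] := ubnP (mdim M + mdim M - (s + t))%N; elim: m => // m IH in p s t Op st *.
move=> lt_m; have [Dp|nDp] := pselect (constant_signature g p); first by exists p.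
have nO : \forall q \near p, O q by apply: open_nbhs_nbhs.
have [q [Oq lsc nq]] : exists q, [/\ O q, forall s' t', has_signature (g q) s' t' ->
    (s <= s')%N /\ (t <= t')%N & ~ has_signature (g q) s t].
  apply: contrapT => H; apply: nDp; exists s, t.
  apply: filterS2 nO (signature_lsc st) => q Oq lsc.
  by apply: contrapT => nq; apply: H; exists q.
have [s' [t' st']] := sig_mx_exists (gT q).
have [ss' tt'] := lsc _ _ st'.
have lt_st : (s + t < s' + t')%N.
  rewrite ltn_neqAle leq_add // andbT; apply/eqP => e; apply: nq.
  have -> : s = s' by move: ss' tt' e; clear; lia.
  by have -> : t = t' by move: ss' tt' e; clear; lia.
apply: (IH q s' t' Oq st'); have := bound _ _ _ st'.
by move: lt_m lt_st; clear; lia.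
Qed.

(** If two continuous candidates differed at one point, they would differ on a neighbourhood of it,
    which meets the dense set where both equal [h]. *)
Lemma smooth_extension_unique h r : smooth_fun setT r ->
  (forall p, constant_signature g p -> r p = h p) ->
  smooth_extension (constant_signature g) h = r.
Proof.
move=> sr rh; rewrite /smooth_extension.
have := @xgetPex _ h [set r | smooth_fun setT r /\
  forall p, constant_signature g p -> r p = h p] (ex_intro _ r (conj sr rh)).
move: (xget _ _) => r' /= [sr' rh']; apply/funext => p; apply: contrapT => /eqP npr.
have cr := smooth_fun_continuous openT sr (I : setT p).
have cr' := smooth_fun_continuous openT sr' (I : setT p).
have c : {for p, continuous (fun x => r' x - r x)} by apply: continuousB.
have : \forall q \near p, r' q - r q != 0.
  by apply: (cvgr_neq0 _ c); rewrite subr_eq0.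
rewrite /prop_near1 nbhsE => -[N [oN Np] H].
have [q Oq Dq] := constant_signature_dense oN Np.
by have := H q Oq; rewrite /= rh' // rh // subrr eqxx.
Qed.

End Density.

(** * Lifts to the product *)

Section Lifts.
Context {R : realType} (B F : manifold R).
Local Notation M := (prod_manifold B F).
Local Notation lB := (@liftB R B F).
Local Notation lF := (@liftF R B F).
Implicit Types (X Y Z T : vfield B) (U V W Q : vfield F) (b : B) (q : F).

(** Holds for every [k]: if [k] is not derivable then, for nonzero [c], neither is the multiple, and
    both limits take the default value 0. Thus the Koszul formulas for lifts also apply to
    coordinate fields, which are smooth only locally. *)
Lemma deriveZ_cst n (k : 'rV[R]_n -> R) c z v :
  'D_v (fun y => c * k y) z = c * 'D_v k z.
Proof.
have [->|c0] := eqVneq c 0.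
  rewrite mul0r; have -> : (fun y => 0 * k y) = cst 0.
    by apply/funext => y; rewrite mul0r.
  exact: derive_cst.
have [dk|ndk] := pselect (derivable k z v).
  by have := deriveZ c dk.
have ndk' : ~ derivable (fun y => c * k y) z v.
  move=> dk; apply: ndk; have -> : k = c^-1 \*: (fun y => c * k y).
    by apply/funext => y /=; rewrite /GRing.scale /= mulKf.
  exact: derivableZ.
rewrite /derive (dvgP ndk) (dvgP ndk').
by have -> : (point : R) = 0 by []; rewrite mulr0.
Qed.

Lemma act_scale (N : manifold R) (X : vfield N) c h p :
  act X (fun x => c * h x) p = c * act X h p.
Proof. exact: deriveZ_cst. Qed.

(** A lifted vector leaves the other block of the product chart fixed, so the two difference
    quotients are literally the same. *)
Lemma act_liftB X (h : M -> R) b q :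
  act (lB X) h (b, q) = act X (fun b' => h (b', q)) b.
Proof.
rewrite /act /derive /=; apply: (congr1 (fun k : R -> R => lim (k @ 0^'))).
apply/funext => t /=; rewrite /prod_psi /prod_phi /liftB /=.
rewrite !linearD !linearZ /= !row_mxKl !row_mxKr scaler0 add0r.
by rewrite [psi q _]phiK //; exact: mdom_self.
Qed.

Lemma act_liftF V (h : M -> R) b q :
  act (lF V) h (b, q) = act V (fun q' => h (b, q')) q.
Proof.
rewrite /act /derive /=; apply: (congr1 (fun k : R -> R => lim (k @ 0^'))).
apply/funext => t /=; rewrite /prod_psi /prod_phi /liftF /=.
rewrite !linearD !linearZ /= !row_mxKl !row_mxKr scaler0 add0r.
by rewrite [psi b _]phiK //; exact: mdom_self.
Qed.

Lemma prod_phi_lshift (p : M) i :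
  (fun x : M => phi p x 0 (lshift _ i)) = (fun x => phi p.1 x.1 0 i).
Proof. by apply/funext => x; rewrite /= /prod_phi row_mxEl. Qed.

Lemma prod_phi_rshift (p : M) i :
  (fun x : M => phi p x 0 (rshift _ i)) = (fun x => phi p.2 x.2 0 i).
Proof. by apply/funext => x; rewrite /= /prod_phi row_mxEr. Qed.

Lemma act_liftB_fst X (h : B -> R) :
  act (lB X) (fun x => h x.1) = (fun x => act X h x.1).
Proof. by apply/funext => -[b q]; rewrite act_liftB. Qed.

Lemma act_liftB_snd X (h : F -> R) : act (lB X) (fun x => h x.2) = (fun=> 0).
Proof. by apply/funext => -[b q]; rewrite act_liftB /= act_const. Qed.

Lemma act_liftF_fst V (h : B -> R) : act (lF V) (fun x => h x.1) = (fun=> 0).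
Proof. by apply/funext => -[b q]; rewrite act_liftF /= act_const. Qed.

Lemma act_liftF_snd V (h : F -> R) :
  act (lF V) (fun x => h x.2) = (fun x => act V h x.2).
Proof. by apply/funext => -[b q]; rewrite act_liftF. Qed.

Lemma lie_liftBB X Y : lie (lB X) (lB Y) = lB (lie X Y).
Proof.
apply/funext => p; apply/rowP => j; rewrite mxE [in RHS]/liftB.
case: (split_ordP j) => i ->; rewrite ?row_mxEl ?row_mxEr.
  pose c x := phi p.1 x 0 i.
  by rewrite prod_phi_lshift !(act_liftB_fst _ c) !act_liftB_fst mxE.
pose c x := phi p.2 x 0 i.
by rewrite prod_phi_rshift !(act_liftB_snd _ c) !act_const mxE subrr.
Qed.

Lemma lie_liftFF V W : lie (lF V) (lF W) = lF (lie V W).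
Proof.
apply/funext => p; apply/rowP => j; rewrite mxE [in RHS]/liftF.
case: (split_ordP j) => i ->; rewrite ?row_mxEl ?row_mxEr.
  pose c x := phi p.1 x 0 i.
  by rewrite prod_phi_lshift !(act_liftF_fst _ c) !act_const mxE subrr.
pose c x := phi p.2 x 0 i.
by rewrite prod_phi_rshift !(act_liftF_snd _ c) !act_liftF_snd mxE.
Qed.

Lemma lie_liftBF X V : lie (lB X) (lF V) = (fun=> 0).
Proof.
apply/funext => p; apply/rowP => j; rewrite mxE [RHS]mxE.
case: (split_ordP j) => i ->.
  pose c x := phi p.1 x 0 i.
  rewrite prod_phi_lshift (act_liftF_fst _ c) (act_liftB_fst _ c).
  by rewrite act_liftF_fst act_const subrr.
pose c x := phi p.2 x 0 i.
rewrite prod_phi_rshift (act_liftF_snd _ c) (act_liftB_snd _ c).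
by rewrite act_liftB_snd act_const subrr.
Qed.

Lemma lie_liftFB X V : lie (lF V) (lB X) = (fun=> 0).
Proof. by apply/funext => p; rewrite lieC lie_liftBF oppr0. Qed.

Lemma derive_lsubmx m n (k : 'rV[R]_m -> R) (z v : 'rV[R]_(m + n)) :
  'D_v (fun y => k (lsubmx y)) z = 'D_(lsubmx v) k (lsubmx z).
Proof.
rewrite /derive; apply: (congr1 (fun k : R -> R => lim (k @ 0^'))).
by apply/funext => t /=; rewrite linearP.
Qed.

Lemma derive_rsubmx m n (k : 'rV[R]_n -> R) (z v : 'rV[R]_(m + n)) :
  'D_v (fun y => k (rsubmx y)) z = 'D_(rsubmx v) k (rsubmx z).
Proof.
rewrite /derive; apply: (congr1 (fun k : R -> R => lim (k @ 0^'))).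
by apply/funext => t /=; rewrite linearP.
Qed.

(** The components of [lower] are defined by coordinate fields; as these are lifts, the Koszul forms
    of lifts determine every component. *)
Lemma coord_field_lshift (p : M) i :
  coord_field p (lshift _ i) = lB (coord_field p.1 i).
Proof.
apply/funext => x; apply/rowP => j; rewrite mxE /liftB /=.
have dl : lsubmx (delta_mx 0 (lshift (mdim F) i) : 'rV[R]_(mdim B + mdim F)) = delta_mx 0 i.
  by apply/rowP => k; rewrite !mxE (inj_eq (@lshift_inj _ _)).
have dr : rsubmx (delta_mx 0 (lshift (mdim F) i) : 'rV[R]_(mdim B + mdim F)) = 0.
  by apply/rowP => k; rewrite !mxE eq_rlshift andbF.
case: (split_ordP j) => k ->; rewrite ?row_mxEl ?row_mxEr.
  have -> : (fun z => prod_phi x (prod_psi p z) 0 (lshift (mdim F) k)) =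
            (fun z => phi x.1 (psi p.1 (lsubmx z)) 0 k).
    by apply/funext => z; rewrite /prod_phi row_mxEl.
  rewrite (derive_lsubmx (fun y => phi x.1 (psi p.1 y) 0 k)) dl mxE.
  by rewrite /prod_phi row_mxKl.
have -> : (fun z => prod_phi x (prod_psi p z) 0 (rshift (mdim B) k)) =
          (fun z => phi x.2 (psi p.2 (rsubmx z)) 0 k).
  by apply/funext => z; rewrite /prod_phi row_mxEr.
by rewrite (derive_rsubmx (fun y => phi x.2 (psi p.2 y) 0 k)) dr mxE derive0.
Qed.

Lemma coord_field_rshift (p : M) i :
  coord_field p (rshift _ i) = lF (coord_field p.2 i).
Proof.
apply/funext => x; apply/rowP => j; rewrite mxE /liftF /=.
have dl : lsubmx (delta_mx 0 (rshift (mdim B) i) : 'rV[R]_(mdim B + mdim F)) = 0.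
  by apply/rowP => k; rewrite !mxE eq_lrshift andbF.
have dr : rsubmx (delta_mx 0 (rshift (mdim B) i) : 'rV[R]_(mdim B + mdim F)) = delta_mx 0 i.
  by apply/rowP => k; rewrite !mxE (inj_eq (@rshift_inj _ _)).
case: (split_ordP j) => k ->; rewrite ?row_mxEl ?row_mxEr.
  have -> : (fun z => prod_phi x (prod_psi p z) 0 (lshift (mdim F) k)) =
            (fun z => phi x.1 (psi p.1 (lsubmx z)) 0 k).
    by apply/funext => z; rewrite /prod_phi row_mxEl.
  by rewrite (derive_lsubmx (fun y => phi x.1 (psi p.1 y) 0 k)) dl mxE derive0.
have -> : (fun z => prod_phi x (prod_psi p z) 0 (rshift (mdim B) k)) =
          (fun z => phi x.2 (psi p.2 (rsubmx z)) 0 k).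
  by apply/funext => z; rewrite /prod_phi row_mxEr.
rewrite (derive_rsubmx (fun y => phi x.2 (psi p.2 y) 0 k)) dr mxE.
by rewrite /prod_phi row_mxKr.
Qed.

Lemma smooth_fun_fst (h : B -> R) : smooth_fun setT h ->
  smooth_fun setT (fun x : M => h x.1).
Proof.
move=> H p k.
apply: (@Ck_sub _ _ _ (lsubmx @^-1` (phi p.1 @` (setT `&` mdom p.1)))).
  move=> _ [x [_ [px _]] <-] /=; rewrite /prod_phi row_mxKl.
  by exists x.1.
apply: (@Ck_comp_linear _ _ _ lsubmx k _ (h \o psi p.1)); last exact: H.
exact: continuous_lsubmx.
Qed.

Lemma smooth_fun_snd (h : F -> R) : smooth_fun setT h ->
  smooth_fun setT (fun x : M => h x.2).
Proof.
move=> H p k.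
apply: (@Ck_sub _ _ _ (rsubmx @^-1` (phi p.2 @` (setT `&` mdom p.2)))).
  move=> _ [x [_ [_ px]] <-] /=; rewrite /prod_phi row_mxKr.
  by exists x.2.
apply: (@Ck_comp_linear _ _ _ rsubmx k _ (h \o psi p.2)); last exact: H.
exact: continuous_rsubmx.
Qed.

End Lifts.

(** * Warped products *)

Section Warped.
Context {R : realType} (B F : manifold R).
Local Notation M := (prod_manifold B F).
Local Notation lB := (@liftB R B F).
Local Notation lF := (@liftF R B F).
Implicit Types (X Y Z T : vfield B) (U V W Q : vfield F) (b : B) (q : F).
Variables (gB : tensor2 B) (gF : tensor2 F) (f : B -> R).
Local Notation g := (warped f gB gF).

Lemma bil_warped b q u1 u2 v1 v2 :
  bil g (b, q) (row_mx u1 u2) (row_mx v1 v2) =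
  bil gB b u1 v1 + f b ^+ 2 * bil gF q u2 v2.
Proof.
rewrite /bil /warped /= tr_row_mx mul_row_block !mulmx0 addr0 add0r mul_row_col mxE.
by rewrite -scalemxAr -scalemxAl [X in _ + X]mxE.
Qed.

Lemma inner_liftBB X Y : inner g (lB X) (lB Y) = (fun x => inner gB X Y x.1).
Proof. by apply/funext => -[b q]; rewrite /inner bil_warped bil0l mulr0 addr0. Qed.

Lemma inner_liftFF V W :
  inner g (lF V) (lF W) = (fun x => f x.1 ^+ 2 * inner gF V W x.2).
Proof. by apply/funext => -[b q]; rewrite /inner bil_warped bil0l add0r. Qed.

Lemma inner_liftBF X V : inner g (lB X) (lF V) = (fun=> 0).
Proof. by apply/funext => -[b q]; rewrite /inner bil_warped bil0l bil0r mulr0 addr0. Qed.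

Lemma inner_liftFB X V : inner g (lF V) (lB X) = (fun=> 0).
Proof. by apply/funext => -[b q]; rewrite /inner bil_warped bil0l bil0r mulr0 addr0. Qed.

Lemma inner_zero (N : manifold R) (h : tensor2 N) (X : vfield N) p :
  inner h X (fun=> 0) p = 0.
Proof. exact: bil0r. Qed.

Hypothesis hf : smooth_fun setT f.

Lemma act_scaler (N : manifold R) (X : vfield N) c h p :
  act X (fun x => h x * c) p = act X h p * c.
Proof.
rewrite mulrC -act_scale; congr (act X _ p).
by apply/funext => x; rewrite mulrC.
Qed.

Lemma act_sqr X b : act X (fun x => f x ^+ 2) b = 2 * f b * act X f b.
Proof. by rewrite (actX openT (I : setT b) X 1 hf) expr1. Qed.

Ltac lift_simp :=
  rewrite -> ?lie_liftBB, ?lie_liftBF, ?lie_liftFB, ?lie_liftFF, ?inner_liftBB,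
    ?inner_liftFF, ?inner_liftBF, ?inner_liftFB, ?inner_zero, ?act_const;
  rewrite -> ?act_liftB, ?act_liftF; cbn beta iota delta [fst snd];
  rewrite -> ?act_const, ?act_scale, ?act_scaler, ?act_sqr.

(* In the names below, the letters B and F tell from which factor the successive
   arguments are lifted. *)
Lemma koszul_BBB X Y Z b q : koszul g (lB X) (lB Y) (lB Z) (b, q) = koszul gB X Y Z b.
Proof. by rewrite /koszul; lift_simp. Qed.

Lemma koszul_BBF X Y W b q : koszul g (lB X) (lB Y) (lF W) (b, q) = 0.
Proof. by rewrite /koszul; lift_simp; ring. Qed.

Lemma koszul_BFB X V Z b q : koszul g (lB X) (lF V) (lB Z) (b, q) = 0.
Proof. by rewrite /koszul; lift_simp; ring. Qed.

Lemma koszul_FBB V Y Z b q : koszul g (lF V) (lB Y) (lB Z) (b, q) = 0.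
Proof. by rewrite /koszul; lift_simp; ring. Qed.

Lemma koszul_BFF X V W b q :
  koszul g (lB X) (lF V) (lF W) (b, q) = f b * act X f b * inner gF V W q.
Proof.
rewrite /koszul; lift_simp.
by generalize (act X f b) (inner gF V W q) => *; field.
Qed.

Lemma koszul_FBF X V W b q :
  koszul g (lF V) (lB X) (lF W) (b, q) = f b * act X f b * inner gF W V q.
Proof.
rewrite /koszul; lift_simp.
by generalize (act X f b) (inner gF W V q) => *; field.
Qed.

Lemma koszul_FFB X V W b q :
  koszul g (lF V) (lF W) (lB X) (b, q) = - (f b * act X f b * inner gF V W q).
Proof.
rewrite /koszul; lift_simp.
by generalize (act X f b) (inner gF V W q) => *; field.
Qed.

Lemma koszul_FFF U V W b q :
  koszul g (lF U) (lF V) (lF W) (b, q) = f b ^+ 2 * koszul gF U V W q.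
Proof.
rewrite /koszul; lift_simp.
generalize (act U (inner gF V W) q) (act V (inner gF W U) q) (act W (inner gF U V) q)
  (inner gF U (lie V W) q) (inner gF V (lie W U) q) (inner gF W (lie U V) q).
by move=> *; ring.
Qed.

Hypotheses (hgB : is_metric gB) (hgF : is_metric gF).
Variable P : vfield F.
Local Notation K := (koszul_bar g (lF P)).

Definition flat (N : manifold R) (h : tensor2 N) (X : vfield N) : oneform N :=
  fun p => h p *m (X p)^T.

Lemma flatE (N : manifold R) (h : tensor2 N) (X : vfield N) p i :
  (forall p, (h p)^T = h p) -> flat h X p i 0 = inner h X (coord_field p i) p.
Proof.
move=> hT; rewrite (innerC hT) /inner coord_field_self /bil /flat.
by rewrite -mulmxA -rowE [RHS]mxE.
Qed.

Lemma mul_flat (N : manifold R) (h : tensor2 N) (X : vfield N) p v :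
  (forall p, (h p)^T = h p) -> (v *m flat h X p) 0 0 = bil h p (X p) v.
Proof. by move=> hT; rewrite (bilC hT) /flat mulmxA. Qed.

Lemma lower_BB X Y b q : lower K (lB X) (lB Y) (b, q) =
  col_mx (lower (koszul gB) X Y b)
         (- (inner gB X Y b * f b ^+ 2) *: flat gF P q).
Proof.
apply/colP => j; rewrite mxE /koszul_bar; case: (split_ordP j) => i ->.
  rewrite coord_field_lshift col_mxEu mxE; rewrite -> koszul_BBB.
  by lift_simp; rewrite mul0r mulr0 addr0 subr0.
rewrite coord_field_rshift col_mxEd mxE (flatE _ _ _ hgF.1); rewrite -> koszul_BBF.
by lift_simp; rewrite /= mul0r !add0r mulrA mulNr.
Qed.

Lemma lower_BF X V b q : lower K (lB X) (lF V) (b, q) =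
  col_mx ((f b ^+ 2 * inner gF V P q) *: flat gB X b)
         ((f b * act X f b) *: flat gF V q).
Proof.
apply/colP => j; rewrite mxE /koszul_bar; case: (split_ordP j) => i ->.
  rewrite coord_field_lshift col_mxEu mxE (flatE _ _ _ hgB.1); rewrite -> koszul_BFB.
  by lift_simp; rewrite /= mul0r add0r subr0.
rewrite coord_field_rshift col_mxEd mxE (flatE _ _ _ hgF.1); rewrite -> koszul_BFF.
by lift_simp; rewrite /= mulr0 mul0r addr0 subr0.
Qed.

(** Both terms with [P] carry an inner product between the two factors and vanish. The contrast with
    [lower_BF] is the torsion of the semi-symmetric connection. *)
Lemma lower_FB X V b q : lower K (lF V) (lB X) (b, q) =
  col_mx 0 ((f b * act X f b) *: flat gF V q).
Proof.
apply/colP => j; rewrite mxE /koszul_bar; case: (split_ordP j) => i ->.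
  rewrite coord_field_lshift col_mxEu mxE; rewrite -> koszul_FBB.
  by lift_simp; rewrite /= !mul0r addr0 subr0.
rewrite coord_field_rshift col_mxEd mxE (flatE _ _ _ hgF.1); rewrite -> koszul_FBF.
by lift_simp; rewrite /= !mul0r addr0 subr0 (innerC hgF.1 V).
Qed.

Lemma lower_FF U V b q : lower K (lF U) (lF V) (b, q) =
  col_mx (- (f b * inner gF U V q) *: dform f b)
         (f b ^+ 2 *: lower (koszul gF) U V q + f b ^+ 4 *:
            (inner gF V P q *: flat gF U q - inner gF U V q *: flat gF P q)).
Proof.
apply/colP => j; rewrite mxE /koszul_bar; case: (split_ordP j) => i ->.
  rewrite coord_field_lshift col_mxEu mxE; rewrite -> koszul_FFB.
  lift_simp; rewrite /= !mulr0 addr0 subr0 mxE.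
  rewrite {1}/act coord_field_self.
  by rewrite mulrAC mulNr.
rewrite coord_field_rshift col_mxEd mxE; rewrite -> koszul_FFF.
have cD (u v : 'cV[R]_(mdim F)) : (u + v) i 0 = u i 0 + v i 0 by rewrite mxE.
have cN (u : 'cV[R]_(mdim F)) : (- u) i 0 = - u i 0 by rewrite mxE.
have cZ c (u : 'cV[R]_(mdim F)) : (c *: u) i 0 = c * u i 0 by rewrite mxE.
rewrite !cZ cD cN !cZ [lower _ _ _ _ i 0]mxE.
rewrite !(flatE _ _ _ hgF.1); lift_simp; rewrite /=.
generalize (koszul gF U V (coord_field q i) q) (inner gF V P q)
  (inner gF U (coord_field q i) q) (inner gF U V q) (inner gF P (coord_field q i) q).
by move=> *; ring.
Qed.

End Warped.

(* Without this, [ring] compares atoms by unfolding derivatives and may not end. *)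
Ltac gen_atoms :=
  repeat match goal with
  | |- context [inner ?a ?b ?c ?d] => generalize (inner a b c d)
  | |- context [bil ?a ?b ?c ?d] => generalize (bil a b c d)
  | |- context [koszul ?a ?b ?c ?d ?e] => generalize (koszul a b c d e)
  | |- context [coinner ?a ?b ?c ?d] => generalize (coinner a b c d)
  | |- context [pairing ?a ?b ?c] => generalize (pairing a b c)
  | |- context [act ?a ?b ?c] => generalize (act a b c)
  end; intros.

(** * Vectors representing the Koszul form *)

Section LeviCivita.
Context {R : realType} (N : manifold R) (g : tensor2 N).
Hypothesis hg : is_metric g.
Hypothesis rs : radical_stationary g.
Implicit Types X Y Z W : vfield N.

Lemma levi_civita_represents X Y p : smooth_vfield setT X -> smooth_vfield setT Y ->
  represents g p (lower (koszul g) X Y p) (levi_civita g X Y p).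
Proof.
move=> sX sY; have [_ H] := rs sX sY.
exact: (@xgetPex _ 0 [set u | represents g p (lower (koszul g) X Y p) u] (H p)).
Qed.

(** For a degenerate metric [levi_civita] is one chosen vector among many, but its inner products
    are determined; only these are used. *)
Lemma bil_levi_civita X Y Z p : smooth_vfield setT X -> smooth_vfield setT Y ->
  smooth_vfield setT Z -> bil g p (levi_civita g X Y p) (Z p) = koszul g X Y Z p.
Proof.
move=> sX sY sZ; rewrite -(levi_civita_represents p sX sY).
exact: (pairing_koszul hg openT (I : setT p) sX sY sZ).
Qed.

Lemma pairing_koszulT X Y Z : smooth_vfield setT X -> smooth_vfield setT Y ->
  smooth_vfield setT Z -> pairing (lower (koszul g) X Y) Z = koszul g X Y Z.
Proof.
move=> sX sY sZ; apply/funext => p.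
exact: (pairing_koszul hg openT (I : setT p) sX sY sZ).
Qed.

End LeviCivita.

Lemma nondegenerate_radical_stationary (R : realType) (N : manifold R) (g : tensor2 N) :
  is_metric g -> nondegenerate_metric g -> radical_stationary g.
Proof.
move=> hg hg0 X Y sX sY; split; first exact: smooth_lower_koszul.
by move=> p; eexists; exact: nondegenerate_represents.
Qed.

(** * Lower derivatives of lifts: pairings and representatives *)

Section Warped.
Context {R : realType} (B F : manifold R).
Local Notation M := (prod_manifold B F).
Local Notation lB := (@liftB R B F).
Local Notation lF := (@liftF R B F).
Implicit Types (X Y Z T : vfield B) (U V W Q : vfield F) (b : B) (q : F).
Variables (gB : tensor2 B) (gF : tensor2 F) (f : B -> R) (P : vfield F).
Local Notation g := (warped f gB gF).
Local Notation K := (koszul_bar g (lF P)).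
Hypotheses (hf : smooth_fun setT f) (hgB : is_metric gB) (hgF : is_metric gF).
Let lower_BB := lower_BB gB f hgF P.
Let lower_BF := lower_BF hf hgB hgF P.
Let lower_FB := lower_FB gB hf hgF P.
Let lower_FF := lower_FF gB hf hgF P.

Lemma warped_sym x : (g x)^T = g x.
Proof. by rewrite /warped tr_block_mx !trmx0 linearZ /= hgB.1 hgF.1. Qed.

Section Pairing.
Lemma pair_liftB (w : oneform M) T b q w1 w2 : w (b, q) = col_mx w1 w2 ->
  pairing w (lB T) (b, q) = (T b *m w1) 0 0.
Proof. by move=> e; rewrite /pairing e /liftB mul_row_col mul0mx addr0. Qed.

Lemma pair_liftF (w : oneform M) Q b q w1 w2 : w (b, q) = col_mx w1 w2 ->
  pairing w (lF Q) (b, q) = (Q q *m w2) 0 0.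
Proof. by move=> e; rewrite /pairing e /liftF mul_row_col mul0mx add0r. Qed.

Lemma mulmxZ00 n c (u : 'rV[R]_n) (w : 'cV[R]_n) : (u *m (c *: w)) 0 0 = c * (u *m w) 0 0.
Proof. by rewrite -scalemxAr mxE. Qed.

Lemma mulmxD00 n (u : 'rV[R]_n) (w w' : 'cV[R]_n) :
  (u *m (w + w')) 0 0 = (u *m w) 0 0 + (u *m w') 0 0.
Proof. by rewrite mulmxDr mxE. Qed.

Lemma mulmxN00 n (u : 'rV[R]_n) (w : 'cV[R]_n) : (u *m - w) 0 0 = - (u *m w) 0 0.
Proof. by rewrite mulmxN mxE. Qed.

Lemma pair_BBB X Y T : pairing (lower K (lB X) (lB Y)) (lB T) =
  (fun x => pairing (lower (koszul gB) X Y) T x.1).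
Proof. by apply/funext => -[b q]; rewrite (pair_liftB _ (lower_BB _ _ _ _)). Qed.

Lemma pair_BBF X Y Q : pairing (lower K (lB X) (lB Y)) (lF Q) =
  (fun x => - (inner gB X Y x.1 * f x.1 ^+ 2) * inner gF P Q x.2).
Proof.
apply/funext => -[b q]; rewrite (pair_liftF _ (lower_BB _ _ _ _)) mulmxZ00.
by rewrite (mul_flat _ _ _ hgF.1).
Qed.

Lemma pair_BFB X V T : pairing (lower K (lB X) (lF V)) (lB T) =
  (fun x => f x.1 ^+ 2 * inner gB X T x.1 * inner gF V P x.2).
Proof.
apply/funext => -[b q]; rewrite (pair_liftB _ (lower_BF _ _ _ _)) mulmxZ00.
by rewrite (mul_flat _ _ _ hgB.1) mulrAC.
Qed.

Lemma pair_BFF X V Q : pairing (lower K (lB X) (lF V)) (lF Q) =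
  (fun x => f x.1 * act X f x.1 * inner gF V Q x.2).
Proof.
apply/funext => -[b q]; rewrite (pair_liftF _ (lower_BF _ _ _ _)) mulmxZ00.
by rewrite (mul_flat _ _ _ hgF.1).
Qed.

Lemma pair_FBB X V T : pairing (lower K (lF V) (lB X)) (lB T) = (fun=> 0).
Proof.
by apply/funext => -[b q]; rewrite (pair_liftB _ (lower_FB _ _ _ _)) mulmx0 mxE.
Qed.

Lemma pair_FBF X V Q : pairing (lower K (lF V) (lB X)) (lF Q) =
  (fun x => f x.1 * act X f x.1 * inner gF V Q x.2).
Proof.
apply/funext => -[b q]; rewrite (pair_liftF _ (lower_FB _ _ _ _)) mulmxZ00.
by rewrite (mul_flat _ _ _ hgF.1).
Qed.

Lemma pair_FFB U V T : pairing (lower K (lF U) (lF V)) (lB T) =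
  (fun x => - (f x.1 * act T f x.1) * inner gF U V x.2).
Proof.
apply/funext => -[b q]; rewrite (pair_liftB _ (lower_FF _ _ _ _)) mulmxZ00.
have -> : (T b *m dform f b) 0 0 = act T f b.
  exact: (pairing_dform T openT (I : setT b) hf).
by rewrite /= !mulNr mulrAC.
Qed.

Lemma pair_FFF U V Q : pairing (lower K (lF U) (lF V)) (lF Q) =
  (fun x => f x.1 ^+ 2 * pairing (lower (koszul gF) U V) Q x.2 +
    f x.1 ^+ 4 * (inner gF V P x.2 * inner gF U Q x.2 -
                  inner gF U V x.2 * inner gF P Q x.2)).
Proof.
apply/funext => -[b q]; rewrite (pair_liftF _ (lower_FF _ _ _ _)) mulmxD00.
by rewrite !mulmxZ00 mulmxD00 mulmxN00 !mulmxZ00 !(mul_flat _ _ _ hgF.1).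
Qed.

(** For the bracket term of the curvature: lifts from different factors commute, and the zero field
    is itself a lift, so the formulas for lifts evaluate it. *)
Lemma lower_zero_liftB X : lower K (fun=> 0) (lB X) = (fun=> 0).
Proof.
have -> : (fun=> 0) = lF (fun=> 0) :> vfield M.
  by apply/funext => -[b q]; rewrite /liftF row_mx0.
apply/funext => -[b q]; rewrite lower_FB /flat trmx0 mulmx0 scaler0.
exact: col_mx0.
Qed.

Lemma lower_zero_liftF V : lower K (fun=> 0) (lF V) = (fun=> 0).
Proof.
have -> : (fun=> 0) = lB (fun=> 0) :> vfield M.
  by apply/funext => -[b q]; rewrite /liftB row_mx0.
apply/funext => -[b q]; rewrite lower_BF /flat trmx0 mulmx0 scaler0.
by rewrite /act derive0 mulr0 scale0r; exact: col_mx0.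
Qed.

Lemma pairing_zero (E : vfield M) : pairing (fun=> 0) E = (fun=> 0).
Proof. by apply/funext => x; rewrite /pairing mulmx0 mxE. Qed.

End Pairing.

Section Represent.
Hypotheses (rsB : radical_stationary gB) (rsF : radical_stationary gF).
Hypothesis hgB0 : nondegenerate_metric gB.

Lemma represents_col b q w1 w2 u1 u2 : represents gB b w1 u1 ->
  (forall v, (v *m w2) 0 0 = f b ^+ 2 * bil gF q u2 v) ->
  represents g (b, q) (col_mx w1 w2) (row_mx u1 u2).
Proof.
move=> h1 h2 v; rewrite -[v]hsubmxK bil_warped mul_row_col mxE.
by rewrite h1 h2.
Qed.

Lemma represents_BB X Y b q : smooth_vfield setT X -> smooth_vfield setT Y ->
  represents g (b, q) (lower K (lB X) (lB Y) (b, q))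
    (row_mx (levi_civita gB X Y b) (- inner gB X Y b *: P q)).
Proof.
move=> sX sY; rewrite lower_BB; apply: represents_col.
  exact: levi_civita_represents.
by move=> v; rewrite mulmxZ00 (mul_flat _ _ _ hgF.1) bilZl; gen_atoms; ring.
Qed.

(* With Rocq's [x / 0 = 0] the coefficient [act X f b / f b] is the right one also
   where [f] vanishes, since the form is then zero. *)
Lemma sqr_div (c a : R) : c ^+ 2 * (a / c) = c * a.
Proof.
have [->|c0] := eqVneq c 0; first by rewrite expr0n mul0r mul0r.
by field.
Qed.

Lemma represents_BF X V b q :
  represents g (b, q) (lower K (lB X) (lF V) (b, q))
    (row_mx ((f b ^+ 2 * inner gF V P q) *: X b) ((act X f b / f b) *: V q)).
Proof.
rewrite lower_BF; apply: represents_col => v.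
  by rewrite mulmxZ00 (mul_flat _ _ _ hgB.1) bilZl.
by rewrite mulmxZ00 (mul_flat _ _ _ hgF.1) bilZl mulrA sqr_div.
Qed.

Lemma represents_FB X V b q :
  represents g (b, q) (lower K (lF V) (lB X) (b, q))
    (row_mx 0 ((act X f b / f b) *: V q)).
Proof.
rewrite lower_FB; apply: represents_col => v.
  by rewrite mulmx0 mxE bil0l.
by rewrite mulmxZ00 (mul_flat _ _ _ hgF.1) bilZl mulrA sqr_div.
Qed.

Definition grad b := representative gB b (dform f b).

Lemma grad_represents b : represents gB b (dform f b) (grad b).
Proof.
have ex : exists u, represents gB b (dform f b) u.
  by eexists; exact: nondegenerate_represents.
exact: (@xgetPex _ 0 [set u | represents gB b (dform f b) u] ex).
Qed.

Lemma bil_grad b X : bil gB b (grad b) (X b) = act X f b.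
Proof. by rewrite -grad_represents; exact: (pairing_dform X openT (I : setT b) hf). Qed.

Lemma represents_FF U V b q : smooth_vfield setT U -> smooth_vfield setT V ->
  represents g (b, q) (lower K (lF U) (lF V) (b, q))
    (row_mx (- (f b * inner gF U V q) *: grad b)
       (levi_civita gF U V q + f b ^+ 2 *:
          (inner gF V P q *: U q - inner gF U V q *: P q))).
Proof.
move=> sU sV; rewrite lower_FF; apply: represents_col => v.
  by rewrite mulmxZ00 grad_represents bilZl.
rewrite mulmxD00 !mulmxZ00 mulmxD00 mulmxN00 !mulmxZ00 !(mul_flat _ _ _ hgF.1).
rewrite (levi_civita_represents rsF q sU sV) bilDl bilZl bilBl !bilZl.
by gen_atoms; ring.
Qed.

End Represent.
End Warped.

(** * Smooth extensions *)

Section Extension.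
Context {R : realType} (N : manifold R) (g : tensor2 N).

(** Both branches of the definition agree with [h] on [D]: an extension by its specification, and
    the default because it is [h]. *)
Lemma smooth_extension_agree (D : set N) h p : D p -> smooth_extension D h p = h p.
Proof.
move=> Dp; rewrite /smooth_extension.
have [ex|nex] := pselect (exists r, smooth_fun setT r /\ forall p, D p -> r p = h p).
  by have [_] := @xgetPex _ h [set r | smooth_fun setT r /\ forall p, D p -> r p = h p] ex; exact.
by rewrite xgetPN // => r [sr rh]; apply: nex; exists r.
Qed.

Hypothesis hg : is_metric g.

Lemma metric_coord_continuous p i j :
  {for p, continuous (inner g (coord_field p i) (coord_field p j))}.
Proof.
have s := inner_smooth hg (mdom_open p) (@coord_field_smooth _ _ p i)
  (@coord_field_smooth _ _ p j).
exact: (smooth_fun_continuous (mdom_open p) s (mdom_self p)).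
Qed.

Lemma smooth_act X h : smooth_vfield setT X -> smooth_fun setT h ->
  smooth_fun setT (@act _ N X h).
Proof. by move=> sX; apply: sX => //; exact: openT. Qed.

End Extension.

(** * Constant signature and inner products of forms on a warped product *)

Section Warped.
Context {R : realType} (B F : manifold R).
Local Notation M := (prod_manifold B F).
Local Notation lB := (@liftB R B F).
Local Notation lF := (@liftF R B F).
Implicit Types (X Y Z T : vfield B) (U V W Q : vfield F) (b : B) (q : F).
Variables (gB : tensor2 B) (gF : tensor2 F) (f : B -> R) (P : vfield F).
Local Notation g := (warped f gB gF).
Local Notation K := (koszul_bar g (lF P)).
Hypotheses (hf : smooth_fun setT f) (hgB : is_metric gB) (hgF : is_metric gF).

Lemma warped_coord_continuous (p : M) i j :
  {for p, continuous (inner g (coord_field p i) (coord_field p j))}.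
Proof.
have c1 (h : B -> R) : {for p.1, continuous h} ->
    {for p, continuous (fun x : M => h x.1)}.
  by move=> ch; apply: (@continuous_comp _ _ _ fst h) => //; exact: cvg_fst.
have c2 (h : F -> R) : {for p.2, continuous h} ->
    {for p, continuous (fun x : M => h x.2)}.
  by move=> ch; apply: (@continuous_comp _ _ _ snd h) => //; exact: cvg_snd.
case: (split_ordP i) => i' ->; case: (split_ordP j) => j' ->;
  rewrite ?coord_field_lshift ?coord_field_rshift.
- by rewrite inner_liftBB; apply: c1; exact: metric_coord_continuous.
- by rewrite inner_liftBF; exact: cst_continuous.
- by rewrite inner_liftFB; exact: cst_continuous.
- rewrite inner_liftFF.
  apply: (@continuousM _ _ (fun x : M => f x.1 ^+ 2)
    (fun x : M => inner gF (coord_field p.2 i') (coord_field p.2 j') x.2)).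
    apply: (c1 (fun b => f b ^+ 2)).
    exact: (smooth_fun_continuous openT (smooth_funX 2 openT hf) (I : setT p.1)).
  by apply: c2; exact: metric_coord_continuous.
Qed.

Lemma warped_signature b q s0 t0 s1 t1 : f b != 0 ->
  has_signature (gB b) s0 t0 -> has_signature (gF q) s1 t1 ->
  has_signature (g (b, q)) (s0 + s1) (t0 + t1).
Proof.
move=> fb h0 h1; apply: sig_mx_block => //.
by apply: sig_mxZ h1; rewrite exprn_even_gt0.
Qed.

(* If [f b = 0] the signature at [(b, q)] is that of [gB b], so its constancy forces
   [f ^+ 2 *: gF q] to vanish near [b]. *)
Lemma constant_signature_warped b q : constant_signature g (b, q) ->
  (f b = 0 -> (forall X, act X f b = 0) \/ gF q = 0) /\
  (f b != 0 -> constant_signature gF q).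
Proof.
move=> [s [t H]]; have [[A C] /= [nA nC] AC] := H.
have [s0 [t0 st0]] := sig_mx_exists (hgB.1 b).
split=> fb.
  have [->|gF0] := eqVneq (gF q) 0; [by right|left=> X].
  have [s1 [t1 st1]] := sig_mx_exists (hgF.1 q).
  have st := nbhs_singleton H.
  have [es et] : s = s0 /\ t = t0.
    apply: (sig_mx_unique st); rewrite -[s0]addn0 -[t0]addn0.
    apply: (@sig_mx_block _ _ _ (gB b) (f b ^+ 2 *: gF q)) => //.
    by rewrite fb expr0n scale0r; exact: sig_mx0.
  have lsc := signature_lsc (metric_coord_continuous hgB) st0.
  (* At a nearby [b'] with [f b' != 0] the factor B alone already accounts for at least (s0, t0), by
     semicontinuity. Constancy leaves no room for signs of [gF q], which would then be zero. *)
  have f0 : \forall b' \near b, f b' = 0.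
    apply: filterS2 nA lsc => b' Ab' lsc; apply: contrapT => /eqP fb'.
    have [s' [t' st']] := sig_mx_exists (hgB.1 b').
    have [ss tt] := lsc _ _ st'.
    have st2 : has_signature (g (b', q)) s t.
      by apply: (AC (b', q)); split=> //; exact: nbhs_singleton.
    have [es2 et2] := sig_mx_unique st2 (warped_signature fb' st' st1).
    have s10 : s1 = 0%N by move: es es2 ss; clear; lia.
    have t10 : t1 = 0%N by move: et et2 tt; clear; lia.
    by move: gF0; rewrite (@sig_mx00 _ _ (gF q)) ?eqxx // -{1}s10 -t10.
  move: f0; rewrite /prop_near1 nbhsE => -[V [oV Vb] H0].
  by rewrite (act_eq X oV Vb H0) act_const.
exists (s - s0)%N, (t - t0)%N; apply: filterS nC => q' Cq'.
have [s1 [t1 st1]] := sig_mx_exists (hgF.1 q').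
have st2 : has_signature (g (b, q')) s t by apply: (AC (b, q')); split=> //; exact: nbhs_singleton.
have [-> ->] := sig_mx_unique st2 (warped_signature fb st0 st1).
by rewrite !addKn.
Qed.

(** Reduces each covariant derivative to finding a smooth [k] with the values of the inner product
    on the regions of constant signature; elsewhere density decides, whatever the inner product is
    there. *)
Lemma dual_derivative_warped A (w : oneform M) E (k : M -> R) : smooth_fun setT k ->
  smooth_fun setT (act A (pairing w E)) ->
  (forall b q, constant_signature g (b, q) ->
    coinner g (lower K A E) w (b, q) = k (b, q)) ->
  dual_derivative g K A w E = (fun x => act A (pairing w E) x - k x).
Proof.
move=> sk sa ck; apply: smooth_extension_unique.
- exact: warped_sym.
- exact: warped_coord_continuous.
- exact: (smooth_funB openT sa sk).
- by move=> [b q] D; rewrite ck.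
Qed.

Hypotheses (hgB0 : nondegenerate_metric gB) (hgFs : semi_regular gF).
Hypothesis sP : smooth_vfield setT P.
Local Notation sv := (smooth_vfield setT).
Let rsB := nondegenerate_radical_stationary hgB hgB0.
Let rsF := hgFs.1.
Let wsym := warped_sym f hgB hgF.
Let rBB X Y b q := @represents_BB R B F gB gF f P hgF rsB X Y b q.
Let rBF X V b q := represents_BF P hf hgB hgF X V b q.
Let rFB X V b q := represents_FB gB P hf hgF X V b q.
Let rFF U V b q := represents_FF P hf hgF rsF hgB0 (U := U) (V := V) b q.

Ltac ring_slope :=
  gen_atoms;
  match goal with
  | h : _ ^+ 2 * _ = _, h' : _ ^+ 2 * _ = _ |- _ => ring: h h'
  | h : _ ^+ 2 * _ = _ |- _ => ring: h
  | _ => ring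
  end.

Lemma coinnerC (w t : oneform M) x : coinner g w t x = coinner g t w x.
Proof. exact: (bilC wsym). Qed.

Lemma coinner_BB_BB X Y Z T b q : sv X -> sv Y -> sv Z -> sv T ->
  coinner g (lower K (lB X) (lB Y)) (lower K (lB Z) (lB T)) (b, q) =
  coinner gB (lower (koszul gB) X Y) (lower (koszul gB) Z T) b +
  f b ^+ 2 * inner gB X Y b * inner gB Z T b * inner gF P P q.
Proof.
move=> sX sY sZ sT.
rewrite (represents_coinner wsym (rBB b q sX sY) (rBB b q sZ sT)).
rewrite bil_warped bilZl bilZr /coinner /levi_civita /inner.
by gen_atoms; ring.
Qed.

(** Only one quotient by [f] occurs, and f^2 (X f / f) = f X f holds at every point, zeros of [f]
    included. *)
Lemma coinner_BF_BB X V Y Z b q : sv X -> sv Y -> sv Z ->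
  coinner g (lower K (lB X) (lF V)) (lower K (lB Y) (lB Z)) (b, q) =
  (f b ^+ 2 * koszul gB Y Z X b - f b * act X f b * inner gB Y Z b) * inner gF V P q.
Proof.
move=> sX sY sZ.
rewrite (represents_coinner wsym (rBF X V b q) (rBB b q sY sZ)).
rewrite bil_warped !bilZl bilZr (bilC hgB.1) (bil_levi_civita hgB rsB b sY sZ sX) /inner.
(* The quotient becomes a variable known only through this relation, and [ring] computes modulo
   it. *)
move: (sqr_div (f b) (act X f b)); generalize (act X f b / f b).
by ring_slope.
Qed.

Lemma coinner_BB_FB X Y V Z b q : sv X -> sv Y ->
  coinner g (lower K (lB X) (lB Y)) (lower K (lF V) (lB Z)) (b, q) =
  - (f b * act Z f b * inner gB X Y b) * inner gF P V q.
Proof.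
move=> sX sY.
rewrite (represents_coinner wsym (rBB b q sX sY) (rFB Z V b q)).
rewrite bil_warped bil0r bilZl bilZr /inner.
move: (sqr_div (f b) (act Z f b)); generalize (act Z f b / f b).
by ring_slope.
Qed.

(* This is where the restriction to regions of constant signature is needed: the
   left-hand side is 0 wherever [f] is. *)
Lemma slope_prod X Y V W b q : constant_signature g (b, q) ->
  f b ^+ 2 * ((act X f b / f b) * (act Y f b / f b)) * bil gF q (V q) (W q) =
  act X f b * act Y f b * bil gF q (V q) (W q).
Proof.
move=> D; have [H _] := constant_signature_warped D.
have [f0|f0] := eqVneq (f b) 0; last by congr (_ * _); field.
have [a0|gF0] := H f0; first by rewrite !a0 !(mul0r, mulr0).
by rewrite /bil gF0 mulmx0 mul0mx mxE !mulr0.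
Qed.

Lemma coinner_BF_BF X V Y W b q : constant_signature g (b, q) ->
  coinner g (lower K (lB X) (lF V)) (lower K (lB Y) (lF W)) (b, q) =
  f b ^+ 4 * inner gB X Y b * (inner gF V P q * inner gF W P q) +
  act X f b * act Y f b * inner gF V W q.
Proof.
move=> D; rewrite (represents_coinner wsym (rBF X V b q) (rBF Y W b q)).
rewrite bil_warped !bilZl !bilZr /inner -slope_prod //; gen_atoms.
by generalize ((f b)^-1) => *; ring.
Qed.

Lemma coinner_FB_FB X V Y W b q : constant_signature g (b, q) ->
  coinner g (lower K (lF V) (lB X)) (lower K (lF W) (lB Y)) (b, q) =
  act X f b * act Y f b * inner gF V W q.
Proof.
move=> D; rewrite (represents_coinner wsym (rFB X V b q) (rFB Y W b q)).
rewrite bil_warped bil0l !bilZl !bilZr /inner -slope_prod //; gen_atoms.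
by generalize ((f b)^-1) => *; ring.
Qed.

Lemma coinner_FB_BF X V Y W b q : constant_signature g (b, q) ->
  coinner g (lower K (lF V) (lB X)) (lower K (lB Y) (lF W)) (b, q) =
  act X f b * act Y f b * inner gF V W q.
Proof.
move=> D; rewrite (represents_coinner wsym (rFB X V b q) (rBF Y W b q)).
rewrite bil_warped bil0l !bilZl !bilZr /inner -slope_prod //; gen_atoms.
by generalize ((f b)^-1) => *; ring.
Qed.

(** The B-part pairs [levi_civita gB X Y] with the gradient of [f]; this is the first-order half of
    the Hessian. *)
Lemma coinner_BB_FF X Y U V b q : sv X -> sv Y -> sv U -> sv V ->
  coinner g (lower K (lB X) (lB Y)) (lower K (lF U) (lF V)) (b, q) =
  - (f b * act (levi_civita gB X Y) f b) * inner gF U V q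
  - f b ^+ 2 * inner gB X Y b * koszul gF U V P q
  - f b ^+ 4 * inner gB X Y b *
      (inner gF V P q * inner gF U P q - inner gF U V q * inner gF P P q).
Proof.
move=> sX sY sU sV.
rewrite (represents_coinner wsym (rBB b q sX sY) (rFF b q sU sV)).
rewrite bil_warped bilZr (bilC hgB.1) (bil_grad hf hgB0) bilZl (bilC hgF.1 q (P q)).
rewrite bilDl (bil_levi_civita hgF rsF q sU sV sP) bilZl bilBl !bilZl /inner.
by gen_atoms; ring.
Qed.

Lemma coinner_FF_FB U V X W b q : sv U -> sv V -> sv W ->
  coinner g (lower K (lF U) (lF V)) (lower K (lF W) (lB X)) (b, q) =
  f b * act X f b * koszul gF U V W q +
  f b ^+ 3 * act X f b * (inner gF V P q * inner gF U W q - inner gF U V q * inner gF P W q).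
Proof.
move=> sU sV sW.
rewrite (represents_coinner wsym (rFF b q sU sV) (rFB X W b q)).
rewrite bil_warped bil0r bilZr bilDl (bil_levi_civita hgF rsF q sU sV sW) bilZl bilBl !bilZl.
rewrite /inner; move: (sqr_div (f b) (act X f b)); generalize (act X f b / f b).
by ring_slope.
Qed.

Lemma coinner_BF_FF X W U V b q : sv U -> sv V -> sv W ->
  coinner g (lower K (lB X) (lF W)) (lower K (lF U) (lF V)) (b, q) =
  f b * act X f b * koszul gF U V W q +
  f b ^+ 3 * act X f b *
    (inner gF V P q * inner gF U W q - inner gF U V q * inner gF P W q
     - inner gF W P q * inner gF U V q).
Proof.
move=> sU sV sW.
rewrite (represents_coinner wsym (rBF X W b q) (rFF b q sU sV)) (bilC wsym).
rewrite bil_warped !bilZl !bilZr (bil_grad hf hgB0) bilDl.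
rewrite (bil_levi_civita hgF rsF q sU sV sW) bilZl bilBl !bilZl.
rewrite /inner; move: (sqr_div (f b) (act X f b)); generalize (act X f b / f b).
by ring_slope.
Qed.

Lemma coinner_FF_FF U V W Q b q : sv U -> sv V -> sv W -> sv Q ->
  coinner g (lower K (lF U) (lF V)) (lower K (lF W) (lF Q)) (b, q) =
  f b ^+ 2 * coinner gB (dform f) (dform f) b * (inner gF U V q * inner gF W Q q) +
  f b ^+ 2 * coinner gF (lower (koszul gF) U V) (lower (koszul gF) W Q) q +
  f b ^+ 4 * (inner gF Q P q * koszul gF U V W q - inner gF W Q q * koszul gF U V P q +
              inner gF V P q * koszul gF W Q U q - inner gF U V q * koszul gF W Q P q) +
  f b ^+ 6 * (inner gF V P q * inner gF Q P q * inner gF U W q -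
              inner gF V P q * inner gF W Q q * inner gF U P q -
              inner gF U V q * inner gF Q P q * inner gF P W q +
              inner gF U V q * inner gF W Q q * inner gF P P q).
Proof.
move=> sU sV sW sQ.
rewrite (represents_coinner wsym (rFF b q sU sV) (rFF b q sW sQ)).
rewrite bil_warped !bilZl !bilZr bilDl bilDr bilZr.
have bilBr u v w : bil gF q u (v - w) = bil gF q u v - bil gF q u w.
  by rewrite bilDr bilNr.
rewrite bilBr !bilZr (bil_levi_civita hgF rsF q sU sV sW) (bil_levi_civita hgF rsF q sU sV sP).
rewrite bilZl bilBl !bilZl !bilDr !bilZr !bilBr !bilZr.
rewrite -> (bilC hgF.1 q (U q) (levi_civita gF W Q q)), (bilC hgF.1 q (P q) (levi_civita gF W Q q)).
rewrite -> (bil_levi_civita hgF rsF q sW sQ sU), (bil_levi_civita hgF rsF q sW sQ sP).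
rewrite /coinner /levi_civita /inner /grad.
by gen_atoms; ring.
Qed.

End Warped.

Ltac proj := cbn beta iota delta [fst snd].

(** * Covariant derivatives of the lower derivatives of lifts *)

Section Warped.
Context {R : realType} (B F : manifold R).
Local Notation M := (prod_manifold B F).
Local Notation lB := (@liftB R B F).
Local Notation lF := (@liftF R B F).
Implicit Types (X Y Z T : vfield B) (U V W Q : vfield F) (b : B) (q : F).

Lemma act_liftB_mul X (h1 : B -> R) (h2 : F -> R) :
  act (lB X) (fun x => h1 x.1 * h2 x.2) = (fun x => act X h1 x.1 * h2 x.2).
Proof. by apply/funext => -[b q]; rewrite act_liftB /= act_scaler. Qed.

Lemma act_liftF_mul V (h1 : B -> R) (h2 : F -> R) :
  act (lF V) (fun x => h1 x.1 * h2 x.2) = (fun x => h1 x.1 * act V h2 x.2).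
Proof. by apply/funext => -[b q]; rewrite act_liftF /= act_scale. Qed.

Variables (gB : tensor2 B) (gF : tensor2 F) (f : B -> R) (P : vfield F).
Local Notation g := (warped f gB gF).
Local Notation K := (koszul_bar g (lF P)).
Local Notation sv := (smooth_vfield setT).
Hypotheses (hf : smooth_fun setT f) (hgB : is_metric gB) (hgF : is_metric gF).
Hypotheses (hgB0 : nondegenerate_metric gB) (hgFs : semi_regular gF).
Hypothesis sP : sv P.

Lemma act_levi_civita X Y b : sv X -> sv Y ->
  act (levi_civita gB X Y) f b = coinner gB (lower (koszul gB) X Y) (dform f) b.
Proof. by move=> sX sY; rewrite -(bil_grad hf hgB0) (bilC hgB.1). Qed.

(** [levi_civita] is a pointwise choice, so smoothness is read off from the inner product of two
    smooth forms instead. *)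
Lemma smooth_act_levi_civita X Y : sv X -> sv Y ->
  smooth_fun setT (act (levi_civita gB X Y) f).
Proof.
move=> sX sY.
have -> : act (levi_civita gB X Y) f = coinner gB (lower (koszul gB) X Y) (dform f).
  by apply/funext => b; exact: act_levi_civita.
by apply: smooth_coinner => //; [exact: smooth_lower_koszul|exact: smooth_dform].
Qed.

(** The use of the second clause of semi-regularity: the extended derivative is the pairing with a
    smooth form. *)
Lemma smooth_dual_derivative U V W Q : sv U -> sv V -> sv W -> sv Q ->
  smooth_fun setT (dual_derivative gF (koszul gF) U (lower (koszul gF) V W) Q).
Proof.
move=> sU sV sW sQ; have [w [sw _] ->] := hgFs.2 _ _ _ sV sW sU; last exact: sQ.
exact: (sw _ _ openT sQ).
Qed.

(** On the nondegenerate factor the defining expression is smooth everywhere, hence is its own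
    extension. *)
Lemma riemann_dual_derivative X Y Z T : sv X -> sv Y -> sv Z -> sv T ->
  dual_derivative gB (koszul gB) X (lower (koszul gB) Y Z) T =
  (fun b => act X (koszul gB Y Z T) b -
            coinner gB (lower (koszul gB) X T) (lower (koszul gB) Y Z) b).
Proof.
move=> sX sY sZ sT; rewrite /dual_derivative (pairing_koszulT hgB sY sZ sT).
apply: smooth_extension_unique => //; [exact: hgB.1|exact: metric_coord_continuous|].
apply: (smooth_funB openT); last by apply: smooth_coinner => //; exact: smooth_lower_koszul.
by apply: smooth_act => //; exact: (koszul_smooth hgB openT).
Qed.

Ltac smooth :=
  lazymatch goal with
  | |- smooth_fun _ f => exact: hf
  | |- smooth_fun _ (fun x => @?a x + @?b x) => apply: (@smooth_funD _ _ _ a b openT); smooth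
  | |- smooth_fun _ (fun x => - @?a x) => apply: (@smooth_funN _ _ _ a openT); smooth
  | |- smooth_fun _ (fun x => @?a x * @?b x) => apply: (@smooth_funM _ _ _ a b openT); smooth
  | |- smooth_fun _ (fun x => @?a x ^+ ?m) => apply: (@smooth_funX _ _ _ a m openT); smooth
  | |- smooth_fun _ (fun x => ?h x.1) => apply: (@smooth_fun_fst _ _ _ h); smooth
  | |- smooth_fun _ (fun x => ?h x.2) => apply: (@smooth_fun_snd _ _ _ h); smooth
  | |- smooth_fun _ (act (levi_civita _ _ _) f) => apply: smooth_act_levi_civita; assumption
  | |- smooth_fun _ (act _ _) => apply: smooth_act; [assumption|smooth]
  | |- smooth_fun _ (inner gB _ _) => apply: (inner_smooth hgB openT); assumption
  | |- smooth_fun _ (inner gF _ _) => apply: (inner_smooth hgF openT); assumption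
  | |- smooth_fun _ (koszul gB _ _ _) => apply: (koszul_smooth hgB openT); assumption
  | |- smooth_fun _ (koszul gF _ _ _) => apply: (koszul_smooth hgF openT); assumption
  | |- smooth_fun _ (dual_derivative _ _ _ _ _) => apply: smooth_dual_derivative; assumption
  | |- smooth_fun _ (coinner gB _ _) => apply: (smooth_coinner hgB hgB0); smooth
  | |- smooth_oneform (lower (koszul gB) _ _) => apply: smooth_lower_koszul; assumption
  | |- smooth_oneform (dform f) => apply: smooth_dform; assumption
  | |- smooth_fun _ (fun x => ?h x) => change (smooth_fun setT h); smooth
  | |- smooth_fun _ (fun x => ?c) => exact: (smooth_fun_cst _ c)
  end.

Ltac dual k :=
  rewrite (@dual_derivative_warped _ _ _ _ _ f P hf hgB hgF _ _ _ k).

Lemma dual_BBBB X Y Z T b q : sv X -> sv Y -> sv Z -> sv T ->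
  dual_derivative g K (lB X) (lower K (lB Y) (lB Z)) (lB T) (b, q) =
  dual_derivative gB (koszul gB) X (lower (koszul gB) Y Z) T b -
  f b ^+ 2 * inner gB X T b * inner gB Y Z b * inner gF P P q.
Proof.
move=> sX sY sZ sT.
dual (fun x : M => coinner gB (lower (koszul gB) X T) (lower (koszul gB) Y Z) x.1 +
  f x.1 ^+ 2 * inner gB X T x.1 * inner gB Y Z x.1 * inner gF P P x.2).
- rewrite pair_BBB // (pairing_koszulT hgB sY sZ sT) act_liftB_fst.
  by rewrite (riemann_dual_derivative sX sY sZ sT); proj; gen_atoms; ring.
- smooth.
- by rewrite pair_BBB // (pairing_koszulT hgB sY sZ sT) act_liftB_fst; smooth.
- by move=> b' q' _; rewrite coinner_BB_BB.
Qed.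

Lemma dual_BBBF X Y Z Q b q : sv X -> sv Y -> sv Z -> sv Q ->
  dual_derivative g K (lB X) (lower K (lB Y) (lB Z)) (lF Q) (b, q) =
  - (act X (inner gB Y Z) b * f b ^+ 2 + f b * act X f b * inner gB Y Z b
     + f b ^+ 2 * koszul gB Y Z X b) * inner gF P Q q.
Proof.
move=> sX sY sZ sQ.
dual (fun x : M => (f x.1 ^+ 2 * koszul gB Y Z X x.1 -
  f x.1 * act X f x.1 * inner gB Y Z x.1) * inner gF Q P x.2).
- rewrite pair_BBF // (act_liftB_mul X (fun b => - (inner gB Y Z b * f b ^+ 2))); proj.
  have sg : smooth_fun setT (inner gB Y Z) by smooth.
  have sf : smooth_fun setT (fun b => f b ^+ 2) by smooth.
  rewrite (actN openT (I : setT b) X (smooth_funM openT sg sf)).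
  rewrite (actM openT (I : setT b) X sg sf) act_sqr // (innerC hgF.1 Q).
  by gen_atoms; ring.
- smooth.
- by rewrite pair_BBF // (act_liftB_mul X (fun b => - (inner gB Y Z b * f b ^+ 2))); smooth.
- by move=> b' q' _; rewrite coinner_BF_BB.
Qed.

Lemma dual_BFBB Z Q X Y b q : sv X -> sv Y -> sv Z -> sv Q ->
  dual_derivative g K (lB Z) (lower K (lF Q) (lB X)) (lB Y) (b, q) =
  f b * act X f b * inner gB Z Y b * inner gF P Q q.
Proof.
move=> sX sY sZ sQ.
dual (fun x : M => - (f x.1 * act X f x.1 * inner gB Z Y x.1) * inner gF P Q x.2).
- by rewrite pair_FBB // act_const; proj; gen_atoms; ring.
- smooth.
- have -> : act (lB Z) (pairing (lower K (lF Q) (lB X)) (lB Y)) = (fun=> 0).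
    by apply/funext => x; rewrite pair_FBB // act_const.
  exact: smooth_fun_cst.
- by move=> b' q' _; rewrite coinner_BB_FB.
Qed.

Lemma dual_FBBB Q Z X Y b q : sv X -> sv Y -> sv Z -> sv Q ->
  dual_derivative g K (lF Q) (lower K (lB Z) (lB X)) (lB Y) (b, q) =
  f b * act Y f b * inner gB Z X b * inner gF P Q q.
Proof.
move=> sX sY sZ sQ.
dual (fun x : M => - (f x.1 * act Y f x.1 * inner gB Z X x.1) * inner gF P Q x.2).
- by rewrite pair_BBB // act_liftF_fst; proj; gen_atoms; ring.
- smooth.
- by rewrite pair_BBB // act_liftF_fst; exact: smooth_fun_cst.
- by move=> b' q' _; rewrite coinnerC // coinner_BB_FB.
Qed.

(** The product rule for X(f Y f) leaves a term X f Y f <W,Q>. The candidate cancels it also at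
    zeros of [f], where the unextended inner product would contribute 0; so the extension matters
    here. *)
Lemma dual_BBFF X Y W Q b q : sv X -> sv Y -> sv W -> sv Q ->
  dual_derivative g K (lB X) (lower K (lB Y) (lF W)) (lF Q) (b, q) =
  f b * act X (act Y f) b * inner gF W Q q
  - f b ^+ 4 * inner gB X Y b * (inner gF Q P q * inner gF W P q).
Proof.
move=> sX sY sW sQ.
dual (fun x : M => f x.1 ^+ 4 * inner gB X Y x.1 * (inner gF Q P x.2 * inner gF W P x.2) +
  act X f x.1 * act Y f x.1 * inner gF Q W x.2).
- rewrite pair_BFF // (act_liftB_mul X (fun b => f b * act Y f b)); proj.
  have sa : smooth_fun setT (act Y f) by smooth.
  rewrite (actM openT (I : setT b) X hf sa) (innerC hgF.1 Q W).
  by gen_atoms; ring.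
- smooth.
- by rewrite pair_BFF // (act_liftB_mul X (fun b => f b * act Y f b)); smooth.
- by move=> b' q' D; rewrite coinner_BF_BF.
Qed.

Lemma dual_FFBB W Q X Y b q : sv X -> sv Y -> sv W -> sv Q ->
  dual_derivative g K (lF W) (lower K (lF Q) (lB X)) (lB Y) (b, q) =
  - (act X f b * act Y f b * inner gF W Q q).
Proof.
move=> sX sY sW sQ.
dual (fun x : M => act Y f x.1 * act X f x.1 * inner gF W Q x.2).
- by rewrite pair_FBB // act_const; proj; gen_atoms; ring.
- smooth.
- have -> : act (lF W) (pairing (lower K (lF Q) (lB X)) (lB Y)) = (fun=> 0).
    by apply/funext => x; rewrite pair_FBB // act_const.
  exact: smooth_fun_cst.
- by move=> b' q' D; rewrite coinner_FB_FB.
Qed.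

Lemma dual_BFFB X V W T b q : sv X -> sv T -> sv V -> sv W ->
  dual_derivative g K (lB X) (lower K (lF V) (lF W)) (lB T) (b, q) =
  - (act X f b * act T f b + f b * hessian gB f X T b) * inner gF V W q
  + f b ^+ 2 * inner gB X T b * koszul gF V W P q
  + f b ^+ 4 * inner gB X T b *
      (inner gF W P q * inner gF V P q - inner gF V W q * inner gF P P q).
Proof.
move=> sX sT sV sW.
dual (fun x : M => - (f x.1 * act (levi_civita gB X T) f x.1) * inner gF V W x.2
  - f x.1 ^+ 2 * inner gB X T x.1 * koszul gF V W P x.2
  - f x.1 ^+ 4 * inner gB X T x.1 *
      (inner gF W P x.2 * inner gF V P x.2 - inner gF V W x.2 * inner gF P P x.2)).
- rewrite pair_FFB // (act_liftB_mul X (fun b => - (f b * act T f b))); proj.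
  have sa : smooth_fun setT (act T f) by smooth.
  rewrite (actN openT (I : setT b) X (smooth_funM openT hf sa)).
  (* The Hessian assembles from X(T f), given by the product rule, and the first-order term of the
     inner product. *)
  rewrite (actM openT (I : setT b) X hf sa) /hessian.
  by gen_atoms; ring.
- smooth.
- by rewrite pair_FFB // (act_liftB_mul X (fun b => - (f b * act T f b))); smooth.
- by move=> b' q' D; rewrite coinner_BB_FF.
Qed.

Lemma dual_FBFB V X W T b q : sv X -> sv T -> sv V -> sv W ->
  dual_derivative g K (lF V) (lower K (lB X) (lF W)) (lB T) (b, q) =
  f b ^+ 2 * inner gB X T b * act V (inner gF W P) q
  - act X f b * act T f b * inner gF V W q.
Proof.
move=> sX sT sV sW.
dual (fun x : M => act T f x.1 * act X f x.1 * inner gF V W x.2).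
- rewrite (pair_BFB P hf hgB hgF) (act_liftF_mul V (fun b => f b ^+ 2 * inner gB X T b)); proj.
  by gen_atoms; ring.
- smooth.
- by rewrite (pair_BFB P hf hgB hgF) (act_liftF_mul V (fun b => f b ^+ 2 * inner gB X T b)); smooth.
- by move=> b' q' D; rewrite coinner_FB_BF.
Qed.

Lemma dual_FFBF U V Z Q b q : sv Z -> sv U -> sv V -> sv Q ->
  dual_derivative g K (lF U) (lower K (lF V) (lB Z)) (lF Q) (b, q) =
  f b * act Z f b * (act U (inner gF V Q) q - koszul gF U Q V q)
  - f b ^+ 3 * act Z f b *
      (inner gF Q P q * inner gF U V q - inner gF U Q q * inner gF P V q).
Proof.
move=> sZ sU sV sQ.
dual (fun x : M => f x.1 * act Z f x.1 * koszul gF U Q V x.2 +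
  f x.1 ^+ 3 * act Z f x.1 *
    (inner gF Q P x.2 * inner gF U V x.2 - inner gF U Q x.2 * inner gF P V x.2)).
- rewrite pair_FBF // (act_liftF_mul U (fun b => f b * act Z f b)); proj.
  by gen_atoms; ring.
- smooth.
- by rewrite pair_FBF // (act_liftF_mul U (fun b => f b * act Z f b)); smooth.
- by move=> b' q' D; rewrite coinner_FF_FB.
Qed.

Lemma dual_FBFF Q Z U V b q : sv Z -> sv U -> sv V -> sv Q ->
  dual_derivative g K (lF Q) (lower K (lB Z) (lF U)) (lF V) (b, q) =
  f b * act Z f b * (act Q (inner gF U V) q - koszul gF Q V U q)
  - f b ^+ 3 * act Z f b *
      (inner gF V P q * inner gF Q U q - inner gF Q V q * inner gF P U q
       - inner gF U P q * inner gF Q V q).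
Proof.
move=> sZ sU sV sQ.
dual (fun x : M => f x.1 * act Z f x.1 * koszul gF Q V U x.2 +
  f x.1 ^+ 3 * act Z f x.1 *
    (inner gF V P x.2 * inner gF Q U x.2 - inner gF Q V x.2 * inner gF P U x.2
     - inner gF U P x.2 * inner gF Q V x.2)).
- rewrite pair_BFF // (act_liftF_mul Q (fun b => f b * act Z f b)); proj.
  by gen_atoms; ring.
- smooth.
- by rewrite pair_BFF // (act_liftF_mul Q (fun b => f b * act Z f b)); smooth.
- by move=> b' q' D; rewrite coinnerC // coinner_BF_FF.
Qed.

Lemma act_liftB_FFF Z Q U V : sv Z -> sv Q -> sv U -> sv V ->
  act (lB Z) (pairing (lower K (lF Q) (lF U)) (lF V)) =
  (fun x => 2 * f x.1 * act Z f x.1 * koszul gF Q U V x.2 +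
     4 * f x.1 ^+ 3 * act Z f x.1 * (inner gF U P x.2 * inner gF Q V x.2 -
        inner gF Q U x.2 * inner gF P V x.2)).
Proof.
move=> sZ sQ sU sV; rewrite pair_FFF // (pairing_koszulT hgF sQ sU sV).
apply/funext => -[b q]; rewrite act_liftB; proj.
have s2 c : smooth_fun setT (fun b => f b ^+ 2 * c) by smooth.
have s4 c : smooth_fun setT (fun b => f b ^+ 4 * c) by smooth.
rewrite (actD openT (I : setT b) Z (s2 _) (s4 _)) !act_scaler act_sqr //.
by rewrite (actX openT (I : setT b) Z 3 hf).
Qed.

Lemma dual_BFFF Z Q U V b q : sv Z -> sv U -> sv V -> sv Q ->
  dual_derivative g K (lB Z) (lower K (lF Q) (lF U)) (lF V) (b, q) =
  f b * act Z f b * koszul gF Q U V q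
  + f b ^+ 3 * act Z f b *
      (3 * (inner gF U P q * inner gF Q V q - inner gF Q U q * inner gF P V q)
       + inner gF V P q * inner gF Q U q).
Proof.
move=> sZ sU sV sQ.
dual (fun x : M => f x.1 * act Z f x.1 * koszul gF Q U V x.2 +
  f x.1 ^+ 3 * act Z f x.1 *
    (inner gF U P x.2 * inner gF Q V x.2 - inner gF Q U x.2 * inner gF P V x.2
     - inner gF V P x.2 * inner gF Q U x.2)).
- by rewrite act_liftB_FFF //; proj; gen_atoms; ring.
- smooth.
- by rewrite act_liftB_FFF //; smooth.
- by move=> b' q' D; rewrite coinner_BF_FF.
Qed.

Lemma act_liftF_FFF U V W Q : sv U -> sv Q -> sv V -> sv W ->
  act (lF U) (pairing (lower K (lF V) (lF W)) (lF Q)) =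
  (fun x => f x.1 ^+ 2 * act U (koszul gF V W Q) x.2 +
     f x.1 ^+ 4 *
       (inner gF W P x.2 * act U (inner gF V Q) x.2 +
        inner gF V Q x.2 * act U (inner gF W P) x.2 -
        (inner gF V W x.2 * act U (inner gF P Q) x.2 +
         inner gF P Q x.2 * act U (inner gF V W) x.2))).
Proof.
move=> sU sQ sV sW; rewrite pair_FFF // (pairing_koszulT hgF sV sW sQ).
apply/funext => -[b q]; rewrite act_liftF; proj.
have s1 c : smooth_fun setT (fun q => c * koszul gF V W Q q) by smooth.
have sg A C : sv A -> sv C -> smooth_fun setT (inner gF A C) by move=> sA sC; smooth.
have sm1 := smooth_funM openT (sg _ _ sW sP) (sg _ _ sV sQ).
have sm2 := smooth_funM openT (sg _ _ sV sW) (sg _ _ sP sQ).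
have s2 c : smooth_fun setT (fun q => c *
    (inner gF W P q * inner gF V Q q - inner gF V W q * inner gF P Q q)) by smooth.
rewrite (actD openT (I : setT q) U (s1 _) (s2 _)) !act_scale.
rewrite (actB openT (I : setT q) U sm1 sm2).
rewrite (actM openT (I : setT q) U (sg _ _ sW sP) (sg _ _ sV sQ)).
by rewrite (actM openT (I : setT q) U (sg _ _ sV sW) (sg _ _ sP sQ)).
Qed.

(** The candidate trades the possibly non-smooth inner product on F for a difference with the
    extended derivative on F. The two agree at [q] when [f b] is nonzero, as F then has constant
    signature near [q]; otherwise every term carries a power of [f]. *)
Lemma dual_FFFF U V W Q b q : sv U -> sv V -> sv W -> sv Q ->
  dual_derivative g K (lF U) (lower K (lF V) (lF W)) (lF Q) (b, q) =
  f b ^+ 2 * dual_derivative gF (koszul gF) U (lower (koszul gF) V W) Q q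
  - f b ^+ 2 * coinner gB (dform f) (dform f) b * (inner gF U Q q * inner gF V W q)
  + f b ^+ 4 *
     (inner gF W P q * act U (inner gF V Q) q + inner gF V Q q * act U (inner gF W P) q -
      (inner gF V W q * act U (inner gF P Q) q + inner gF P Q q * act U (inner gF V W) q)
      - (inner gF W P q * koszul gF U Q V q - inner gF V W q * koszul gF U Q P q +
         inner gF Q P q * koszul gF V W U q - inner gF U Q q * koszul gF V W P q))
  - f b ^+ 6 * (inner gF Q P q * inner gF W P q * inner gF U V q -
              inner gF Q P q * inner gF V W q * inner gF U P q -
              inner gF U Q q * inner gF W P q * inner gF P V q +
              inner gF U Q q * inner gF V W q * inner gF P P q).
Proof.
move=> sU sV sW sQ.
dual (fun x : M =>
  f x.1 ^+ 2 * coinner gB (dform f) (dform f) x.1 * (inner gF U Q x.2 * inner gF V W x.2) +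
  f x.1 ^+ 2 * (act U (koszul gF V W Q) x.2 -
     dual_derivative gF (koszul gF) U (lower (koszul gF) V W) Q x.2) +
  f x.1 ^+ 4 *
    (inner gF W P x.2 * koszul gF U Q V x.2 - inner gF V W x.2 * koszul gF U Q P x.2 +
     inner gF Q P x.2 * koszul gF V W U x.2 - inner gF U Q x.2 * koszul gF V W P x.2) +
  f x.1 ^+ 6 * (inner gF Q P x.2 * inner gF W P x.2 * inner gF U V x.2 -
              inner gF Q P x.2 * inner gF V W x.2 * inner gF U P x.2 -
              inner gF U Q x.2 * inner gF W P x.2 * inner gF P V x.2 +
              inner gF U Q x.2 * inner gF V W x.2 * inner gF P P x.2)).
- rewrite act_liftF_FFF //; proj.
  generalize (dual_derivative gF (koszul gF) U (lower (koszul gF) V W) Q q).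
  by gen_atoms; ring.
- smooth.
- by rewrite act_liftF_FFF //; smooth.
- move=> b' q' D; rewrite coinner_FF_FF //; proj.
  have [_ H] := constant_signature_warped hgB hgF D.
  have [f0|f0] := eqVneq (f b') 0; first by rewrite f0 !expr0n /= !mul0r.
  rewrite /dual_derivative (smooth_extension_agree _ (H f0)).
  rewrite (pairing_koszulT hgF sV sW sQ).
  by gen_atoms; ring.
Qed.

End Warped.

(** * Curvature *)

Section Curvature.
Context {R : realType} (B F : manifold R).
Local Notation lB := (@liftB R B F).
Local Notation lF := (@liftF R B F).
Local Notation sv := (smooth_vfield setT).
Variables (gB : tensor2 B) (gF : tensor2 F) (f : B -> R) (P : vfield F).
Hypotheses (hf : smooth_fun setT f) (hgB : is_metric gB) (hgF : is_metric gF).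
Hypotheses (hgB0 : nondegenerate_metric gB) (hgFs : semi_regular gF).
Hypothesis sP : sv P.
Variables (X Y Z T : vfield B) (U V W Q : vfield F).
Hypotheses (sX : sv X) (sY : sv Y) (sZ : sv Z) (sT : sv T).
Hypotheses (sU : sv U) (sV : sv V) (sW : sv W) (sQ : sv Q).
Variables (b : B) (q : F).
Local Notation Rbar := (riemann_bar (warped f gB gF) (lF P)).
Local Notation gb S1 S2 := (inner gB S1 S2 b).
Local Notation gf S1 S2 := (inner gF S1 S2 q).
Local Notation KF S1 S2 S3 := (koszul gF S1 S2 S3 q).

Ltac gen_duals :=
  repeat match goal with
  | |- context [dual_derivative ?a ?b ?c ?d ?e ?p] =>
    generalize (dual_derivative a b c d e p)
  end.

Lemma curvature_BBBB : Rbar (lB X) (lB Y) (lB Z) (lB T) (b, q) =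
  riemann gB X Y Z T b + f b ^+ 2 * gb X Z * gf P P * gb Y T
  - f b ^+ 2 * gb Y Z * gf P P * gb X T.
Proof.
rewrite /riemann_bar /riemann /curvature.
rewrite -> (dual_BBBB hf hgB hgF hgB0 sP b q sX sY sZ sT),
  (dual_BBBB hf hgB hgF hgB0 sP b q sY sX sZ sT), lie_liftBB, (pair_BBB gB f P hgF).
by proj; gen_duals; gen_atoms; ring.
Qed.

Lemma curvature_BBBF : Rbar (lB X) (lB Y) (lB Z) (lF Q) (b, q) =
  - f b * act X f b * gb Y Z * gf P Q + f b * act Y f b * gb X Z * gf P Q.
Proof.
rewrite /riemann_bar /curvature.
rewrite -> (dual_BBBF hf hgB hgF hgB0 sP b q sX sY sZ sQ),
  (dual_BBBF hf hgB hgF hgB0 sP b q sY sX sZ sQ), lie_liftBB, (pair_BBF gB f P hgF).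
(* With factor f^2 there remain Koszul terms and the bracket term; metric compatibility and
   vanishing torsion cancel them all, leaving the derivatives of [f]. *)
proj; rewrite -> (koszul_metric hgB.1 X Y Z), (koszul_metric hgB.1 Y X Z),
  (koszul_torsion hgB.1 X Y Z).
by gen_atoms; ring.
Qed.

Lemma curvature_BFBB : Rbar (lB Z) (lF Q) (lB X) (lB Y) (b, q) =
  f b * act X f b * gb Y Z * gf P Q - f b * act Y f b * gb X Z * gf P Q.
Proof.
rewrite /riemann_bar /curvature.
rewrite -> (dual_BFBB hf hgB hgF hgB0 sP b q sX sY sZ sQ),
  (dual_FBBB hf hgB hgF hgB0 sP b q sX sY sZ sQ), lie_liftBF,
  (lower_zero_liftB gB P hf hgF), pairing_zero.
rewrite -> (innerC hgB.1 Z Y), (innerC hgB.1 Z X).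
by gen_atoms; ring.
Qed.

(** X(Y f) - Y(X f) is cancelled by the bracket term, and the rest is symmetric in [X] and [Y]. *)
Lemma curvature_BBFF : Rbar (lB X) (lB Y) (lF W) (lF Q) (b, q) = 0.
Proof.
rewrite /riemann_bar /curvature.
rewrite -> (dual_BBFF hf hgB hgF sP b q sX sY sW sQ),
  (dual_BBFF hf hgB hgF sP b q sY sX sW sQ), lie_liftBB, (pair_BFF P hf hgB hgF).
proj; rewrite -> (act_lie openT (I : setT b) sX sY hf), (innerC hgB.1 Y X).
by gen_atoms; ring.
Qed.

Lemma curvature_FFBB : Rbar (lF W) (lF Q) (lB X) (lB Y) (b, q) = 0.
Proof.
rewrite /riemann_bar /curvature.
rewrite -> (dual_FFBB P hf hgB hgF b q sX sY sW sQ),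
  (dual_FFBB P hf hgB hgF b q sX sY sQ sW), lie_liftFF, (pair_FBB gB P hf hgF).
by rewrite -> (innerC hgF.1 Q W); gen_atoms; ring.
Qed.

Lemma curvature_BFFB : Rbar (lB X) (lF V) (lF W) (lB T) (b, q) =
  - f b * hessian gB f X T b * gf V W
  - (KF V P W + f b ^+ 2 * gf P P * gf V W - f b ^+ 2 * gf V P * gf P W)
    * f b ^+ 2 * gb X T.
Proof.
rewrite /riemann_bar /curvature.
rewrite -> (dual_BFFB hf hgB hgF hgB0 hgFs sP b q sX sT sV sW),
  (dual_FBFB hf hgB hgF sP b q sX sT sV sW), lie_liftBF,
  (lower_zero_liftF P hf hgB hgF), pairing_zero.
(* V<W,P> splits into K_F(V,W,P), which cancels, and the term K_F(V,P,W) of the result; the products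
   X f T f cancel as well. *)
rewrite -> (koszul_metric hgF.1 V W P), (innerC hgF.1 W P).
by generalize (hessian gB f X T b); gen_atoms; ring.
Qed.

Lemma curvature_FFBF : Rbar (lF U) (lF V) (lB Z) (lF Q) (b, q) =
  f b ^+ 3 * act Z f b * (- gf P U * gf Q V + gf P V * gf Q U).
Proof.
rewrite /riemann_bar /curvature.
rewrite -> (dual_FFBF hf hgB hgF hgB0 hgFs sP b q sZ sU sV sQ),
  (dual_FFBF hf hgB hgF hgB0 hgFs sP b q sZ sV sU sQ), lie_liftFF,
  (pair_FBF gB P hf hgF).
(* The part linear in [f] becomes K_F(U,V,Q) - K_F(V,U,Q) - <[U,V],Q>, which vanishes as the
   torsion. *)
proj; rewrite -> (koszul_metric hgF.1 U V Q), (koszul_metric hgF.1 V U Q),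
  (koszul_torsion hgF.1 U V Q), (innerC hgF.1 V U), (innerC hgF.1 Q V), (innerC hgF.1 Q U).
by gen_atoms; ring.
Qed.

Lemma curvature_BFFF : Rbar (lB Z) (lF Q) (lF U) (lF V) (b, q) =
  - (f b ^+ 3 * act Z f b * (- gf P U * gf Q V + gf P V * gf Q U)).
Proof.
rewrite /riemann_bar /curvature.
rewrite -> (dual_BFFF hf hgB hgF hgB0 hgFs sP b q sZ sU sV sQ),
  (dual_FBFF hf hgB hgF hgB0 hgFs sP b q sZ sU sV sQ), lie_liftBF,
  (lower_zero_liftF P hf hgB hgF), pairing_zero.
rewrite -> (koszul_metric hgF.1 Q U V), (innerC hgF.1 U P), (innerC hgF.1 V P).
by gen_atoms; ring.
Qed.

Lemma curvature_FFFF : Rbar (lF U) (lF V) (lF W) (lF Q) (b, q) =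
  f b ^+ 2 * riemann gF U V W Q q
  + f b ^+ 2 * coinner gB (dform f) (dform f) b * (gf U W * gf V Q - gf V W * gf U Q)
  - f b ^+ 6 * gf V P * gf U W * gf P Q + f b ^+ 6 * gf U P * gf V W * gf P Q
  + f b ^+ 4 * KF U P W * gf V Q - f b ^+ 4 * KF V P W * gf U Q
  - f b ^+ 4 * KF U P Q * gf V W + f b ^+ 4 * KF V P Q * gf U W
  + f b ^+ 6 * gf P P * gf U W * gf V Q - f b ^+ 6 * gf U P * gf P W * gf V Q
  - f b ^+ 6 * gf P P * gf V W * gf U Q + f b ^+ 6 * gf V P * gf P W * gf U Q.
Proof.
rewrite /riemann_bar /riemann /curvature.
rewrite -> (dual_FFFF hf hgB hgF hgB0 hgFs sP b q sU sV sW sQ),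
  (dual_FFFF hf hgB hgF hgB0 hgFs sP b q sV sU sW sQ), lie_liftFF,
  (pair_FFF gB P hf hgF).
(* At order f^4 all derivatives of inner products turn into Koszul terms. Those without [P] among
   the arguments cancel against the bracket by vanishing torsion, and what survives has [P] in the
   middle slot. *)
proj; rewrite -> (koszul_metric hgF.1 U V Q), (koszul_metric hgF.1 U W P),
  (koszul_metric hgF.1 U P Q), (koszul_metric hgF.1 U V W),
  (koszul_metric hgF.1 V U Q), (koszul_metric hgF.1 V W P),
  (koszul_metric hgF.1 V P Q), (koszul_metric hgF.1 V U W).
rewrite -> (koszul_torsion hgF.1 U V Q), (koszul_torsion hgF.1 U V W),
  (innerC hgF.1 V U), (innerC hgF.1 Q P), (innerC hgF.1 P W), (innerC hgF.1 P V),
  ?(innerC hgF.1 P U).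
by gen_duals; gen_atoms; ring.
Qed.

End Curvature.

Theorem theorem2p18 (R : realType) (B F : manifold R)
    (gB : tensor2 B) (gF : tensor2 F) (f : B -> R)
    (hgB : is_metric gB) (hgB0 : nondegenerate_metric gB)
    (hgF : is_metric gF) (hgFs : semi_regular gF)
    (hf : smooth_fun setT f)
    (X Y Z T : vfield B) (U V W Q P : vfield F)
    (hX : smooth_vfield setT X) (hY : smooth_vfield setT Y)
    (hZ : smooth_vfield setT Z) (hT : smooth_vfield setT T)
    (hU : smooth_vfield setT U) (hV : smooth_vfield setT V)
    (hW : smooth_vfield setT W) (hQ : smooth_vfield setT Q)
    (hP : smooth_vfield setT P)
    (b : B) (q : F) :
  let Rbar := riemann_bar (warped f gB gF) (liftF P) in
  let x : prod_manifold B F := (b, q) in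
  let X' := liftB X in let Y' := liftB Y in
  let Z' := liftB Z in let T' := liftB T in
  let U' := liftF U in let V' := liftF V in
  let W' := liftF W in let Q' := liftF Q in
  let gb := fun S1 S2 : vfield B => inner gB S1 S2 b in
  let gf := fun S1 S2 : vfield F => inner gF S1 S2 q in
  let KF := fun S1 S2 S3 : vfield F => koszul gF S1 S2 S3 q in
  let c := f b in
  (Rbar X' Y' Z' T' x =
     riemann gB X Y Z T b
     + c ^+ 2 * gb X Z * gf P P * gb Y T
     - c ^+ 2 * gb Y Z * gf P P * gb X T) /\
  (Rbar X' Y' Z' Q' x = - Rbar Z' Q' X' Y' x /\
   Rbar X' Y' Z' Q' x =
     - c * act X f b * gb Y Z * gf P Q
     + c * act Y f b * gb X Z * gf P Q) /\
  (Rbar X' Y' W' Q' x = 0 /\ Rbar W' Q' X' Y' x = 0) /\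
  (Rbar X' V' W' T' x =
     - c * hessian gB f X T b * gf V W
     - (KF V P W + c ^+ 2 * gf P P * gf V W - c ^+ 2 * gf V P * gf P W)
       * c ^+ 2 * gb X T) /\
  (Rbar U' V' Z' Q' x = - Rbar Z' Q' U' V' x /\
   Rbar U' V' Z' Q' x =
     c ^+ 3 * act Z f b * (- gf P U * gf Q V + gf P V * gf Q U)) /\
  (Rbar U' V' W' Q' x =
     c ^+ 2 * riemann gF U V W Q q
     + c ^+ 2 * coinner gB (dform f) (dform f) b
       * (gf U W * gf V Q - gf V W * gf U Q)
     - c ^+ 6 * gf V P * gf U W * gf P Q
     + c ^+ 6 * gf U P * gf V W * gf P Q
     + c ^+ 4 * KF U P W * gf V Q
     - c ^+ 4 * KF V P W * gf U Q
     - c ^+ 4 * KF U P Q * gf V W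
     + c ^+ 4 * KF V P Q * gf U W
     + c ^+ 6 * gf P P * gf U W * gf V Q
     - c ^+ 6 * gf U P * gf P W * gf V Q
     - c ^+ 6 * gf P P * gf V W * gf U Q
     + c ^+ 6 * gf V P * gf P W * gf U Q).
Proof.
move=> Rbar x X' Y' Z' T' U' V' W' Q' gb gf KF c.
split; first exact: curvature_BBBB.
have E2 : Rbar X' Y' Z' Q' x = _ := curvature_BBBF hf hgB hgF hgB0 hP hX hY hZ hQ b q.
have E2' : Rbar Z' Q' X' Y' x = _ := curvature_BFBB hf hgB hgF hgB0 hP hX hY hZ hQ b q.
split; first by split; [rewrite E2 E2'; gen_atoms; ring|exact: E2].
split; first by split; [exact: curvature_BBFF|exact: curvature_FFBB].
split; first exact: curvature_BFFB.
have E5 : Rbar U' V' Z' Q' x = _ := curvature_FFBF hf hgB hgF hgB0 hgFs hP hZ hU hV hQ b q.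
have E5' : Rbar Z' Q' U' V' x = _ := curvature_BFFF hf hgB hgF hgB0 hgFs hP hZ hU hV hQ b q.
split; first by split; [rewrite E5 E5' opprK|exact: E5].
exact: curvature_FFFF.
Qed.
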